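(* Let an arbitrary Markov chain on an arbitrary measurable space $(X,\Sigma)$ satisfy the condition $\Delta_{ba}\subset ca(X,\Sigma)$, i.e. all invariant finitely additive measures of the chain are countably additive (in other words, the chain has no invariant purely finitely additive measures). Then the space $M_{ca}$ of invariant countably additive measures of the chain is finite-dimensional, $\dim\Delta_{ba}=\dim\Delta_{ca}=d<\infty$; to it there corresponds a finite-dimensional projector $E(1,A)$ with eigenvalue $\lambda=1$; and $$\frac1n\sum_{i=1}^{n}A^i\to E(1,A)\quad\text{as } n\to\infty$$ in the uniform operator topology (operator norm) on $ca(X,\Sigma)$, i.e. uniformly over all initial countably additive measures in $S_{ca}$.
   Context: $X$ is an arbitrary infinite set and $\Sigma$ is a $\sigma$-algebra of subsets of $X$ containing all singletons. $B(X,\Sigma)$ is the Banach space of bounded $\Sigma$-measurable functions $f:X\to\mathbb{R}$ with the sup-norm. $ba(X,\Sigma)$ is the Banach space of bounded finitely additive measures $\mu:\Sigma\to\mathbb{R}$ with the total variation norm, and $ca(X,\Sigma)$ is its subspace of countably additive measures. A nonnegative $\mu\in ba(X,\Sigma)$ is purely finitely additive if the only countably additive $\lambda$ with $0\le\lambda\le\mu$ is $\lambda=0$; a signed $\mu$ is purely finitely additive if both parts $\mu^+,\mu^-$ of its Jordan decomposition are. $S_{ba}=\{\mu\in ba(X,\Sigma):\mu\ge 0,\ \|\mu\|=1\}$, $S_{ca}=S_{ba}\cap ca(X,\Sigma)$. A Markov chain is given by a transition function $p(x,E)$, $x\in X$, $E\in\Sigma$, with $0\le p(x,E)\le 1$,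 $p(x,X)=1$, $p(\cdot,E)\in B(X,\Sigma)$ for all $E\in\Sigma$, and $p(x,\cdot)\in ca(X,\Sigma)$ for all $x\in X$. The Markov operator $A:ba(X,\Sigma)\to ba(X,\Sigma)$ is $A\mu(E)=\int_X p(x,E)\,\mu(dx)$; it maps $ca(X,\Sigma)$ into itself, and in the convergence statement $A$ is considered as an operator on $ca(X,\Sigma)$. $\Delta_{ba}=\{\mu\in S_{ba}: A\mu=\mu\}$, $\Delta_{ca}=\{\mu\in S_{ca}: A\mu=\mu\}$; $M_{ba}$ and $M_{ca}$ are the linear subspaces of all invariant measures ($A\mu=\mu$) in $ba(X,\Sigma)$ and $ca(X,\Sigma)$; they are the linear spans of $\Delta_{ba}$ and $\Delta_{ca}$, and $\dim\Delta_{ba}:=\dim M_{ba}$, $\dim\Delta_{ca}:=\dim M_{ca}$. $E(1,A)$ denotes the (spectral) projector of $ca(X,\Sigma)$ onto the eigenspace $M_{ca}$ of $A$ for the eigenvalue $1$. *)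

(* Defs.v *)
From HB Require Import structures.
From mathcomp Require Import all_boot all_order all_algebra.
From mathcomp Require Import all_classical all_reals all_analysis.

Set Implicit Arguments.
Unset Strict Implicit.
Unset Printing Implicit Defensive.

Import Order.TTheory GRing.Theory Num.Theory.
Import numFieldNormedType.Exports.
Import HBSimple.

Local Open Scope classical_set_scope.
Local Open Scope ring_scope.

(* A set function on the sigma-algebra of X is encoded as a function
   [set X -> R] that vanishes off the sigma-algebra (see [ba]).  With this
   normalisation, Leibniz equality is equality on measurable sets, and the
   vector space structure is the pointwise one of [set X -> R]. *)

Section set_functions.
Context {R : realType} {d : measure_display} {X : measurableType d}.
Implicit Types (mu : set X -> R) (V : set (set X -> R)).

Definition ba : set (set X -> R) := [set mu |
  [/\ forall B, ~ measurable B -> mu B = 0,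
      measure_function.additive (EFin \o mu) &
      exists M : R, forall B, measurable B -> `|mu B| <= M]].

Definition ca : set (set X -> R) := [set mu |
  ba mu /\ measure_function.sigma_additive (EFin \o mu)].

(* Total variation: supremum over the finite measurable partitions of X. *)
Definition tv_norm mu : \bar R := ereal_sup [set s : \bar R |
  exists (n : nat) (F : 'I_n -> set X),
    [/\ forall i, measurable (F i), trivIset [set: 'I_n] F,
        \bigcup_(i in [set: 'I_n]) F i = [set: X] &
        s = (\sum_(i < n) `|mu (F i)|%:E)%E]].

Definition S_ba : set (set X -> R) := [set mu |
  [/\ ba mu, forall B, measurable B -> 0 <= mu B & tv_norm mu = 1%E]].

Definition S_ca : set (set X -> R) := S_ba `&` ca.

(* Integral of a bounded measurable function against a bounded finitely
   additive measure (Dunford-Schwartz): limit of the integrals of simple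
   functions converging uniformly to the integrand. *)
Definition is_ba_integral mu (f : X -> R) (I : R) : Prop :=
  exists g : nat -> {sfun X >-> R},
    {uniform, (fun n => g n : X -> R) @ \oo --> f} /\
    fine (sintegral (EFin \o mu) (g n)) @[n --> \oo] --> I.

Definition ba_integral mu (f : X -> R) : R := get (is_ba_integral mu f).

(* Operators on a subspace V are total functions on [set X -> R]; only their
   values on V matter. *)

Definition bounded_linear_on V (T : (set X -> R) -> set X -> R) : Prop :=
  (forall (a : R) mu nu, V mu -> V nu -> T (a *: mu + nu) = a *: T mu + T nu) /\
  exists2 M : R, 0 <= M &
    forall mu, V mu -> (tv_norm (T mu) <= M%:E * tv_norm mu)%E.

Definition op_norm V (T : (set X -> R) -> set X -> R) : \bar R :=
  ereal_sup [set tv_norm (T mu) | mu in [set mu | V mu /\ (tv_norm mu <= 1)%E]].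

Definition eigenspace_on V (T : (set X -> R) -> set X -> R) (lambda : R) :
  set (set X -> R) := [set mu | V mu /\ T mu = lambda *: mu].

(* lambda belongs to the resolvent set of the restriction of T to K. *)
Definition in_resolvent_set K (T : (set X -> R) -> set X -> R) (lambda : R) :=
  exists S : (set X -> R) -> set X -> R,
    [/\ forall mu, K mu -> K (S mu), bounded_linear_on K S &
        forall mu, K mu -> S (lambda *: mu - T mu) = mu /\
                           lambda *: S mu - T (S mu) = mu].

(* E is the spectral (Riesz) projector of T : V -> V for an eigenvalue lambda
   whose spectral subspace is the eigenspace: a bounded projector commuting
   with T, onto the eigenspace (where T is lambda times the identity), while
   lambda is not in the spectrum of T on the complementary subspace.  These
   conditions determine E on V. *)
Definition spectral_projector V (T : (set X -> R) -> set X -> R) (lambda : R)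
    (E : (set X -> R) -> set X -> R) : Prop :=
  [/\ exists2 mu, eigenspace_on V T lambda mu & mu <> 0,
      bounded_linear_on V E,
      E @` V = eigenspace_on V T lambda /\
        (forall mu, V mu -> E (E mu) = E mu),
      forall mu, V mu -> E (T mu) = T (E mu) &
      in_resolvent_set [set mu | V mu /\ E mu = 0] T lambda].

Definition cesaro_mean (T : (set X -> R) -> set X -> R) (n : nat) mu :
    set X -> R :=
  n%:R^-1 *: \sum_(1 <= i < n.+1) iter i T mu.

End set_functions.

Section markov.
Context {R : realType} {d : measure_display} {X : measurableType d}.
Variable p : R.-pker X ~> X.

Definition markov_op (mu : set X -> R) : set X -> R := fun B =>
  if `[< measurable B >] then ba_integral mu (fun x => fine (p x B)) else 0.

Definition Delta_ba : set (set X -> R) :=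
  [set mu | S_ba mu /\ markov_op mu = mu].

Definition M_ba : set (set X -> R) := [set mu | ba mu /\ markov_op mu = mu].

Definition M_ca : set (set X -> R) := [set mu | ca mu /\ markov_op mu = mu].

End markov.

Definition has_dim {R : fieldType} {V : lmodType R} (M : set V) (n : nat) :=
  exists e : 'I_n -> V,
    [/\ forall i, M (e i),
        forall c : 'I_n -> R, \sum_i c i *: e i = 0 -> forall i, c i = 0 &
        forall v, M v -> exists c : 'I_n -> R, v = \sum_i c i *: e i].

(* Main.v *)
(* Writing T for the Markov operator and T_n for its Cesaro means, everything
   rests on one compactness remark: a limit along an ultrafilter of charges
   lam_n with T lam_n - lam_n -> 0 is an invariant charge, hence countably
   additive, so that lam_n (F_n) -> 0 whenever F_n decreases to the empty set.

   - For a fixed countably additive nu, T_n nu converges in total variation: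
     for some n all but a small part of T_n nu is dominated by a multiple of an
     invariant probability mu, and there von Neumann's argument in L^2(mu)
     applies, in a form that only uses integrals of bounded functions.
   - Applied to Dirac masses this gives pointwise convergence to 0 of
     x |-> (T_n - T_k) delta_x (B_n); integrating against T_n nu_n, Egorov's
     theorem and the remark above make (T_n - T_k) T_n small in operator norm.
     Hence T_n converges uniformly to a projector E.
   - On the kernel of E some T_n is a contraction; this bounds 1 - T from below,
     and the potentials Q_n, with (1 - T) Q_n = 1 - T_n, converge to its inverse.
   - By the remark there is no infinite sequence of invariant probabilities
     carried by disjoint sets. So there are finitely many atoms of the cone of
     positive invariant measures, and subtracting them greedily exhausts it. *)

Require Import Defs.
From HB Require Import structures.
From mathcomp Require Import all_boot all_order all_algebra.
From mathcomp Require Import all_classical all_reals all_analysis.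
From mathcomp Require Import measurable_realfun ring lra.
Import Order.TTheory GRing.Theory Num.Theory.
Import numFieldNormedType.Exports.
Local Open Scope classical_set_scope.
Local Open Scope ring_scope.

Set Implicit Arguments.
Unset Strict Implicit.
Unset Printing Implicit Defensive.

Import HBSimple.

(** * Finitely additive measures and their integrals *)

Section charges.
Context {R : realType} {d : measure_display} {X : measurableType d}.
Implicit Types (mu nu : set X -> R) (f g h : X -> R) (A B : set X).

(** The averages T_n nu_n along varying initial measures need not converge in norm. Compactness is
    available only setwise, along ultrafilters, and a setwise limit does not see the total
    variation. This is the reason for the product (T_n - T_k) T_n. The inner average makes the
    measures asymptotically invariant, which the compactness remark requires; the outer difference,
    moved to the dual side, becomes a sequence of functions tending to 0 pointwise. The sets B_n
    must be allowed to vary with n, because it is the supremum over all measurable sets that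
    controls the total variation.

    Densities are avoided altogether: the squared L^2(mu)-norm of the density of kappa is the
    supremum of 2 kappa(g) - mu(g^2) over bounded g. As a supremum of affine functions of kappa it
    is convex, so it survives averaging, and Jensen's inequality for the dual operator shows that T
    does not increase it. The parallelogram law is recovered by testing with g + h and g - h. *)

Definition finite_partition (I : finType) (F : I -> set X) :=
  [/\ forall i, measurable (F i),
      forall i j x, F i x -> F j x -> i = j &
      forall x, exists i, F i x].

Lemma ba_set0 mu : ba mu -> mu set0 = 0.
Proof.
case=> _ /(_ (fun=> set0) (fun=> measurable0)) + _.
move=> /(_ (@trivIset_set0 _ _ _) 0%N).
by rewrite !big_ord0 => -[].
Qed.

Lemma baU mu A B : ba mu -> measurable A -> measurable B -> A `&` B = set0 ->
  mu (A `|` B) = mu A + mu B.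
Proof.
move=> bmu mA mB AB; have [_ + _] := bmu.
move=> /(_ (bigcup2 A B)) /=.
have mF i : measurable (bigcup2 A B i) by case: i => [|[|i]] /=.
have tF : trivIset setT (bigcup2 A B).
  apply/trivIsetP => i j _ _.
  by case: i j => [|[|i]] [|[|j]]; rewrite /bigcup2 //= ?setI0 ?set0I // setIC.
move=> /(_ mF tF 2%N); rewrite !big_ord_recl !big_ord0 /= setU0 adde0.
by case.
Qed.

Lemma baDI mu A B : ba mu -> measurable A -> measurable B ->
  mu A = mu (A `&` B) + mu (A `\` B).
Proof.
move=> bmu mA mB; rewrite -(baU bmu).
- by rewrite setUIDK.
- exact: measurableI.
- exact: measurableD.
- by rewrite -subset0 => x [[_ Bx] [_]].
Qed.

Lemma baD mu A B : ba mu -> measurable A -> measurable B -> B `<=` A ->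
  mu (A `\` B) = mu A - mu B.
Proof.
move=> bmu mA mB BA; rewrite (baDI bmu mA mB) setIC.
by move/setIidPl: BA => ->; rewrite addrAC subrr add0r.
Qed.

Lemma baP mu : (forall B, ~ measurable B -> mu B = 0) -> mu set0 = 0 ->
  (forall A B, measurable A -> measurable B -> A `&` B = set0 ->
    mu (A `|` B) = mu A + mu B) ->
  (exists M : R, forall B, measurable B -> `|mu B| <= M) -> ba mu.
Proof.
move=> mu_off mu0 muU mub; split=> // F mF tF n /=.
elim: n => [|n IHn]; first by rewrite !big_ord0 /= mu0.
rewrite !big_ord_recr /= muU //.
- by rewrite EFinD IHn.
- by apply: bigsetU_measurable.
- rewrite -subset0 => x [+ Fnx]; rewrite -bigcup_mkord => -[i /= ilt Fix].
  have ein : i = n by apply: tF => //; exists x.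
  by move: ilt; rewrite ein ltnn.
Qed.

Lemma ba_bigU mu (I : finType) (P : pred I) (F : I -> set X) : ba mu ->
  (forall i, measurable (F i)) -> (forall i j x, F i x -> F j x -> i = j) ->
  mu (\big[setU/set0]_(i | P i) F i) = \sum_(i | P i) mu (F i).
Proof.
move=> bmu mF dF.
have := index_enum_uniq I.
elim: (index_enum I) => [|i s IHs] /=; first by rewrite !big_nil (ba_set0 bmu).
move=> /andP[nis us]; rewrite !big_cons; case: ifP => _; last exact: IHs.
rewrite (baU bmu) ?IHs //; first exact: bigsetU_measurable.
rewrite -subset0 => x [Fix]; rewrite -bigcup_seq_cond /=.
by move=> [j /= /andP[js _] Fjx]; move: nis; rewrite (dF _ _ _ Fix Fjx) js.
Qed.

(** A real-valued substitute for an upper bound on [tv_norm], by [tvleP]; it keeps all estimates out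
    of the extended reals. *)
Definition tvle mu (V : R) := forall n (F : 'I_n -> set X),
  finite_partition F -> \sum_i `|mu (F i)| <= V.

Lemma tvle_fin mu V (I : finType) (F : I -> set X) :
  tvle mu V -> finite_partition F -> \sum_i `|mu (F i)| <= V.
Proof.
move=> muV [mF dF cF].
rewrite (reindex (@enum_val I predT)) /=; last first.
  by apply: onW_bij; apply: enum_val_bij.
apply: (muV _ (fun i => F (enum_val i))); split=> [i|i j x Fi Fj|x].
- exact: mF.
- exact: enum_val_inj (dF _ _ _ Fi Fj).
- by have [i Fi] := cF x; exists (enum_rank i); rewrite enum_rankK.
Qed.

Lemma tvleP mu V : (tv_norm mu <= V%:E)%E <-> tvle mu V.
Proof.
split=> [muV n F [mF dF cF]|muV].
  rewrite -lee_fin; apply: le_trans muV; apply: ereal_sup_ubound.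
  exists n, F; split => //; last by rewrite -sumEFin.
    by apply/trivIsetP => i j _ _ ij; rewrite -subset0 => x [Fi Fj];
       move: ij; rewrite (dF _ _ _ Fi Fj) eqxx.
  by apply/seteqP; split=> // x _; have [i Fix] := cF x; exists i.
apply: ge_ereal_sup => _ [n [F [mF tF cF ->]]].
rewrite sumEFin lee_fin; apply: muV; split=> // [i j x Fi Fj|x].
  by apply: (tF i j) => //; exists x.
have : [set: X] x by []. by rewrite -cF => -[i _ Fi]; exists i.
Qed.

(** The blocks of nonnegative value have a union of value at most V, and so, up to sign, do the
    remaining blocks; hence the factor 2. *)
Lemma ba_tvle mu V : ba mu -> (forall B, measurable B -> `|mu B| <= V) ->
  tvle mu (V *+ 2).
Proof.
move=> bmu muV n F [mF dF cF].
rewrite (bigID (fun i => 0 <= mu (F i))) /=.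
rewrite mulr2n; apply: lerD.
  under eq_bigr => i /ger0_norm -> do [].
  rewrite -(ba_bigU _ bmu mF dF).
  by apply: le_trans (ler_norm _) (muV _ _); apply: bigsetU_measurable.
under eq_bigr => i do rewrite -ltNge => /ltr0_norm -> .
rewrite sumrN -(ba_bigU _ bmu mF dF).
apply: le_trans (ler_norm _) _; rewrite normrN.
by apply: muV; apply: bigsetU_measurable.
Qed.

Lemma ba_tvle_ex mu : ba mu -> exists2 V, 0 < V & tvle mu V.
Proof.
move=> bmu; have [_ _ [M muM]] := bmu.
exists (Num.max 1 M *+ 2); first by rewrite pmulrn_lgt0 // lt_max ltr01.
by apply: (ba_tvle bmu) => B mB; rewrite le_max muM ?orbT.
Qed.

Definition sint mu (g : {sfun X >-> R}) : R := fine (sintegral (EFin \o mu) g).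

(** The simple integral sums over the level sets of g. Grouping the blocks by their coefficient
    allows any finer partition, hence a common one for two functions. *)
Lemma sint_partition mu (g : {sfun X >-> R}) (I : finType) (F : I -> set X)
    (c : I -> R) : ba mu -> finite_partition F ->
  (forall i x, F i x -> g x = c i) -> sint mu g = \sum_i c i * mu (F i).
Proof.
move=> bmu [mF dF cF] gc.
have fr : finite_set (range g) by exact: fimfunP.
rewrite /sint /sintegral.
rewrite -(fsbig_widen (range g) setT)//=; last first.
  by move=> x [_ Nfx] /=; rewrite preimage10// (ba_set0 bmu) mule0.
rewrite fsbig_finite //=.
under eq_bigr do rewrite -EFinM.
rewrite sumEFin /=.
have gE z : z * mu (g @^-1` [set z]) = \sum_(i | c i == z) c i * mu (F i).
  have -> : g @^-1` [set z] = \big[setU/set0]_(i | c i == z) F i.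
    rewrite -(bigcup_pred [pred i | c i == z]); apply/seteqP; split=> [x /= gx|x [i]].
      have [i Fix] := cF x; exists i => //; apply/eqP; rewrite -(gc _ _ Fix); exact: gx.
    by move=> /eqP <- Fix; exact: gc.
  rewrite (ba_bigU _ bmu mF dF) mulr_sumr.
  by apply: eq_bigr => i /eqP ->.
under eq_bigr do rewrite gE.
rewrite (exchange_big_dep predT) //=; apply: eq_bigr => i _.
(* The coefficient of an empty block is unconstrained and may lie outside the range of g, but it is
   multiplied by 0. *)
have [/eqP F0|/set0P[x Fx]] := boolP (F i == set0).
  by rewrite F0 (ba_set0 bmu) big1 // => *; rewrite mulr0.
rewrite (big_rem (c i)) /=; last first.
  by rewrite in_fset_set // inE; exists x => //; apply: gc.
rewrite eqxx big1_seq ?addr0 // => z /andP[/eqP <-].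
by rewrite mem_rem_uniqF ?finmap.fset_uniq.
Qed.

Lemma sfun_partition2 (g h : {sfun X >-> R}) :
  exists (I : finType) (F : I -> set X) (c e : I -> R), finite_partition F /\
    forall i x, F i x -> g x = c i /\ h x = e i.
Proof.
have fr (k : {sfun X >-> R}) :
    exists s : seq R, forall x, k x \in s.
  have fk : finite_set (range k) by exact: fimfunP.
  exists (finmap.enum_fset (fset_set (range k))) => x.
  by rewrite in_fset_set // inE; exists x.
have [s gs] := fr g; have [t ht] := fr h.
pose F (i : seq_sub s * seq_sub t) :=
  g @^-1` [set ssval i.1] `&` h @^-1` [set ssval i.2].
exists (seq_sub s * seq_sub t)%type, F, (fun i => ssval i.1), (fun i => ssval i.2).
split; last by move=> i x [].
split => [i|[i1 i2] [j1 j2] x [/= gi hi] [/= gj hj]|x].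
- by apply: measurableI; apply: measurable_funPTI.
- have -> : i1 = j1 by apply: val_inj; exact: etrans (esym gi) gj.
  by have -> : i2 = j2 by apply: val_inj; exact: etrans (esym hi) hj.
- by exists (SeqSub (gs x), SeqSub (ht x)).
Qed.

Lemma sint_lin mu (a : R) (g h k : {sfun X >-> R}) : ba mu ->
  (forall x, k x = a * g x + h x) -> sint mu k = a * sint mu g + sint mu h.
Proof.
move=> bmu kE; have [I [F [c [e [pF gh]]]]] := sfun_partition2 g h.
rewrite (sint_partition (g := g) (c := c) bmu pF); last by move=> i x /gh[].
rewrite (sint_partition (g := h) (c := e) bmu pF); last by move=> i x /gh[].
rewrite (sint_partition (c := fun i => a * c i + e i) bmu pF); last first.
  by move=> i x /gh[<- <-]; exact: kE.
rewrite mulr_sumr -big_split /=; apply: eq_bigr => i _.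
by rewrite mulrDl mulrA.
Qed.

Lemma sint_close mu V (eps : R) (g h : {sfun X >-> R}) : ba mu -> tvle mu V ->
  0 <= eps -> (forall x, `|g x - h x| <= eps) -> `|sint mu g - sint mu h| <= eps * V.
Proof.
move=> bmu muV eps0 ghe; have [I [F [c [e [pF gh]]]]] := sfun_partition2 g h.
rewrite (sint_partition (g := g) (c := c) bmu pF); last by move=> i x /gh[].
rewrite (sint_partition (g := h) (c := e) bmu pF); last by move=> i x /gh[].
rewrite -sumrB; apply: le_trans (ler_norm_sum _ _ _) _.
apply: le_trans (ler_wpM2l eps0 (tvle_fin muV pF)).
rewrite mulr_sumr; apply: ler_sum => i _.
have [/eqP F0|/set0P[x Fx]] := boolP (F i == set0).
  by rewrite F0 (ba_set0 bmu) !mulr0 subrr normr0 mulr0.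
rewrite -mulrBl normrM ler_wpM2r //.
by have [<- <-] := gh _ _ Fx.
Qed.

Lemma sint_indic mu A (mA : measurable A) : ba mu -> sint mu (indic_sfun _ mA) = mu A.
Proof.
move=> bmu.
rewrite (sint_partition (F := fun b : bool => if b then A else ~` A)
  (c := fun b : bool => b%:R) bmu).
- by rewrite big_bool /= mul1r mul0r addr0.
- split=> [[]|[] [] x //|x]; [exact: mA|exact: measurableC|].
  by have [Ax|nAx] := pselect (A x); [exists true|exists false].
- by case=> x /= Ax; have -> : indic_sfun _ mA x = \1_A x :> R by [];
    rewrite indicE; [rewrite mem_set|rewrite memNset].
Qed.

Definition bmf f := measurable_fun [set: X] f /\ exists C : R, forall x, `|f x| <= C.

(** The sum is e times the number of i with 1 <= i <= N and i e <= y: y rounded down to the grid of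
    step e, capped at N e. *)
Lemma staircase (y e : R) (N : nat) : 0 < e -> 0 <= y ->
  let s := \sum_(i < N) e * (i.+1%:R * e <= y)%R%:R in
  [/\ s <= y, s <= N%:R * e & y <= s + e \/ s = N%:R * e].
Proof.
move=> e0 y0 /=; elim: N => [|N [IH1 IH2 IH3]].
  by rewrite big_ord0 mul0r; split => //; right.
rewrite big_ord_recr /=; set s := \sum_(i < N) _ in IH1 IH2 IH3 *.
have -> : N.+1%:R * e = N%:R * e + e by rewrite -natr1 mulrDl mul1r.
case: (lerP (N%:R * e + e) y) => h /=; rewrite ?mulr1 ?mulr0 ?addr0.
  by split; [|by rewrite lerD2r|]; case: IH3 => H; first [lra|right; lra|left; lra].
by split; [|lra|left; case: IH3 => H; lra].
Qed.

Lemma bmf_sfun f (e : R) : bmf f -> 0 < e ->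
  exists g : {sfun X >-> R}, forall x, `|f x - g x| <= e.
Proof.
move=> [mf [C fC]] e0.
(* Enough steps for N e to exceed 2 C, hence f + C, so that the cap of the staircase does no
   harm. *)
pose N := (Num.truncn (2 * C / e)).+1.
have mA i : measurable [set x | i.+1%:R * e <= f x + C].
  rewrite -[X in measurable X]setTI.
  have mfC : measurable_fun [set: X] (fun x => f x + C).
    by apply: measurable_funD.
  have := mfC measurableT _ (measurable_itv `[i.+1%:R * e, +oo[).
  congr (measurable _); apply/seteqP; split=> x /= [_]; rewrite in_itv /= ?andbT.
    by [].
  by move=> ?; split => //; rewrite in_itv /= andbT.
pose g : {sfun X >-> R} := cst_sfun (- C) + \sum_(i < N) cst_sfun e * indic_sfun _ (mA i).
exists g => x.
have gE : g x = - C + \sum_(i < N) e * (i.+1%:R * e <= f x + C)%R%:R.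
  rewrite sfunD /= sfun_sum; congr (_ + _); apply: eq_bigr => i _.
  rewrite sfunM /= /mindic indicE; congr (_ * _%:R).
  by congr nat_of_bool; apply/idP/idP; rewrite inE.
have fx := fC x; have fx0 : 0 <= f x + C by move: fx; rewrite ler_norml; lra.
have [s1 s2 s3] := staircase N e0 fx0.
rewrite gE; set s := \sum_(i < N) _ in s1 s2 s3 *.
have : f x + C <= N%:R * e.
  have : 2 * C / e < N%:R by rewrite truncnS_gt.
  by rewrite ltr_pdivrMr // => h; move: fx; rewrite ler_norml; lra.
by rewrite ler_norml; case: s3 => H; lra.
Qed.

End charges.

(** * The integral of bounded measurable functions *)

Section integral.
Context {R : realType} {d : measure_display} {X : measurableType d}.
Implicit Types (mu nu : set X -> R) (f g h : X -> R) (A B : set X).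

Lemma uniform_cvgP (g : nat -> X -> R) f :
  {uniform, g @ \oo --> f} <->
  forall e : R, 0 < e -> \forall n \near \oo, forall x, `|f x - g n x| < e.
Proof.
split=> [gf e e0|gf P /uniform_nbhs[E [entE EP]]].
  have fe : nbhs (f : {uniform X -> R}) [set h | forall x, ball (f x) e (h x)].
    apply/uniform_nbhs; exists [set xy | ball xy.1 e xy.2]; split.
      exact: (entourage_ball _ (PosNum e0)).
    by move=> h /= H x; exact: H.
  exact: (gf _ fe).
move: entE; rewrite -entourage_ballE => -[e /= e0 eE].
apply: filterS (gf e e0) => n H; apply: EP => x _ /=; apply: eE => /=.
exact: H.
Qed.

(** The constant K is arbitrary, so that approximation errors can be added up without normalising
    them. *)
Lemma eq_eps (a b K : R) : (forall e : R, 0 < e -> `|a - b| <= e * K) -> a = b.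
Proof.
move=> abK; apply/eqP; rewrite -subr_eq0 -normr_le0; apply/ler_addgt0Pr => e e0.
rewrite add0r; have complement0 : 0 < `|K| + 1 by rewrite ltr_wpDl.
have := abK (e / (`|K| + 1)) (divr_gt0 e0 complement0); move/le_trans; apply.
rewrite -mulrA ler_piMr ?(ltW e0)// mulrC ler_pdivrMr // mul1r.
by rewrite (le_trans (ler_norm K))// lerDl.
Qed.

(** This replaces the definition through [get] everywhere else. Two simple functions close to f are
    close to each other, so their integrals are too; this gives the existence of the integral and
    the error bound for an arbitrary g. *)
Lemma ba_int_approx mu V f (e : R) (g : {sfun X >-> R}) : ba mu -> bmf f ->
  tvle mu V -> 0 <= e -> (forall x, `|f x - g x| <= e) ->
  `|ba_integral mu f - sint mu g| <= e * V.
Proof.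
move=> bmu bf muV e0 fg.
(* The given bound V may be 0; the Cauchy argument divides by a positive one. *)
have [W W0 muW] := ba_tvle_ex bmu.
have key (k : nat -> {sfun X >-> R}) :
    {uniform, (fun n => k n : X -> R) @ \oo --> f} ->
    forall (g : {sfun X >-> R}) e V, 0 <= e -> tvle mu V -> (forall x, `|f x - g x| <= e) ->
    forall e', 0 < e' ->
    \forall n \near \oo, `|sint mu (k n) - sint mu g| <= (e + e') * V.
  move=> /uniform_cvgP kf g' e1 V1 e10 muV1 fg' e' e'0.
  apply: filterS (kf _ e'0) => n fk; apply: sint_close => //; first by lra.
  move=> x; have -> : k n x - g' x = (f x - g' x) - (f x - k n x) by lra.
  by apply: le_trans (ler_normB _ _) _; apply: lerD => //; apply: ltW.
have : exists I, is_ba_integral mu f I.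
  have /choice[k kf] n : exists k : {sfun X >-> R}, forall x, `|f x - k x| <= n.+1%:R^-1.
    by apply: bmf_sfun => //; rewrite invr_gt0.
  have kfu : {uniform, (fun n => k n : X -> R) @ \oo --> f}.
    apply/uniform_cvgP => e1 e10.
    have := near_infty_natSinv_lt (PosNum e10); apply: filterS => n /= ne x.
    exact: le_lt_trans (kf n x) ne.
  have /cauchy_cvgP/cvg_ex[l skl] : cauchy ((fun n => sint mu (k n)) @ \oo).
    apply: cauchy_exP => e1 e10.
    have e20 : 0 < e1 / 4 / W by rewrite !divr_gt0.
    have [N _ HN] := near_infty_natSinv_lt (PosNum e20).
    have fN x : `|f x - k N x| <= e1 / 4 / W.
      by apply: le_trans (kf N x) (ltW _); apply: HN => /=.
    exists (sint mu (k N)).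
    have := key _ kfu _ _ _ (ltW e20) muW fN _ e20.
    apply: filterS => n; rewrite /ball /= distrC => /le_lt_trans; apply.
    by rewrite -mulrDl mulfVK ?gt_eqF //; lra.
  by exists l, k.
move=> /getPex[k [kf kI]].
apply/ler_addgt0Pr => e1 e10.
have V10 : 0 < `|V| + 1 by rewrite ltr_wpDl.
have e20 : 0 < e1 / 2 / (`|V| + 1) by rewrite !divr_gt0.
have e120 : 0 < e1 / 2 by rewrite divr_gt0.
have H1 := key _ kf _ _ _ e0 muV fg _ e20.
move/cvgrPdist_le : kI => /(_ _ e120) H2.
have [n [H3 H4]] := filter_ex (filterI H1 H2).
have -> : ba_integral mu f - sint mu g =
  (ba_integral mu f - sint mu (k n)) + (sint mu (k n) - sint mu g) by lra.
apply: le_trans (ler_normD _ _) _; apply: le_trans (lerD H4 H3) _.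
rewrite mulrDl.
suff : e1 / 2 / (`|V| + 1) * V <= e1 / 2 by lra.
rewrite mulrAC ler_pdivrMr // ler_pM2l // (le_trans (ler_norm V)) // lerDl //.
Qed.

Lemma bmf_cst (c : R) : bmf (fun _ : X => c).
Proof. by split; [exact: measurable_cst|exists `|c|]. Qed.

Lemma bmf_lin (a : R) f h : bmf f -> bmf h -> bmf (fun x => a * f x + h x).
Proof.
move=> [mf [C fC]] [mh [D hD]]; split.
  apply: measurable_funD => //; apply: measurable_funM => //.
exists (`|a| * C + D) => x; apply: le_trans (ler_normD _ _) _.
by apply: lerD => //; rewrite normrM ler_wpM2l.
Qed.

Lemma bmfZ (a : R) f : bmf f -> bmf (fun x => a * f x).
Proof.
move=> bf; have := bmf_lin a bf (bmf_cst 0).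
by congr bmf; apply/funext => x; rewrite addr0.
Qed.

Lemma bmfD f h : bmf f -> bmf h -> bmf (fun x => f x + h x).
Proof.
move=> bf bh; have := bmf_lin 1 bf bh.
by congr bmf; apply/funext => x; rewrite mul1r.
Qed.

Lemma bmfB f h : bmf f -> bmf h -> bmf (fun x => f x - h x).
Proof.
move=> bf bh; have := bmf_lin (-1) bh bf.
by congr bmf; apply/funext => x; lra.
Qed.

Lemma bmfM f h : bmf f -> bmf h -> bmf (fun x => f x * h x).
Proof.
move=> [mf [C fC]] [mh [D hD]]; split; first exact: measurable_funM.
by exists (C * D) => x; rewrite normrM ler_pM.
Qed.

Lemma bmf_sum (I : Type) (s : seq I) (F : I -> X -> R) :
  (forall i, bmf (F i)) -> bmf (fun x => \sum_(i <- s) F i x).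
Proof.
move=> bF; elim: s => [|i s IHs].
  by have := bmf_cst 0; congr bmf; apply/funext => x; rewrite big_nil.
by have := bmfD (bF i) IHs; congr bmf; apply/funext => x; rewrite big_cons.
Qed.

Lemma bmf_indic A : measurable A -> bmf (\1_A : X -> R).
Proof.
move=> mA; split; first exact: measurable_indic.
by exists 1 => x; rewrite indicE; case: (_ \in _); rewrite ?normr1 ?normr0.
Qed.

Lemma tvle_lin (a V W : R) mu nu : tvle mu V -> tvle nu W ->
  tvle (a *: mu + nu) (`|a| * V + W).
Proof.
move=> muV nuW n F pF.
apply: le_trans (lerD (ler_wpM2l (normr_ge0 a) (muV _ _ pF)) (nuW _ _ pF)).
rewrite mulr_sumr -big_split /=; apply: ler_sum => i _.
by apply: le_trans (ler_normD _ _) _; rewrite normrM.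
Qed.

Lemma linE (a : R) mu nu B : (a *: mu + nu) B = a * mu B + nu B.
Proof. by []. Qed.

Lemma ba_lin (a : R) mu nu : ba mu -> ba nu -> ba (a *: mu + nu).
Proof.
move=> bmu bnu; have [mu_off _ [M muM]] := bmu; have [nu_off _ [N nuN]] := bnu.
apply: baP.
- by move=> B nB; rewrite linE mu_off // nu_off // mulr0 addr0.
- by rewrite linE !ba_set0 // mulr0 addr0.
- move=> A B mA mB AB; rewrite !linE !baU //.
  by lra.
- exists (`|a| * M + N) => B mB.
  apply: le_trans (ler_normD _ _) _; apply: lerD; last exact: nuN.
  by rewrite normrM ler_wpM2l // muM.
Qed.

Lemma ba_integral_lin (a : R) mu f h : ba mu -> bmf f -> bmf h ->
  ba_integral mu (fun x => a * f x + h x) =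
  a * ba_integral mu f + ba_integral mu h.
Proof.
move=> bmu bf bh; have [V V0 muV] := ba_tvle_ex bmu.
apply: (@eq_eps _ _ ((`|a| + 1) * V + `|a| * V + V)) => e e0.
have [g1 fg1] := bmf_sfun bf e0; have [g2 hg2] := bmf_sfun bh e0.
pose k : {sfun X >-> R} := cst_sfun a * g1 + g2.
have e'0 : 0 <= (`|a| + 1) * e by rewrite mulr_ge0 ?(ltW e0) ?addr_ge0.
have kE x : k x = a * g1 x + g2 x by [].
have := ba_int_approx (g := k) bmu (bmf_lin a bf bh) muV e'0.
have H x : `|a * f x + h x - k x| <= (`|a| + 1) * e.
  rewrite kE; have -> : a * f x + h x - (a * g1 x + g2 x) =
    a * (f x - g1 x) + (h x - g2 x) by lra.
  apply: le_trans (ler_normD _ _) _; rewrite normrM mulrDl mul1r.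
  by apply: lerD => //; rewrite ler_wpM2l.
move=> /(_ H); rewrite (sint_lin bmu kE) => H1.
have H2 := ba_int_approx bmu bf muV (ltW e0) fg1.
have H3 := ba_int_approx bmu bh muV (ltW e0) hg2.
set x := ba_integral _ _ in H1 *.
set y := ba_integral _ _ in H2 *.
set z := ba_integral _ _ in H3 *.
have -> : x - (a * y + z) = (x - (a * sint mu g1 + sint mu g2)) -
   a * (y - sint mu g1) - (z - sint mu g2) by lra.
apply: le_trans (ler_normB _ _) _; apply: le_trans (lerD (ler_normB _ _) H3) _.
rewrite normrM; have := ler_wpM2l (normr_ge0 a) H2; lra.
Qed.

Lemma ba_integral_meas_lin (a : R) mu nu f : ba mu -> ba nu -> bmf f ->
  ba_integral (a *: mu + nu) f = a * ba_integral mu f + ba_integral nu f.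
Proof.
move=> bmu bnu bf.
have [V V0 muV] := ba_tvle_ex bmu; have [W W0 nuW] := ba_tvle_ex bnu.
apply: (@eq_eps _ _ (`|a| * V + W + `|a| * V + W)) => e e0.
have [g fg] := bmf_sfun bf e0.
have H1 := ba_int_approx (ba_lin a bmu bnu) bf (tvle_lin a muV nuW) (ltW e0) fg.
have H2 := ba_int_approx bmu bf muV (ltW e0) fg.
have H3 := ba_int_approx bnu bf nuW (ltW e0) fg.
have [I [F [c [c2 [pF gc]]]]] := sfun_partition2 g g.
have gc' i x : F i x -> g x = c i by move=> /gc[].
have sE : sint (a *: mu + nu) g = a * sint mu g + sint nu g.
  rewrite !(sint_partition _ pF gc') //; last exact: ba_lin.
  rewrite mulr_sumr -big_split /=; apply: eq_bigr => i _.
  by rewrite linE; lra.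
rewrite sE in H1.
set p := ba_integral _ _ in H1 *.
set q := ba_integral _ _ in H2 *.
set r := ba_integral _ _ in H3 *.
have -> : p - (a * q + r) = (p - (a * sint mu g + sint nu g)) -
   a * (q - sint mu g) - (r - sint nu g) by lra.
apply: le_trans (ler_normB _ _) _; apply: le_trans (lerD (ler_normB _ _) H3) _.
rewrite normrM; have := ler_wpM2l (normr_ge0 a) H2; lra.
Qed.

Lemma ba_integralZ (a : R) mu f : ba mu -> bmf f ->
  ba_integral mu (fun x => a * f x) = a * ba_integral mu f.
Proof.
move=> bmu bf.
have z0 : ba_integral mu (fun=> 0) = 0.
  have := ba_integral_lin 1 bmu (bmf_cst 0) (bmf_cst 0).
  have -> : (fun _ : X => 1 * 0 + 0 : R) = fun=> 0 by apply/funext => x; lra.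
  lra.
have := ba_integral_lin a bmu bf (bmf_cst 0); rewrite z0 addr0 => <-.
by congr ba_integral; apply/funext => x; rewrite addr0.
Qed.

Lemma ba_integralD mu f h : ba mu -> bmf f -> bmf h ->
  ba_integral mu (fun x => f x + h x) = ba_integral mu f + ba_integral mu h.
Proof.
move=> bmu bf bh; have := ba_integral_lin 1 bmu bf bh; rewrite mul1r => <-.
by congr ba_integral; apply/funext => x; rewrite mul1r.
Qed.

Lemma ba_integralB mu f h : ba mu -> bmf f -> bmf h ->
  ba_integral mu (fun x => f x - h x) = ba_integral mu f - ba_integral mu h.
Proof.
move=> bmu bf bh; have := ba_integral_lin (-1) bmu bh bf.
rewrite mulN1r addrC => <-.
by congr ba_integral; apply/funext => x; lra.
Qed.

Lemma ba_integral_sum mu (I : Type) (s : seq I) (F : I -> X -> R) : ba mu ->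
  (forall i, bmf (F i)) ->
  ba_integral mu (fun x => \sum_(i <- s) F i x) = \sum_(i <- s) ba_integral mu (F i).
Proof.
move=> bmu bF; elim: s => [|i s IHs].
  rewrite big_nil; transitivity (0 * ba_integral mu (fun=> 0)); last by rewrite mul0r.
  rewrite -(ba_integralZ 0 bmu (bmf_cst 0)).
  by congr ba_integral; apply/funext => x; rewrite big_nil mul0r.
rewrite big_cons -IHs -ba_integralD //; last exact: bmf_sum.
by congr ba_integral; apply/funext => x; rewrite big_cons.
Qed.

Lemma ba_integral_indic mu A : ba mu -> measurable A ->
  ba_integral mu (\1_A) = mu A.
Proof.
move=> bmu mA; have [V V0 muV] := ba_tvle_ex bmu.
apply: (@eq_eps _ _ V) => e e0; rewrite -(sint_indic mA bmu).
apply: ba_int_approx => //; [exact: bmf_indic|exact: ltW|].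
by move=> x; rewrite /= /mindic subrr normr0 ltW.
Qed.

Lemma ba_integral_cst mu (c : R) : ba mu -> ba_integral mu (fun=> c) = c * mu setT.
Proof.
move=> bmu; rewrite -(ba_integral_indic bmu measurableT) -ba_integralZ //.
  by congr ba_integral; apply/funext => x; rewrite indicE in_setT mulr1.
exact: bmf_indic.
Qed.

Lemma ba_integral_le mu V f (C : R) : ba mu -> bmf f -> tvle mu V -> 0 <= C ->
  (forall x, `|f x| <= C) -> `|ba_integral mu f| <= C * V.
Proof.
move=> bmu bf muV C0 fC.
have s0 : sint mu (cst_sfun 0) = 0.
  have kE (x : X) : cst_sfun 0 x = 1 * cst_sfun 0 x + cst_sfun 0 x :> R.
    by rewrite /= mul1r addr0.
  by have := sint_lin bmu kE; lra.
have := ba_int_approx (g := cst_sfun 0) bmu bf muV C0.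
by rewrite s0 subr0; apply => x; rewrite subr0.
Qed.

(** The variation over a partition is the integral of the step function equal to the sign of mu(F i)
    on each block. *)
Lemma tvle_dual mu V : ba mu ->
  (forall g, bmf g -> (forall x, `|g x| <= 1) -> `|ba_integral mu g| <= V) ->
  tvle mu V.
Proof.
move=> bmu H n F pF; have [mF dF cF] := pF.
pose s i := if 0 <= mu (F i) then 1 else -1 : R.
pose g x := \sum_i s i * \1_(F i) x.
have bs i : bmf (fun x => s i * \1_(F i) x) by apply: bmfZ; exact: bmf_indic.
have gE : ba_integral mu g = \sum_i `|mu (F i)|.
  rewrite ba_integral_sum //; apply: eq_bigr => i _.
  rewrite ba_integralZ //; last exact: bmf_indic.
  rewrite ba_integral_indic // /s; case: lerP => h.
    by rewrite mul1r ger0_norm.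
  by rewrite mulN1r ltr0_norm.
apply: le_trans (ler_norm _) _; rewrite -gE; apply: H; first exact: bmf_sum.
move=> x; have [i Fix] := cF x.
rewrite /g (bigD1 i) //= big1 ?addr0; last first.
  move=> j ji; rewrite indicE memNset ?mulr0 // => Fjx.
  by rewrite (dF _ _ _ Fix Fjx) eqxx in ji.
by rewrite indicE mem_set // mulr1 /s; case: ifP; rewrite ?normrN normr1.
Qed.

Lemma tvle_pos mu : ba mu -> (forall B, measurable B -> 0 <= mu B) ->
  tvle mu (mu setT).
Proof.
move=> bmu mu0 n F [mF dF cF].
rewrite (eq_bigr (fun i => mu (F i))); last by move=> i _; rewrite ger0_norm ?mu0.
rewrite -(ba_bigU predT bmu mF dF) le_eqVlt; apply/orP; left; apply/eqP.
congr mu; apply/seteqP; split=> // x _.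
by have [i Fx] := cF x; rewrite -(bigcup_pred predT); exists i.
Qed.

Lemma tvle_setT mu V : tvle mu V -> `|mu setT| <= V.
Proof.
move=> /(_ 1%N (fun=> setT)); rewrite big_ord1; apply; split => //.
  by move=> i j; rewrite !ord1.
by exists ord0.
Qed.

Lemma tvle_norm mu V B : tvle mu V -> measurable B -> `|mu B| <= V.
Proof.
move=> muV mB.
have pF : finite_partition (fun b : bool => if b then B else ~` B).
  split=> [[]|[] [] //|x]; [exact: mB|exact: measurableC|].
  by have [Ax|nAx] := pselect (B x); [exists true|exists false].
have := tvle_fin muV pF; rewrite big_bool /=; apply: le_trans.
by rewrite lerDl.
Qed.

Lemma ba_integral_ge0 mu f : ba mu -> (forall B, measurable B -> 0 <= mu B) ->
  bmf f -> (forall x, 0 <= f x) -> 0 <= ba_integral mu f.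
Proof.
move=> bmu mu0 bf f0; have [_ [C0 fC0]] := bf.
pose C := Num.max 0 C0.
have fC x : f x <= C by rewrite le_max (le_trans (ler_norm _) (fC0 x)) orbT.
have C_ge0 : 0 <= C by rewrite le_max lexx.
(* Since 0 <= f <= C, the function C - f is bounded by C in absolute value, so its integral is at
   most C mu(X), the integral of C. *)
have := ba_integral_le bmu (bmfB (bmf_cst C) bf) (tvle_pos bmu mu0) C_ge0.
rewrite ba_integralB //; last exact: bmf_cst.
rewrite ba_integral_cst // => H.
have /H : forall x, `|C - f x| <= C.
  by move=> x; rewrite ger0_norm ?subr_ge0 // lerBlDr lerDl.
by rewrite ler_norml => /andP[_]; lra.
Qed.

Lemma ba_integral_mono mu f h : ba mu -> (forall B, measurable B -> 0 <= mu B) ->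
  bmf f -> bmf h -> (forall x, f x <= h x) -> ba_integral mu f <= ba_integral mu h.
Proof.
move=> bmu mu0 bf bh fh; rewrite -subr_ge0 -ba_integralB //.
by apply: ba_integral_ge0 => //; [exact: bmfB|move=> x; rewrite subr_ge0].
Qed.

End integral.

(** * Countable additivity *)

Section countable.
Context {R : realType} {d : measure_display} {X : measurableType d}.
Implicit Types (mu nu : set X -> R) (f g h : X -> R) (A B : set X) (F : nat -> set X).

Definition shrinking F := [/\ forall n, measurable (F n),
  forall n, F n.+1 `<=` F n & \bigcap_n F n = set0].

Lemma shrinking_le F m n : shrinking F -> (m <= n)%N -> F n `<=` F m.
Proof.
move=> [_ dF _]; elim: n => [|n IHn]; first by rewrite leqn0 => /eqP ->.
by rewrite leq_eqVlt => /predU1P[->//|]; rewrite ltnS => /IHn; apply: subset_trans.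
Qed.

Lemma ba_le mu A B : ba mu -> (forall C, measurable C -> 0 <= mu C) ->
  measurable A -> measurable B -> A `<=` B -> mu A <= mu B.
Proof.
move=> bmu mu0 mA mB AB; rewrite -subr_ge0 -(baD bmu mB mA AB).
by apply: mu0; exact: measurableD.
Qed.

(** Continuity at the empty set is the form of countable additivity that ultrafilter limits and
    Egorov's argument deliver. *)
Lemma caP mu : ca mu <-> ba mu /\ forall F, shrinking F -> mu (F n) @[n --> \oo] --> 0.
Proof.
split=> [[bmu smu]|[bmu cmu]]; split => //.
  move=> F [mF dF F0].
  (* The differences are disjoint with union F 0, and their partial sums telescope to mu(F 0) - mu(F
     n). *)
  pose G n := F n `\` F n.+1.
  have mG n : measurable (G n) by exact: measurableD.
  have sF : shrinking F by [].
  have tG : trivIset setT G.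
    apply: ltn_trivIset => m n mn; rewrite -subset0 => x [[Fm nFm] [Fn _]].
    by apply: nFm; exact: (shrinking_le sF mn).
  have UG : \bigcup_n G n = F 0%N.
    apply/seteqP; split=> [x [n _ [Fn _]]|x F0x]; first exact: (shrinking_le sF (leq0n n)).
    apply: contrapT => nG.
    have : (\bigcap_n F n) x.
      move=> n _; elim: n => // n IHn; apply: contrapT => nF.
      by apply: nG; exists n.
    by rewrite F0.
  have sG n : \sum_(0 <= i < n) (EFin \o mu) (G i) = (mu (F 0%N) - mu (F n))%:E.
    elim: n => [|n IHn]; first by rewrite big_nil subrr.
    rewrite big_nat_recr //= IHn /G (baD bmu (mF n) (mF n.+1) (dF n)) -EFinD.
    by congr EFin; lra.
  have := smu G mG tG; rewrite UG /=.
  under eq_fun do rewrite sG.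
  move/fine_cvg => /= /(cvgB (cvg_cst (mu (F 0%N)))) /=; rewrite subrr.
  apply: cvg_trans; apply: near_eq_cvg; apply: nearW => n.
  exact: subKr.
move=> F mF tF.
pose U := \bigcup_n F n; pose T n := U `\` \big[setU/set0]_(i < n) F i.
have mU : measurable U by exact: bigcup_measurable.
have mB n : measurable (\big[setU/set0]_(i < n) F i) by exact: bigsetU_measurable.
have BU n : \big[setU/set0]_(i < n) F i `<=` U by exact: bigsetU_bigcup.
have sT : shrinking T.
  split=> [n|n|].
  - exact: measurableD.
  - by apply: setDS; rewrite big_ord_recr /=; apply: subsetUl.
  - rewrite -subset0 => x H; have [[n _ Fn] _] := H 0%N Logic.I.
    have [_ /=] := H n.+1 Logic.I; apply.
    by rewrite big_ord_recr /=; right.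
have muT n : mu (T n) = mu U - \sum_(i < n) mu (F i).
  rewrite /T (baD bmu) //; congr (_ - _).
  by have [_ /(_ F mF tF n) /= + _] := bmu; rewrite sumEFin => -[].
have sE n : (\sum_(0 <= i < n) (EFin \o mu) (F i))%E = (mu U - mu (T n))%:E.
  by rewrite big_mkord muT sumEFin; congr EFin; lra.
under eq_fun do rewrite sE.
apply: cvg_EFin; first exact: nearW.
have := cvgB (cvg_cst (mu U)) (cmu _ sT); rewrite subr0.
by apply.
Qed.

Lemma ca_lin (a : R) mu nu : ca mu -> ca nu -> ca (a *: mu + nu).
Proof.
move=> /caP[bmu cmu] /caP[bnu cnu]; apply/caP; split; first exact: ba_lin.
move=> F sF; have := cvgD (cvgM (cvg_cst a) (cmu _ sF)) (cnu _ sF).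
by rewrite mulr0 addr0; apply.
Qed.

Lemma addmE mu nu B : (mu + nu) B = mu B + nu B. Proof. by []. Qed.

Lemma oppmE mu B : (- mu) B = - mu B. Proof. by []. Qed.

Lemma submE mu nu B : (mu - nu) B = mu B - nu B. Proof. by []. Qed.

Lemma scalemE (a : R) mu B : (a *: mu) B = a * mu B. Proof. by []. Qed.

Lemma zeroE B : (0 : set X -> R) B = 0. Proof. by []. Qed.

Lemma ca0 : ca (0 : set X -> R).
Proof.
apply/caP; split; last by move=> F _; exact: cvg_cst.
by apply: baP => // [A B *|]; [rewrite zeroE addr0|exists 0 => B _; rewrite normr0].
Qed.

Lemma caZ (a : R) mu : ca mu -> ca (a *: mu).
Proof. by move=> cmu; rewrite -[_ *: _]addr0; apply: ca_lin => //; exact: ca0. Qed.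

Lemma caD mu nu : ca mu -> ca nu -> ca (mu + nu).
Proof. by move=> cmu cnu; rewrite -[mu]scale1r; exact: ca_lin. Qed.

Lemma caB mu nu : ca mu -> ca nu -> ca (mu - nu).
Proof. by move=> cmu cnu; rewrite addrC -scaleN1r; exact: ca_lin. Qed.

Lemma ba0 : ba (0 : set X -> R). Proof. by case: ca0. Qed.

Lemma baZ (a : R) mu : ba mu -> ba (a *: mu).
Proof. by move=> cmu; rewrite -[_ *: _]addr0; apply: ba_lin => //; exact: ba0. Qed.

Lemma ba_add mu nu : ba mu -> ba nu -> ba (mu + nu).
Proof. by move=> cmu cnu; rewrite -[mu]scale1r; exact: ba_lin. Qed.

Lemma ba_sub mu nu : ba mu -> ba nu -> ba (mu - nu).
Proof. by move=> cmu cnu; rewrite addrC -scaleN1r; exact: ba_lin. Qed.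

Definition restr_to mu P B := if `[< measurable B >] then mu (B `&` P) else 0.

Lemma restr_toE mu P B : measurable B -> restr_to mu P B = mu (B `&` P).
Proof. by rewrite /restr_to => mB; rewrite asboolT. Qed.

Lemma restr_to_ba mu P : ba mu -> measurable P -> ba (restr_to mu P).
Proof.
move=> bmu mP; have [_ _ [M muM]] := bmu; apply: baP.
- by move=> B nB; rewrite /restr_to asboolF.
- by rewrite restr_toE // set0I ba_set0.
- move=> A B mA mB AB; rewrite !restr_toE //; last exact: measurableU.
  rewrite setIUl baU //; [exact: measurableI|exact: measurableI|].
  by rewrite setIACA AB set0I.
- by exists M => B mB; rewrite restr_toE //; apply: muM; exact: measurableI.
Qed.

Lemma restr_to_ca mu P : ca mu -> measurable P -> ca (restr_to mu P).
Proof.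
move=> /caP[bmu cmu] mP; apply/caP; split; first exact: restr_to_ba.
move=> F [mF dF F0]; have sFP : shrinking (fun n => F n `&` P).
  split=> [n|n|]; first exact: measurableI.
    exact: setSI.
  by rewrite -subset0 -F0 => x H n _; have [] := H n Logic.I.
have := cmu _ sFP; apply: cvg_trans; apply: near_eq_cvg; apply: nearW => n.
by rewrite restr_toE.
Qed.

Lemma hahn mu : ca mu -> exists P, [/\ measurable P,
  forall B, measurable B -> B `<=` P -> 0 <= mu B &
  forall B, measurable B -> B `&` P = set0 -> mu B <= 0].
Proof.
move=> [bmu smu].
have c0 : (EFin \o mu) set0 = 0%E by rewrite /= ba_set0.
have cf B : measurable B -> (EFin \o mu) B \is a fin_num by [].
have cs : semi_sigma_additive (EFin \o mu) by move=> F mF tF _; exact: smu.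
pose cmu : {charge set X -> \bar R} :=
  HB.pack (EFin \o mu) (isCharge.Build _ _ _ (EFin \o mu) c0 cf cs).
have [P [N [[mP posP] [mN negN] PN PN0]]] := Hahn_decomposition cmu.
exists P; split => // B mB BP.
have := negN B mB; rewrite /= lee_fin; apply => x Bx.
have : [set: X] x by []. rewrite -PN => -[Px|//].
by have : (B `&` P) x by []; rewrite BP.
Qed.

(** The function C 1_G + e dominates the absolute value of f. *)
Lemma egorov_bound lam f (e C : R) (G : set X) : ba lam ->
  (forall B, measurable B -> 0 <= lam B) -> bmf f -> measurable G ->
  0 <= e -> (forall x, `|f x| <= C) -> (forall x, ~ G x -> `|f x| <= e) ->
  `|ba_integral lam f| <= e * lam setT + C * lam G.
Proof.
move=> blam lam0 bf mG e0 fC fe.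
have bi : bmf (\1_G : X -> R) by exact: bmf_indic.
have bh : bmf (fun x => C * \1_G x + e) by exact: (bmf_lin C bi (bmf_cst e)).
have fh x : `|f x| <= C * \1_G x + e.
  have [Gx|nGx] := pselect (G x).
    by rewrite indicE mem_set // mulr1 (le_trans (fC x)) // lerDl.
  by rewrite indicE memNset // mulr0 add0r fe.
have hE : ba_integral lam (fun x => C * \1_G x + e) = e * lam setT + C * lam G.
  rewrite ba_integral_lin //; last exact: bmf_cst.
  by rewrite ba_integral_indic // ba_integral_cst // addrC.
rewrite ler_norml -hE; apply/andP; split.
  rewrite -lerNl -mulN1r -ba_integralZ //.
  apply: ba_integral_mono => //; first exact: bmfZ.
  by move=> x; rewrite mulN1r; move: (fh x); rewrite ler_norml; lra.
by apply: ba_integral_mono => // x; apply: le_trans (ler_norm _) (fh x).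
Qed.

(** Dominated convergence with a varying measure. The sets F m of points where some f n with n >= m
    exceeds e1 shrink to the empty set by pointwise convergence, and f n is at most e1 off F n; the
    last hypothesis makes lam n (F n) negligible. *)
Lemma ba_integral_cvg0 (lam : nat -> set X -> R) (f : nat -> X -> R) (C M : R) :
  (forall n, ba (lam n)) -> (forall n B, measurable B -> 0 <= lam n B) ->
  (forall n, lam n setT <= M) -> (forall n, bmf (f n)) ->
  (forall n x, `|f n x| <= C) -> (forall x, f n x @[n --> \oo] --> 0) ->
  (forall F, shrinking F -> lam n (F n) @[n --> \oo] --> 0) ->
  ba_integral (lam n) (f n) @[n --> \oo] --> 0.
Proof.
move=> blam lam0 lamM bf fC f0 lamF.
have C0 : 0 <= C by apply: le_trans (normr_ge0 _) (fC 0%N point).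
have M0 : 0 <= M by apply: le_trans (lamM 0%N); apply: lam0.
apply/cvgrPdist_le => e e0.
have e10 : 0 < e / 2 / (M + 1) by rewrite !divr_gt0 // ltr_wpDl.
set e1 := e / 2 / (M + 1) in e10.
pose F m := \bigcup_(n in [set n | (m <= n)%N]) [set x | e1 < `|f n x|].
have sF : shrinking F.
  split=> [m|m|].
  - apply: bigcup_measurable => n _.
    have mf : measurable_fun [set: X] (fun x => `|f n x|).
      by apply: measurableT_comp => //; case: (bf n).
    have := mf measurableT _ (measurable_itv `]e1, +oo[).
    by rewrite setTI; congr measurable; apply/seteqP; split=> x /=; rewrite in_itv /= andbT.
  - by move=> x [n /= mn H]; exists n => //=; exact: ltnW.
  - rewrite -subset0 => x H.
    have /cvgrPdist_le/(_ _ e10)[m _ Hm] := f0 x.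
    have [n /= mn] := H m Logic.I.
    by have := Hm n mn; rewrite /= sub0r normrN => /le_lt_trans h /h; rewrite ltxx.
have [mF _ _] := sF.
have C10 : 0 < C + 1 by rewrite ltr_wpDl.
have e20 : 0 < e / 2 / (C + 1) by rewrite !divr_gt0.
have /cvgrPdist_le/(_ _ e20) := lamF _ sF; apply: filterS => n.
rewrite !sub0r !normrN (ger0_norm (lam0 _ _ (mF n))) => lFn.
have nF x : ~ F n x -> `|f n x| <= e1.
  by move=> nFx; rewrite leNgt; apply/negP => h; apply: nFx; exists n => /=.
apply: le_trans (egorov_bound (blam n) (lam0 n) (bf n) (mF n) (ltW e10) (fC n) nF) _.
have h1 : e1 * lam n setT <= e / 2.
  rewrite /e1 mulrAC ler_pdivrMr ?ltr_wpDl // ler_pM2l ?divr_gt0 //.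
  by apply: le_trans (lamM n) _; rewrite lerDl.
have h2 : C * lam n (F n) <= e / 2.
  apply: le_trans (ler_wpM2l C0 lFn) _.
  rewrite mulrCA ler_piMr ?divr_ge0 ?(ltW e0) //.
  by rewrite ler_pdivrMr // mul1r lerDl.
lra.
Qed.

End countable.

(** * The Markov operator and its dual *)

Section markov_operator.
Context {R : realType} {d : measure_display} {X : measurableType d}.
Variable p : R.-pker X ~> X.
Implicit Types (mu nu : set X -> R) (f g h : X -> R) (A B : set X) (F : nat -> set X).

Definition pos_charge mu := forall B, measurable B -> 0 <= mu B.

(** The kernel as a real set function, set to 0 off the sigma-algebra so that it satisfies [ba]. *)
Definition transition (x : X) B := if `[< measurable B >] then fine (p x B) else 0.

Lemma transitionE x B : measurable B -> transition x B = fine (p x B).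
Proof. by rewrite /transition => mB; rewrite asboolT. Qed.

Lemma transition_fin x B : measurable B -> p x B = (transition x B)%:E.
Proof.
move=> mB; rewrite transitionE // fineK //.
have : (p x B <= 1)%E.
  rewrite -(prob_kernel (s := p) x); apply: le_measure => //; rewrite inE //.
by move=> h; rewrite ge0_fin_numE // (le_lt_trans h) // ltry.
Qed.

Lemma transition_ge0 x : pos_charge (transition x).
Proof. by move=> B mB; rewrite -lee_fin -transition_fin. Qed.

Lemma transition_le1 x B : measurable B -> transition x B <= 1.
Proof.
move=> mB; rewrite -lee_fin -transition_fin // -(prob_kernel (s := p) x).
by apply: le_measure => //; rewrite inE //.
Qed.

Lemma transitionT x : transition x setT = 1.
Proof.
have := prob_kernel (s := p) x; rewrite transition_fin // => -[]; exact.
Qed.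

Lemma transition_ba x : ba (transition x).
Proof.
apply: baP.
- by move=> B nB; rewrite /transition asboolF.
- by rewrite transitionE // measure0.
- move=> A B mA mB AB; apply: EFin_inj; rewrite EFinD -!transition_fin //;
    last exact: measurableU.
  by rewrite measureU.
- by exists 1 => B mB; rewrite ger0_norm ?transition_le1 ?transition_ge0.
Qed.

Lemma transition_ca x : ca (transition x).
Proof.
split; first exact: transition_ba.
move=> F mF tF; rewrite /= -transition_fin; last exact: bigcup_measurable.
have := @measure_sigma_additive _ _ _ (p x) F mF tF.
apply: cvg_trans; apply: near_eq_cvg; apply: nearW => n.
by apply: eq_bigr => i _; rewrite transition_fin.
Qed.

Lemma bmf_transition B : measurable B -> bmf (fun x => transition x B).
Proof.
move=> mB; split.
  rewrite (_ : (fun _ => _) = fine \o p ^~ B); last first.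
    by apply/funext => x; rewrite transitionE.
  apply: measurableT_comp => //; exact: measurable_kernel.
by exists 1 => x; rewrite ger0_norm ?transition_le1 ?transition_ge0.
Qed.

Lemma markov_opE mu B : measurable B ->
  markov_op p mu B = ba_integral mu (fun x => transition x B).
Proof.
move=> mB; rewrite /markov_op asboolT //; congr ba_integral.
by apply/funext => x; rewrite transitionE.
Qed.

Lemma markov_op_off mu B : ~ measurable B -> markov_op p mu B = 0.
Proof. by move=> nB; rewrite /markov_op asboolF. Qed.

Lemma markov_op_ba mu : ba mu -> ba (markov_op p mu).
Proof.
move=> bmu; have [V V0 muV] := ba_tvle_ex bmu; apply: baP.
- exact: markov_op_off.
- rewrite markov_opE //.
  have -> : (fun x => transition x set0) = fun=> 0.
    by apply/funext => x; rewrite ba_set0 //; exact: transition_ba.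
  by rewrite ba_integral_cst // mul0r.
- move=> A B mA mB AB; rewrite !markov_opE //; last exact: measurableU.
  rewrite -ba_integralD //; try exact: bmf_transition.
  by congr ba_integral; apply/funext => x; rewrite baU //; exact: transition_ba.
- exists (1 * V) => B mB; rewrite markov_opE //; apply: ba_integral_le => //.
    exact: bmf_transition.
  by move=> x; rewrite ger0_norm ?transition_le1 ?transition_ge0.
Qed.

Lemma markov_op_lin (a : R) mu nu : ba mu -> ba nu ->
  markov_op p (a *: mu + nu) = a *: markov_op p mu + markov_op p nu.
Proof.
move=> bmu bnu; apply/funext => B.
have [mB|nB] := pselect (measurable B).
  by rewrite linE !markov_opE // ba_integral_meas_lin //; exact: bmf_transition.
by rewrite linE !markov_op_off // mulr0 addr0.
Qed.

Lemma markov_op_pos mu : ba mu -> pos_charge mu -> pos_charge (markov_op p mu).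
Proof.
move=> bmu mu0 B mB; rewrite markov_opE //; apply: ba_integral_ge0 => //.
  exact: bmf_transition.
by move=> x; exact: transition_ge0.
Qed.

Lemma markov_opT mu : ba mu -> markov_op p mu setT = mu setT.
Proof.
move=> bmu; rewrite markov_opE //.
under eq_fun do rewrite transitionT.
by rewrite ba_integral_cst // mul1r.
Qed.

(** The predual action of T on bounded measurable functions: by [ba_integral_dual], integrating f
    against T mu is integrating [dual f] against mu. *)
Definition dual f (x : X) := ba_integral (transition x) f.

Lemma bmf_cvg (h : nat -> X -> R) f (C : R) : (forall n, bmf (h n)) ->
  (forall x, h n x @[n --> \oo] --> f x) -> (forall x, `|f x| <= C) -> bmf f.
Proof.
move=> bh hf fC; split; last by exists C.
apply: (measurable_fun_cvg (h := h)) => //; first by move=> n; case: (bh n).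
Qed.

Lemma dual_le f (C : R) : bmf f -> 0 <= C -> (forall x, `|f x| <= C) ->
  forall x, `|dual f x| <= C.
Proof.
move=> bf C0 fC x; rewrite -[C]mulr1 -(transitionT x).
apply: ba_integral_le => //; first exact: transition_ba.
apply: tvle_pos; [exact: transition_ba|exact: transition_ge0].
Qed.

Lemma dual_sfun f (e : R) (g : {sfun X >-> R}) : bmf f -> 0 <= e ->
  (forall x, `|f x - g x| <= e) -> forall x, `|dual f x - sint (transition x) g| <= e.
Proof.
move=> bf e0 fg x; rewrite -[e]mulr1 -(transitionT x).
apply: ba_int_approx => //; first exact: transition_ba.
apply: tvle_pos; [exact: transition_ba|exact: transition_ge0].
Qed.

(** Duality for simple functions, where both claims reduce to finite combinations of the functions x
    |-> p(x, F i). The general case follows by uniform approximation. *)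
Lemma sint_transition (g : {sfun X >-> R}) : bmf (fun x => sint (transition x) g) /\
  forall mu, ba mu ->
    ba_integral mu (fun x => sint (transition x) g) = sint (markov_op p mu) g.
Proof.
have [I [F [c [c2 [pF gc]]]]] := sfun_partition2 g g.
have gc' i x : F i x -> g x = c i by move=> /gc[].
have [mF _ _] := pF.
have sE : (fun x => sint (transition x) g) = fun x => \sum_i c i * transition x (F i).
  by apply/funext => x; rewrite (sint_partition _ pF gc') //; exact: transition_ba.
have bi i : bmf (fun x => c i * transition x (F i)) by apply: bmfZ; exact: bmf_transition.
rewrite sE; split; first exact: bmf_sum.
move=> mu bmu; rewrite ba_integral_sum // (sint_partition _ pF gc'); last exact: markov_op_ba.
apply: eq_bigr => i _; rewrite ba_integralZ //; last exact: bmf_transition.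
by rewrite markov_opE.
Qed.

Lemma bmf_dual f : bmf f -> bmf (dual f).
Proof.
move=> bf; have [_ [C0 fC0]] := bf.
have C00 : 0 <= C0 by apply: le_trans (normr_ge0 _) (fC0 point).
have /choice[k kf] n : exists k : {sfun X >-> R}, forall x, `|f x - k x| <= n.+1%:R^-1.
  by apply: bmf_sfun => //; rewrite invr_gt0.
apply: (@bmf_cvg (fun n x => sint (transition x) (k n)) _ C0).
- by move=> n; have [] := sint_transition (k n).
- move=> x; apply/cvgrPdist_le => e e0.
  have := near_infty_natSinv_lt (PosNum e0); apply: filterS => n /= ne.
  apply: le_trans (ltW ne); apply: dual_sfun => //.
- exact: dual_le.
Qed.

Lemma ba_integral_dual mu f : ba mu -> bmf f ->
  ba_integral (markov_op p mu) f = ba_integral mu (dual f).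
Proof.
move=> bmu bf; have [V V0 muV] := ba_tvle_ex bmu.
have bA := markov_op_ba bmu; have [W W0 muW] := ba_tvle_ex bA.
apply: (@eq_eps _ _ _ (W + V)) => e e0.
have [g fg] := bmf_sfun bf e0; have [bg gE] := sint_transition g.
have H1 := ba_int_approx bA bf muW (ltW e0) fg.
have H2 := ba_integral_le bmu (bmfB (bmf_dual bf) bg) muV (ltW e0)
  (dual_sfun bf (ltW e0) fg).
rewrite ba_integralB // ?gE // in H2; last exact: bmf_dual.
set a := ba_integral _ _ in H1 *; set b := ba_integral _ _ in H2 *.
have -> : a - b = (a - sint (markov_op p mu) g) - (b - sint (markov_op p mu) g) by lra.
by apply: le_trans (ler_normB _ _) _; rewrite mulrDr; exact: lerD.
Qed.

(** Jensen's inequality: integrate (f - c)^2 >= 0 against p(x, .) with c the mean of f. *)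
Lemma dual_sqr f : bmf f -> forall x, dual f x ^+ 2 <= dual (fun y => f y * f y) x.
Proof.
move=> bf x; have bk := transition_ba x.
have b2 := bmfM bf bf.
set c := dual f x.
have := ba_integral_ge0 bk (transition_ge0 x)
  (bmfD (bmf_lin (- (2 * c)) bf b2) (bmf_cst (c ^+ 2))).
rewrite ba_integralD //; [|exact: bmf_lin|exact: bmf_cst].
rewrite ba_integral_lin // ba_integral_cst // transitionT mulr1.
rewrite -/(dual f x) -/(dual _ x) -/c => H.
have : 0 <= - (2 * c) * c + dual (fun y => f y * f y) x + c ^+ 2.
  by apply: H => y; have := sqr_ge0 (f y - c); rewrite !expr2; lra.
by rewrite !expr2; lra.
Qed.

Lemma markov_op_tvle mu V : ba mu -> tvle mu V -> tvle (markov_op p mu) V.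
Proof.
move=> bmu muV; apply: tvle_dual; first exact: markov_op_ba.
move=> g bg g1; rewrite ba_integral_dual // -[V]mul1r.
by apply: ba_integral_le => //; [exact: bmf_dual|exact: dual_le].
Qed.

Lemma markov_op_ca_pos mu : ca mu -> pos_charge mu -> ca (markov_op p mu).
Proof.
move=> /caP[bmu cmu] mu0; apply/caP; split; first exact: markov_op_ba.
move=> F sF; have [mF _ _] := sF.
under eq_fun do rewrite markov_opE //.
apply: (@ba_integral_cvg0 _ _ _ (fun=> mu) (fun n x => transition x (F n)) 1 (mu setT)) => //.
- by move=> n; exact: bmf_transition.
- by move=> n x; rewrite ger0_norm ?transition_le1 ?transition_ge0.
- by move=> x; have /caP[_] := transition_ca x; apply.
Qed.

(** The last clause makes the decomposition lossless: estimates proved on positive measures add up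
    to the total variation of mu. *)
Lemma jordan_ca mu : ca mu -> exists mp mn,
  [/\ ca mp /\ pos_charge mp, ca mn /\ pos_charge mn, mu = mp - mn &
      forall V, tvle mu V -> mp setT + mn setT <= V].
Proof.
move=> cmu; have [bmu _] := cmu; have [P [mP posP negP]] := hahn cmu.
have mPC : measurable (~` P) by exact: measurableC.
exists (restr_to mu P), (- restr_to mu (~` P)).
split.
- split; first exact: restr_to_ca.
  by move=> B mB; rewrite restr_toE // posP //; exact: measurableI.
- split; first by rewrite -scaleN1r; apply: caZ; exact: restr_to_ca.
  move=> B mB; rewrite oppmE restr_toE // oppr_ge0.
  by apply: negP; [exact: measurableI|rewrite -setIA setICl setI0].
- apply/funext => B; have [mB|nB] := pselect (measurable B); last first.
    have [off _ _] := bmu; rewrite off //.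
    by rewrite submE oppmE /restr_to !asboolF //; lra.
  rewrite submE oppmE !restr_toE //.
  by rewrite (baDI bmu mB mP) setDE; lra.
- move=> V muV.
  have pF : finite_partition (fun b : bool => if b then P else ~` P).
    split=> [[]|[] [] //|x] //.
    by have [Ax|nAx] := pselect (P x); [exists true|exists false].
  have := tvle_fin muV pF; rewrite big_bool /= oppmE !restr_toE // !setTI.
  by rewrite ger0_norm ?posP // ler0_norm ?negP // ?setICl //; lra.
Qed.

Lemma markov_op_ca mu : ca mu -> ca (markov_op p mu).
Proof.
move=> /jordan_ca[mp [mn [[cp pp] [cn pn] -> _]]].
have -> : mp - mn = (-1) *: mn + mp by rewrite scaleN1r addrC.
have [bp _] := cp; have [bn _] := cn.
by rewrite markov_op_lin //; apply: ca_lin; exact: markov_op_ca_pos.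
Qed.

End markov_operator.

(** * Ultralimits of probability charges *)

Section ultralimits.
Context {R : realType} {d : measure_display} {X : measurableType d}.
Implicit Types (mu nu : set X -> R) (f g h : X -> R) (A B : set X) (F : nat -> set X).

Definition ba_prob mu := [/\ ba mu, pos_charge mu & mu setT = 1].

Lemma tv_norm_pos mu : ba mu -> pos_charge mu -> tv_norm mu = (mu setT)%:E.
Proof.
move=> bmu mu0; apply/eqP; rewrite eq_le; apply/andP; split.
  by apply/tvleP; exact: tvle_pos.
apply: ereal_sup_ubound; exists 1%N, (fun=> setT); split => //.
- by move=> i j; rewrite !ord1.
- by apply/seteqP; split=> // x _; exists ord0.
- by rewrite big_ord1 ger0_norm // mu0.
Qed.

Lemma S_baP mu : S_ba mu <-> ba_prob mu.
Proof.
split=> [[bmu mu0 mu1]|[bmu mu0 mu1]]; split => //.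
  by move: mu1; rewrite tv_norm_pos // => -[].
by rewrite tv_norm_pos // mu1.
Qed.

Lemma prob_le1 mu B : ba_prob mu -> measurable B -> mu B <= 1.
Proof. by move=> [bmu mu0 <-] mB; apply: ba_le. Qed.

Lemma prob_norm_le1 mu B : ba_prob mu -> `|mu B| <= 1.
Proof.
move=> pmu; have [bmu mu0 _] := pmu; have [off _ _] := bmu.
have [mB|nB] := pselect (measurable B); last by rewrite off // normr0.
by rewrite ger0_norm ?prob_le1 ?mu0.
Qed.

Lemma prob_tvle mu : ba_prob mu -> tvle mu 1.
Proof. by move=> [bmu mu0 <-]; exact: tvle_pos. Qed.

Lemma cvg_real_unique (U : set_system nat) (u : nat -> R) (l m : R) : ProperFilter U ->
  u @ U --> l -> u @ U --> m -> l = m.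
Proof.
move=> PU ul um; apply: (@eq_eps _ _ _ 2) => e e0.
move/cvgrPdist_le : ul => /(_ _ e0) ul; move/cvgrPdist_le : um => /(_ _ e0) um.
have [n [/= H1 H2]] := filter_ex (filterI ul um).
have -> : l - m = (l - u n) - (m - u n) by lra.
apply: le_trans (ler_normB _ _) _; lra.
Qed.

Lemma cvg_fsum (T I : Type) (U : set_system T) (s : seq I) (u : I -> T -> R) (l : I -> R) :
  Filter U -> (forall i, u i @ U --> l i) ->
  (fun n => \sum_(i <- s) u i n) @ U --> \sum_(i <- s) l i.
Proof.
move=> FU ul; elim: s => [|i s IHs].
  rewrite big_nil (_ : (fun _ => _) = fun=> 0); first exact: cvg_cst.
  by apply/funext => n; rewrite big_nil.
rewrite big_cons (_ : (fun _ => _) = (fun n => u i n + \sum_(i <- s) u i n)).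
  exact: cvgD.
by apply/funext => n; rewrite big_cons.
Qed.

Lemma ultra_cvg (U : set_system nat) (u : nat -> R) (M : R) : UltraFilter U ->
  (forall n, `|u n| <= M) -> exists l : R, u @ U --> l.
Proof.
move=> UU uM; have PU : ProperFilter U by exact: ultra_proper.
have cM : compact `[- M, M]%classic by exact: segment_compact.
have [|l [_ cl]] := cM (u @ U) _.
  by apply: nearW => n /=; rewrite in_itv /= -ler_norml.
exists l; apply/cvgrPdist_lt => e e0.
have [//|nU] := in_ultra_setVsetC [set n | `|l - u n| < e] UU.
have nb : nbhs l (ball l e) by exact: nbhsx_ballx.
have [x [/= nx bx]] := cl [set x | ~ `|l - x| < e] (ball l e) nU nb.
by case: nx.
Qed.

Lemma ultralim_prob (U : set_system nat) (lam : nat -> set X -> R) :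
  UltraFilter U -> (forall n, ba_prob (lam n)) ->
  exists mu, ba_prob mu /\ forall B, lam n B @[n --> U] --> mu B.
Proof.
move=> UU plam; have PU : ProperFilter U by exact: ultra_proper.
have /choice[mu muE] B : exists l : R, lam n B @[n --> U] --> l.
  by apply: (@ultra_cvg _ _ 1) => n; exact: prob_norm_le1.
exists mu; split => //; have mu0 : pos_charge mu.
  move=> B mB; rewrite leNgt; apply/negP => muB.
  have e0 : 0 < - mu B / 2 by rewrite divr_gt0 // oppr_gt0.
  move/cvgrPdist_le : (muE B) => /(_ _ e0) /filter_ex[n /= H].
  have [_ /(_ _ mB) l0 _] := plam n.
  by move: H; rewrite ler_norml; lra.
split => //; last first.
  apply: (cvg_real_unique PU (muE setT)).
  have -> : (fun n => lam n setT) = fun=> 1 by apply/funext => n; case: (plam n).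
  exact: cvg_cst.
apply: baP.
- move=> B nB; apply: (cvg_real_unique PU (muE B)).
  have -> : (fun n => lam n B) = fun=> 0.
    by apply/funext => n; have [[off _ _] _ _] := plam n; rewrite off.
  exact: cvg_cst.
- apply: (cvg_real_unique PU (muE set0)).
  have -> : (fun n => lam n set0) = fun=> 0.
    by apply/funext => n; have [bl _ _] := plam n; rewrite ba_set0.
  exact: cvg_cst.
- move=> A B mA mB AB; apply: (cvg_real_unique PU (muE _)).
  have -> : (fun n => lam n (A `|` B)) = (fun n => lam n A + lam n B).
    by apply/funext => n; have [bl _ _] := plam n; rewrite baU.
  exact: cvgD.
(* A crude bound is enough: some lam n B is at most 1 and within 1 of mu B. *)
- exists 2 => B mB; rewrite ger0_norm ?mu0 // leNgt; apply/negP => muB.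
  have e0 : 0 < 1 :> R by [].
  move/cvgrPdist_le : (muE B) => /(_ _ e0) /filter_ex[n /= H].
  have := prob_le1 (plam n) mB.
  by move: H; rewrite ler_norml; lra.
Qed.

Lemma ba_integral_cvg (U : set_system nat) (lam : nat -> set X -> R) mu f :
  ProperFilter U -> (forall n, ba_prob (lam n)) -> ba_prob mu ->
  (forall B, lam n B @[n --> U] --> mu B) -> bmf f ->
  ba_integral (lam n) f @[n --> U] --> ba_integral mu f.
Proof.
move=> PU plam pmu lammu bf; apply/cvgrPdist_le => e e0.
have e30 : 0 < e / 3 by rewrite divr_gt0.
have [g fg] := bmf_sfun bf e30.
have [I [F [c [c2 [pF gc]]]]] := sfun_partition2 g g.
have gc' i x : F i x -> g x = c i by move=> /gc[].
have sE nu : ba_prob nu -> sint nu g = \sum_i c i * nu (F i).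
  by move=> [bnu _ _]; rewrite (sint_partition bnu pF gc').
have : sint (lam n) g @[n --> U] --> sint mu g.
  rewrite sE // (_ : (fun n => sint (lam n) g) = fun n => \sum_i c i * lam n (F i)).
    by apply: cvg_fsum => i; apply: cvgM => //; exact: cvg_cst.
  by apply/funext => n; rewrite sE.
move/cvgrPdist_le => /(_ _ e30); apply: filterS => n H.
have app nu : ba_prob nu -> `|ba_integral nu f - sint nu g| <= e / 3.
  move=> pnu; have [bnu _ _] := pnu.
  rewrite -[e / 3]mulr1; apply: ba_int_approx => //; last exact: ltW.
  exact: prob_tvle.
have H1 := app _ pmu; have H2 := app _ (plam n).
set a := ba_integral _ _ in H1 *; set b := ba_integral _ _ in H2 *.
have -> : a - b = (a - sint mu g) + (sint mu g - sint (lam n) g) - (b - sint (lam n) g) by lra.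
apply: le_trans (ler_normB _ _) _; apply: le_trans (lerD (ler_normD _ _) H2) _; lra.
Qed.

Variable p : R.-pker X ~> X.

(** Setwise convergence passes to integrals of bounded functions, so T lam_n tends setwise to T mu;
    it also has the same setwise limit as lam_n. *)
Lemma ultralim_invariant (U : set_system nat) (lam : nat -> set X -> R) mu :
  ProperFilter U -> (forall n, ba_prob (lam n)) -> ba_prob mu ->
  (forall B, lam n B @[n --> U] --> mu B) ->
  (forall B, measurable B ->
     markov_op p (lam n) B - lam n B @[n --> U] --> (0 : R)) ->
  markov_op p mu = mu.
Proof.
move=> PU plam pmu lammu inv; have [bmu _ _] := pmu; have [off _ _] := bmu.
apply/funext => B; have [mB|nB] := pselect (measurable B); last first.
  by rewrite markov_op_off // off.
apply: (@cvg_real_unique U (fun n => markov_op p (lam n) B)).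
  rewrite markov_opE //; under eq_fun do rewrite markov_opE //.
  by apply: ba_integral_cvg => //; exact: bmf_transition.
rewrite (_ : (fun n => _) =
    (fun n => (markov_op p (lam n) B - lam n B) + lam n B)).
  by rewrite -[mu B]add0r; apply: cvgD; [exact: inv|exact: lammu].
by apply/funext => n; rewrite subrK.
Qed.

Hypothesis inv_ca : forall mu, ba_prob mu -> markov_op p mu = mu -> ca mu.

(** Otherwise an ultrafilter concentrates on indices with lam n (F n) > e. Its limit mu is
    invariant, hence countably additive, so mu(F m) <= e/2 for some m, whereas lam n (F m) >= lam n
    (F n) > e for the selected n >= m. *)
Lemma asymptotically_invariant_shrinking (lam : nat -> set X -> R) F :
  (forall n, ba_prob (lam n)) ->
  (forall B, measurable B -> markov_op p (lam n) B - lam n B @[n --> \oo] --> (0 : R)) ->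
  shrinking F -> lam n (F n) @[n --> \oo] --> (0 : R).
Proof.
move=> plam inv sF; have [mF _ _] := sF.
apply/cvgrPdist_le => e e0; apply: contrapT => nH.
pose S := [set n | e < lam n (F n)].
(* The failure of convergence says exactly that S meets every cofinite set, so an ultrafilter can
   contain S and refine [\oo]. *)
have PW : ProperFilter (within S \oo).
  apply: Build_ProperFilter_ex => B HB; apply: contrapT => nB; apply: nH.
  have {}HB : \forall n \near \oo, S n -> B n by exact: HB.
  apply: filterS HB => n /= HB.
  rewrite sub0r normrN ger0_norm; last by have [_ + _] := plam n; apply.
  by rewrite leNgt; apply/negP => Sn; apply: nB; exists n; exact: HB.
have [U [UU WU]] := ultraFilterLemma PW.
have PU : ProperFilter U by exact: ultra_proper.
have oU : \oo `<=` U.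
  by move=> B oB; apply: WU; apply: filterS oB => n Bn _.
have US : U S by apply: WU; exact: withinT.
have [mu [pmu lammu]] := ultralim_prob UU plam.
have muinv : markov_op p mu = mu.
  apply: (ultralim_invariant PU plam pmu lammu) => B mB.
  apply: cvg_trans (inv B mB) => P; exact: oU.
have /caP[bmu /(_ _ sF)] := inv_ca pmu muinv.
have e20 : 0 < e / 2 by rewrite divr_gt0.
move/cvgrPdist_le => /(_ _ e20) /filter_ex[m] /=.
rewrite sub0r normrN => /(le_trans (ler_norm _)) muF.
have Um : U [set n | (m <= n)%N] by apply: oU; exists m.
have e30 : 0 < e / 4 by rewrite divr_gt0.
move/cvgrPdist_le : (lammu (F m)) => /(_ _ e30) H.
have [n [[/= Sn mn] Hn]] := filter_ex (filterI (filterI US Um) H).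
have [bl l0 _] := plam n.
have := ba_le bl l0 (mF n) (mF m) (shrinking_le sF mn).
by move: Hn Sn; rewrite ler_norml /S /=; lra.
Qed.

End ultralimits.

(** * Cesaro means *)

Section cesaro.
Context {R : realType} {d : measure_display} {X : measurableType d}.
Variable p : R.-pker X ~> X.
Implicit Types (mu nu kappa : set X -> R) (f g h : X -> R) (A B : set X) (F : nat -> set X).

Local Notation T := (markov_op p).
Local Notation Tm := (cesaro_mean T).

Lemma tvleW mu V W : V <= W -> tvle mu V -> tvle mu W.
Proof. by move=> VW muV n F pF; apply: le_trans (muV n F pF) VW. Qed.

Lemma tvleD mu nu V W : tvle mu V -> tvle nu W -> tvle (mu + nu) (V + W).
Proof. by move=> muV nuW; have := tvle_lin 1 muV nuW; rewrite scale1r normr1 mul1r. Qed.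

Lemma tvle0 (V : R) : 0 <= V -> tvle (0 : set X -> R) V.
Proof. by move=> V0 n F pF; rewrite big1 // => i _; rewrite zeroE normr0. Qed.

Lemma tvleZ (a : R) mu V : tvle mu V -> tvle (a *: mu) (`|a| * V).
Proof. by move=> muV; have := tvle_lin a muV (tvle0 (lexx 0)); rewrite !addr0. Qed.

Lemma tvleN mu V : tvle mu V -> tvle (- mu) V.
Proof. by move=> /(tvleZ (-1)); rewrite scaleN1r normrN normr1 mul1r. Qed.

Lemma tvleB mu nu V W : tvle mu V -> tvle nu W -> tvle (mu - nu) (V + W).
Proof. by move=> muV nuW; apply: tvleD => //; exact: tvleN. Qed.

Lemma tvle_tri mu1 mu2 mu3 V W : tvle (mu1 - mu2) V -> tvle (mu2 - mu3) W ->
  tvle (mu1 - mu3) (V + W).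
Proof. by move=> h1 h2; have := tvleD h1 h2; rewrite subrKA. Qed.

Lemma tvleC mu nu V : tvle (mu - nu) V -> tvle (nu - mu) V.
Proof. by move/tvleN; rewrite opprB. Qed.

Lemma tvle_sum (I : Type) (s : seq I) (mu : I -> set X -> R) V :
  (forall i, tvle (mu i) V) -> tvle (\sum_(i <- s) mu i) (V *+ size s).
Proof.
move=> muV; elim: s => [|i s IHs]; first by rewrite big_nil; exact: tvle0.
by rewrite big_cons mulrS; exact: tvleD.
Qed.

Lemma ba_sum (I : Type) (s : seq I) (mu : I -> set X -> R) :
  (forall i, ba (mu i)) -> ba (\sum_(i <- s) mu i).
Proof.
move=> bmu; elim: s => [|i s IHs]; first by rewrite big_nil; exact: ba0.
by rewrite big_cons; exact: ba_add.
Qed.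

Lemma ca_sum (I : Type) (s : seq I) (mu : I -> set X -> R) :
  (forall i, ca (mu i)) -> ca (\sum_(i <- s) mu i).
Proof.
move=> bmu; elim: s => [|i s IHs]; first by rewrite big_nil; exact: ca0.
by rewrite big_cons; exact: caD.
Qed.

Lemma summE (I : Type) (s : seq I) (mu : I -> set X -> R) B :
  (\sum_(i <- s) mu i) B = \sum_(i <- s) mu i B.
Proof. by elim/big_rec2: _ => // i y z _ <-. Qed.

(** The properties common to iterates, Cesaro means and potentials; [ba_operator_avg] transfers them
    to finite averages once and for all. *)
Definition ba_operator (S : (set X -> R) -> set X -> R) :=
  [/\ forall mu, ba mu -> ba (S mu),
      forall (a : R) mu nu, ba mu -> ba nu -> S (a *: mu + nu) = a *: S mu + S nu,
      forall mu, ca mu -> ca (S mu) &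
      forall mu, ba mu -> S (T mu) = T (S mu)].

Lemma ba_operator_iter i : ba_operator (iter i T).
Proof.
elim: i => [|i [IH1 IH2 IH3 IH4]] //.
split => [mu bmu|a mu nu bmu bnu|mu cmu|mu bmu] /=.
- by apply: markov_op_ba; exact: IH1.
- by rewrite IH2 // markov_op_lin //; exact: IH1.
- by apply: markov_op_ca; exact: IH3.
- by rewrite IH4.
Qed.

Lemma ba_operatorB S mu nu : ba_operator S -> ba mu -> ba nu -> S (mu - nu) = S mu - S nu.
Proof.
move=> [_ H _ _] bmu bnu.
by rewrite addrC -scaleN1r H // scaleN1r addrC.
Qed.

Lemma ba_operator_sum S (I : Type) (s : seq I) (mu : I -> set X -> R) : ba_operator S ->
  (forall i, ba (mu i)) -> S (\sum_(i <- s) mu i) = \sum_(i <- s) S (mu i).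
Proof.
move=> [_ H _ _] bmu; elim: s => [|i s IHs].
  have := H (-1) 0 0 ba0 ba0; rewrite !big_nil !scaler0 add0r => ->.
  by rewrite scaleN1r addNr.
by rewrite !big_cons -IHs -[mu i]scale1r H ?scale1r //; exact: ba_sum.
Qed.

Lemma ba_operatorZ S (a : R) mu : ba_operator S -> ba mu -> S (a *: mu) = a *: S mu.
Proof.
move=> nS bmu; have [_ H _ _] := nS.
have S0 : S 0 = 0.
  have := @ba_operator_sum S unit [::] (fun=> 0) nS.
  by rewrite !big_nil; apply => _; exact: ba0.
by rewrite -[a *: mu]addr0 H ?S0 ?addr0 //; exact: ba0.
Qed.

Lemma ba_operatorD S mu nu : ba_operator S -> ba mu -> ba nu -> S (mu + nu) = S mu + S nu.
Proof.
by move=> [_ H _ _] bmu bnu; rewrite -[mu]scale1r H // !scale1r.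
Qed.

Lemma markov_opZ (a : R) mu : ba mu -> T (a *: mu) = a *: T mu.
Proof. exact: (ba_operatorZ a (ba_operator_iter 1)). Qed.

Lemma markov_opB mu nu : ba mu -> ba nu -> T (mu - nu) = T mu - T nu.
Proof. exact: (ba_operatorB (ba_operator_iter 1)). Qed.

Lemma markov_op_sum (I : Type) (s : seq I) (mu : I -> set X -> R) :
  (forall i, ba (mu i)) -> T (\sum_(i <- s) mu i) = \sum_(i <- s) T (mu i).
Proof. exact: (ba_operator_sum s (ba_operator_iter 1)). Qed.

Lemma ba_operator_avg (a : R) (n : nat) (S : nat -> (set X -> R) -> set X -> R) :
  (forall i, ba_operator (S i)) -> ba_operator (fun mu => a *: \sum_(i < n) S i mu).
Proof.
move=> nS; have nT := ba_operator_iter 1.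
have bS i mu : ba mu -> ba (S i mu) by case: (nS i) => H _ _ _; exact: H.
split => [mu bmu|b mu nu bmu bnu|mu cmu|mu bmu].
- by apply: baZ; apply: ba_sum => i; exact: bS.
- under eq_bigr => i _ do [have [_ H _ _] := nS i; rewrite H //].
  by rewrite big_split /= -scaler_sumr scalerDr !scalerA mulrC.
- by apply: caZ; apply: ca_sum => i; case: (nS i) => _ _ H _; exact: H.
- rewrite markov_opZ; last by apply: ba_sum => i; exact: bS.
  rewrite markov_op_sum //; last by move=> i; exact: bS.
  by congr (_ *: _); apply: eq_bigr => i _; case: (nS i) => _ _ _ H; exact: H.
Qed.

Lemma cesaroE n mu : Tm n mu = n%:R^-1 *: \sum_(i < n) iter i.+1 T mu.
Proof. by rewrite /cesaro_mean big_add1 big_mkord. Qed.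

Lemma ba_operator_cesaro n : ba_operator (Tm n).
Proof.
rewrite (_ : Tm n = fun mu => n%:R^-1 *: \sum_(i < n) iter i.+1 T mu).
  exact: (ba_operator_avg n%:R^-1 n (fun i => ba_operator_iter i.+1)).
by apply/funext => mu; exact: cesaroE.
Qed.

Lemma iter_tvle i mu V : ba mu -> tvle mu V -> tvle (iter i T mu) V.
Proof.
move=> bmu muV; elim: i => // i IHi /=; apply: markov_op_tvle => //.
by have [H _ _ _] := ba_operator_iter i; exact: H.
Qed.

Lemma tvle_ge0 mu V : tvle mu V -> 0 <= V.
Proof. by move/tvle_setT; apply: le_trans. Qed.

Lemma tvle_avg n (mu : nat -> set X -> R) V : 0 <= V ->
  (forall i, (i < n)%N -> tvle (mu i) V) -> tvle (n%:R^-1 *: \sum_(i < n) mu i) V.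
Proof.
move=> V0 muV; have H i : tvle (if (i < n)%N then mu i else 0) V.
  by case: ifP => [/muV//|_]; exact: tvle0.
have := tvleZ n%:R^-1 (tvle_sum (index_enum 'I_n) (fun i : 'I_n => H i)).
rewrite (eq_bigr (fun i : 'I_n => mu i)); last by move=> i _; rewrite ltn_ord.
apply: tvleW; rewrite -[index_enum _]enumT size_enum_ord.
rewrite ger0_norm ?invr_ge0 // -(mulr_natl V) mulrA.
(* For n = 0 the inverse is 0 by convention, and V >= 0 suffices. *)
case: n {H muV} => [|n]; first by rewrite invr0 mul0r mul0r.
by rewrite mulVf ?mul1r // pnatr_eq0.
Qed.

Lemma cesaro_tvle n mu V : ba mu -> tvle mu V -> tvle (Tm n mu) V.
Proof.
move=> bmu muV; rewrite cesaroE.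
apply: (@tvle_avg n (fun i => iter i.+1 T mu)); first exact: tvle_ge0 muV.
by move=> i _; exact: iter_tvle.
Qed.

Lemma iter_prob i mu : ba_prob mu -> ba_prob (iter i T mu).
Proof.
elim: i => // i IHi /IHi[bi pi i1] /=; split; first exact: markov_op_ba.
- exact: markov_op_pos.
- by rewrite markov_opT.
Qed.

Lemma cesaro_prob n mu : ba_prob mu -> ba_prob (Tm n.+1 mu).
Proof.
move=> pmu; have [bmu _ _] := pmu; split.
- by have [H _ _ _] := ba_operator_cesaro n.+1; exact: H.
- move=> B mB; rewrite cesaroE scalemE summE mulr_ge0 ?invr_ge0 // sumr_ge0 // => i _.
  by have [_ H _] := iter_prob i.+1 pmu; exact: H.
- rewrite cesaroE scalemE summE (eq_bigr (fun=> 1)).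
    by rewrite sumr_const card_ord mulVf // pnatr_eq0.
  by move=> i _; have [_ _] := iter_prob i.+1 pmu.
Qed.

Lemma cesaro_diff n mu : ba mu ->
  T (Tm n mu) - Tm n mu = n%:R^-1 *: (iter n.+1 T mu - T mu).
Proof.
move=> bmu; have bi i : ba (iter i T mu) by have [H _ _ _] := ba_operator_iter i; exact: H.
rewrite cesaroE markov_opZ; last exact: ba_sum.
rewrite markov_op_sum //.
rewrite -scalerBr -sumrB; congr (_ *: _).
rewrite -(big_mkord predT (fun i => T (iter i.+1 T mu) - iter i.+1 T mu)).
by rewrite (@telescope_sumr_eq _ 0 n (fun i => iter i.+1 T mu)).
Qed.

Lemma cesaro_diff_tvle n mu V : ba mu -> tvle mu V ->
  tvle (T (Tm n mu) - Tm n mu) (2 * V / n%:R).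
Proof.
move=> bmu muV; rewrite cesaro_diff //.
have := tvleZ n%:R^-1 (tvleB (iter_tvle n.+1 bmu muV) (iter_tvle 1 bmu muV)).
by apply: tvleW; rewrite ger0_norm ?invr_ge0 //; set a := n%:R^-1; lra.
Qed.

(** Each shift of the initial measure by T moves the m-th mean by at most 2 V / m, by
    telescoping. *)
Lemma cesaro_iter_tvle m i mu V : ba mu -> tvle mu V ->
  tvle (Tm m (iter i T mu) - Tm m mu) (i%:R * (2 * V / m%:R)).
Proof.
move=> bmu muV; elim: i => [|i IHi]; first by rewrite subrr mul0r; exact: tvle0.
have bi : ba (iter i T mu) by have [H _ _ _] := ba_operator_iter i; exact: H.
have -> (x : R) : i.+1%:R * x = x + i%:R * x by rewrite -natr1 mulrDl mul1r addrC.
apply: tvle_tri IHi.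
have [_ _ _ H] := ba_operator_cesaro m; rewrite /= H //.
by apply: cesaro_diff_tvle => //; exact: iter_tvle.
Qed.

(** Replacing an initial measure by one of its own averages does not change the asymptotics of its
    means: average the bounds for the individual shifts. *)
Lemma cesaro_cesaro_tvle m j mu V : ba mu -> tvle mu V ->
  tvle (Tm m (Tm j.+1 mu) - Tm m mu) (j.+1%:R * (2 * V / m%:R)).
Proof.
move=> bmu muV; have bi i : ba (iter i T mu) by have [H _ _ _] := ba_operator_iter i; exact: H.
have V0 := tvle_ge0 muV.
have -> : Tm m mu = j.+1%:R^-1 *: \sum_(i < j.+1) Tm m mu.
  rewrite sumr_const card_ord -(scaler_nat j.+1 (Tm m mu)) scalerA.
  by rewrite mulVf ?scale1r // pnatr_eq0.
rewrite (cesaroE j.+1) (ba_operatorZ _ (ba_operator_cesaro m)); last exact: ba_sum.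
rewrite (ba_operator_sum _ (ba_operator_cesaro m)) //.
rewrite -scalerBr -sumrB.
apply: (@tvle_avg _ (fun i => Tm m (iter i.+1 T mu) - Tm m mu)).
  by rewrite mulr_ge0 // divr_ge0 // mulr_ge0.
move=> i ij; apply: tvleW (cesaro_iter_tvle m i.+1 bmu muV).
by rewrite ler_wpM2r ?ler_nat // divr_ge0 // mulr_ge0.
Qed.

(** The dual counterpart of the n-th Cesaro mean, see [ba_integral_cesaro]. *)
Definition cdual n f (x : X) := n%:R^-1 * \sum_(i < n) iter i.+1 (dual p) f x.

Lemma bmf_iter_dual i f : bmf f -> bmf (iter i (dual p) f).
Proof. by move=> bf; elim: i => //= i; exact: bmf_dual. Qed.

Lemma ba_integral_iter i mu f : ba mu -> bmf f ->
  ba_integral (iter i T mu) f = ba_integral mu (iter i (dual p) f).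
Proof.
move=> bmu bf; elim: i mu bmu => // i IHi mu bmu.
rewrite iterSr IHi; last exact: markov_op_ba.
by rewrite ba_integral_dual //; exact: bmf_iter_dual.
Qed.

Lemma bmf_cdual n f : bmf f -> bmf (cdual n f).
Proof.
by move=> bf; apply: bmfZ; apply: bmf_sum => i; exact: bmf_iter_dual.
Qed.

Lemma ba_integral_measZ (a : R) mu f : ba mu -> bmf f ->
  ba_integral (a *: mu) f = a * ba_integral mu f.
Proof.
move=> bmu bf.
have z : ba_integral 0 f = 0.
  have := ba_integral_meas_lin (-1) ba0 ba0 bf; rewrite scaler0 addr0 => ->; lra.
by rewrite -[a *: mu]addr0 ba_integral_meas_lin ?z ?addr0 //; exact: ba0.
Qed.

Lemma ba_integral_measD mu nu f : ba mu -> ba nu -> bmf f ->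
  ba_integral (mu + nu) f = ba_integral mu f + ba_integral nu f.
Proof.
by move=> bmu bnu bf; rewrite -[mu]scale1r ba_integral_meas_lin // scale1r mul1r.
Qed.

Lemma ba_integral_measB mu nu f : ba mu -> ba nu -> bmf f ->
  ba_integral (mu - nu) f = ba_integral mu f - ba_integral nu f.
Proof.
move=> bmu bnu bf; rewrite addrC -scaleN1r ba_integral_meas_lin //.
by rewrite mulN1r addrC.
Qed.

Lemma ba_integral_meas_sum (I : Type) (s : seq I) (mu : I -> set X -> R) f :
  (forall i, ba (mu i)) -> bmf f ->
  ba_integral (\sum_(i <- s) mu i) f = \sum_(i <- s) ba_integral (mu i) f.
Proof.
move=> bmu bf; elim: s => [|i s IHs].
  rewrite !big_nil; have := ba_integral_measZ 0 ba0 bf.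
  by rewrite scale0r mul0r.
by rewrite !big_cons ba_integral_measD ?IHs //; exact: ba_sum.
Qed.

Lemma ba_integral_cesaroE n mu f : ba mu -> bmf f ->
  ba_integral (Tm n mu) f = n%:R^-1 * \sum_(i < n) ba_integral (iter i.+1 T mu) f.
Proof.
move=> bmu bf; have bi i : ba (iter i T mu) by have [H _ _ _] := ba_operator_iter i; exact: H.
by rewrite cesaroE ba_integral_measZ ?ba_integral_meas_sum //; exact: ba_sum.
Qed.

Lemma ba_integral_cesaro n mu f : ba mu -> bmf f ->
  ba_integral (Tm n mu) f = ba_integral mu (cdual n f).
Proof.
move=> bmu bf; rewrite ba_integral_cesaroE //.
rewrite ba_integralZ //; last by apply: bmf_sum => i; exact: bmf_iter_dual.
rewrite ba_integral_sum //; last by move=> i; exact: bmf_iter_dual.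
by congr (_ * _); apply: eq_bigr => i _; rewrite ba_integral_iter.
Qed.

End cesaro.

(** * Mean ergodic theorem below an invariant measure *)

Section strong.
Context {R : realType} {d : measure_display} {X : measurableType d}.
Variable p : R.-pker X ~> X.
Implicit Types (mu nu kappa lam : set X -> R) (f g h : X -> R).
Implicit Types (A B : set X) (F : nat -> set X).

Local Notation T := (markov_op p).
Local Notation Tm := (cesaro_mean T).

Lemma div_small (W e : R) : 0 < e ->
  exists N, forall m, (N <= m)%N -> W / m%:R <= e.
Proof.
move=> e0; exists (Num.truncn (`|W| / e)).+1 => m mN.
have h : `|W| / e < (Num.truncn (`|W| / e)).+1%:R by exact: truncnS_gt.
have hm : (Num.truncn (`|W| / e)).+1%:R <= m%:R :> R by rewrite ler_nat.
have {hm}h := lt_le_trans h hm.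
have m0 : 0 < m%:R :> R by apply: le_lt_trans h; rewrite divr_ge0 // ltW.
rewrite ler_pdivrMr // mulrC; move: h; rewrite ltr_pdivrMr // => h.
exact: le_trans (ler_norm _) (ltW h).
Qed.

Lemma cesaro_ba n mu : ba mu -> ba (Tm n mu).
Proof. by have [H _ _ _] := ba_operator_cesaro p n; exact: H. Qed.

Lemma cesaro_ca n mu : ca mu -> ca (Tm n mu).
Proof. by have [_ _ H _] := ba_operator_cesaro p n; exact: H. Qed.

(* If mu is a probability charge, [energy_le mu c kappa] says that the square of
   the L^2(mu)-norm of the density of kappa is at most c. *)
Definition energy_le mu (c : R) kappa := forall g, bmf g ->
  2 * ba_integral kappa g - ba_integral mu (fun x => g x * g x) <= c.

(** Test with [dual g] in place of g: by [dual_sqr] and the invariance of mu, its square has at most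
    the mu-integral of g^2. *)
Lemma energy_markov_op mu c kappa : ba_prob mu -> T mu = mu -> ba kappa ->
  energy_le mu c kappa -> energy_le mu c (T kappa).
Proof.
move=> [bmu mu0 _] Tmu bk ek g bg; rewrite ba_integral_dual //.
have bd := bmf_dual p bg.
apply: le_trans (ek _ bd); rewrite lerD2l lerN2.
rewrite -[in leRHS]Tmu ba_integral_dual //; last exact: bmfM.
apply: ba_integral_mono => //; [exact: bmfM|by apply: bmf_dual; exact: bmfM|].
by move=> x; rewrite -expr2; exact: dual_sqr.
Qed.

Lemma energy_cesaro mu c kappa n : ba_prob mu -> T mu = mu -> ba kappa ->
  energy_le mu c kappa -> energy_le mu c (Tm n.+1 kappa).
Proof.
move=> pmu Tmu bk ek g bg.
have bi i : ba (iter i T kappa) by have [H _ _ _] := ba_operator_iter p i; exact: H.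
have ei i : energy_le mu c (iter i T kappa).
  by elim: i => [|i IHi]; [exact: ek|exact: (energy_markov_op pmu Tmu (bi i) IHi)].
rewrite ba_integral_cesaroE //; set q := ba_integral mu _.
have : \sum_(i < n.+1) (2 * ba_integral (iter i.+1 T kappa) g - q) <= \sum_(i < n.+1) c.
  by apply: ler_sum => i _; exact: (ei i.+1 g bg).
rewrite sumrB !sumr_const card_ord -mulr_sumr.
set s := \sum_(i < _) _; rewrite -(mulr_natl q) -(mulr_natl c) => H.
have n0 : 0 < n.+1%:R^-1 :> R by rewrite invr_gt0.
rewrite -(ler_pM2l n0) in H; move: H.
rewrite mulrBr !mulrA mulVf ?pnatr_eq0 // !mul1r.
by rewrite (mulrC _ 2).
Qed.

(** Let g witness that the midpoint has energy above m. Testing kappa1 with g + h and kappa2 with g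
    - h and adding, the cross terms cancel and leave (kappa1 - kappa2)(h) - mu(h^2) < c - m for
    every bounded h. *)
Lemma energy_parallelogram mu c m kappa1 kappa2 e : ba_prob mu -> ba kappa1 -> ba kappa2 ->
  energy_le mu c kappa1 -> energy_le mu c kappa2 ->
  ~ energy_le mu m (2^-1 *: kappa1 + 2^-1 *: kappa2) ->
  0 < e -> c - m <= 2 * e ^+ 2 -> tvle (kappa1 - kappa2) (3 * e).
Proof.
move=> [bmu mu0 mu1] b1 b2 e1 e2 /existsNP[g /not_implyP[bg /negP]].
rewrite -ltNge ba_integral_meas_lin //; last exact: baZ.
rewrite ba_integral_measZ // => Hg e0 cm.
have key h : bmf h -> ba_integral (kappa1 - kappa2) h -
    ba_integral mu (fun x => h x * h x) <= 2 * e ^+ 2.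
  move=> bh; have bgg := bmfM bg bg; have bhh := bmfM bh bh; have bgh := bmfM bg bh.
  have H1 := e1 _ (bmfD bg bh); have H2 := e2 _ (bmfB bg bh).
  have E1 : ba_integral mu (fun x => (g x + h x) * (g x + h x)) =
      ba_integral mu (fun x => g x * g x) + 2 * ba_integral mu (fun x => g x * h x)
      + ba_integral mu (fun x => h x * h x).
    rewrite -ba_integralZ // -ba_integralD //; last exact: bmfZ.
    rewrite -ba_integralD //; last by apply: bmfD => //; exact: bmfZ.
    by congr ba_integral; apply/funext => x; lra.
  have E2 : ba_integral mu (fun x => (g x - h x) * (g x - h x)) =
      ba_integral mu (fun x => g x * g x) - 2 * ba_integral mu (fun x => g x * h x)
      + ba_integral mu (fun x => h x * h x).
    rewrite -ba_integralZ // -ba_integralB //; last exact: bmfZ.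
    rewrite -ba_integralD //; last by apply: bmfB => //; exact: bmfZ.
    by congr ba_integral; apply/funext => x; lra.
  move: H1 H2; rewrite E1 E2 (ba_integralD b1 bg bh) (ba_integralB b2 bg bh).
  rewrite ba_integral_measB //; lra.
have key_sign h : bmf h -> (forall x, `|h x| <= 1) -> ba_integral (kappa1 - kappa2) h <= 3 * e.
  move=> bh h1; have b12 := ba_sub b1 b2.
  (* Rescaling the test function by e balances the two terms: e (kappa1 - kappa2)(h) <= 2 e^2 +
     e^2. *)
  have := key _ (bmfZ e bh); rewrite ba_integralZ //.
  have le1 : ba_integral mu (fun x => e * h x * (e * h x)) <= e ^+ 2.
    rewrite -[leRHS]mulr1 -mu1 -(ba_integral_cst _ bmu).
    apply: ba_integral_mono => //; [by apply: bmfM; exact: bmfZ|exact: bmf_cst|].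
    move=> x; rewrite mulrACA -!expr2 ler_piMr ?sqr_ge0 // -real_normK ?num_real //.
    by rewrite exprn_ile1.
  move=> H; have : e * ba_integral (kappa1 - kappa2) h <= e * (3 * e).
    by rewrite mulrCA -expr2; lra.
  by rewrite ler_pM2l.
apply: tvle_dual; first exact: ba_sub.
move=> h bh h1; rewrite ler_norml key_sign // andbT.
have := key_sign _ (bmfZ (-1) bh); rewrite ba_integralZ //; last exact: ba_sub.
have H x : `|-1 * h x| <= 1 by rewrite mulN1r normrN.
by move=> /(_ H); lra.
Qed.

(* Mean ergodic theorem: among the charges whose averages have the same
   asymptotics as those of lam, take one of almost minimal energy. *)
Lemma dominated_cauchy mu lam (C : R) : ba_prob mu -> T mu = mu -> ba lam ->
  pos_charge lam -> 0 < C -> (forall B, measurable B -> lam B <= C * mu B) ->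
  forall e : R, 0 < e -> exists N, forall m n, (N <= m)%N -> (N <= n)%N ->
    tvle (Tm m lam - Tm n lam) e.
Proof.
move=> pmu Tmu bl l0 C0 lamC e1 e10; have [bmu mu0 mu1] := pmu.
pose K kappa := ba kappa /\ forall e : R, 0 < e -> exists N, forall m, (N <= m)%N ->
  tvle (Tm m kappa - Tm m lam) e.
pose S := [set c | exists kappa, K kappa /\ energy_le mu c kappa].
have Klam : K lam.
  by split=> // e e0; exists 0%N => m _; rewrite subrr; apply: tvle0; exact: ltW.
(* The density of lam is at most C, so its energy should be at most C^2. Without densities: lam(g^2)
   <= C mu(g^2), combined with the integral of (g - C)^2 / C against lam, gives 2 lam(g) <= mu(g^2)
   + C^2. *)
have Slam : S (C ^+ 2).
  exists lam; split => // g bg.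
  have bgg := bmfM bg bg.
  have bb : ba (C *: mu - lam) by apply: ba_sub => //; exact: baZ.
  have pb : pos_charge (C *: mu - lam).
    by move=> B mB; rewrite submE scalemE subr_ge0 lamC.
  have H0 : 0 <= ba_integral (C *: mu - lam) (fun x => g x * g x).
    by apply: ba_integral_ge0 => // x; rewrite -expr2 sqr_ge0.
  rewrite ba_integral_measB // in H0; last exact: baZ.
  rewrite ba_integral_measZ // in H0.
  have H1 : 0 <= ba_integral lam (fun x => C^-1 * (g x * g x) + ((-2) * g x + C)).
    apply: ba_integral_ge0 => //.
      apply: bmf_lin => //; apply: bmf_lin => //; exact: bmf_cst.
    move=> x; have -> : C^-1 * (g x * g x) + (-2 * g x + C) = C^-1 * (g x - C) ^+ 2.
      by field; rewrite gt_eqF.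
    by rewrite mulr_ge0 ?sqr_ge0 // invr_ge0 ltW.
  rewrite ba_integral_lin // in H1; last by apply: bmf_lin => //; exact: bmf_cst.
  rewrite ba_integral_lin // in H1; last exact: bmf_cst.
  rewrite ba_integral_cst // in H1.
  have H2 := lamC _ measurableT; rewrite mu1 mulr1 in H2.
  have H3 : C^-1 * ba_integral lam (fun x => g x * g x) <= ba_integral mu (fun x => g x * g x).
    by rewrite mulrC ler_pdivrMr // mulrC; lra.
  have H4 : C * lam setT <= C ^+ 2 by rewrite expr2 ler_pM2l.
  by lra.
have S_ge0 c : S c -> 0 <= c.
  move=> [kappa [[bk _] ek]]; have := ek _ (bmf_cst 0).
  rewrite !ba_integral_cst // ; lra.
have hS : has_inf S by split; [exists (C ^+ 2)|exists 0 => c /S_ge0].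
pose e := e1 / 5.
have e0 : 0 < e by rewrite divr_gt0.
have e20 : 0 < e ^+ 2 by rewrite exprn_gt0.
have [c [kappa [[bk Kk] ek]] cS] := inf_adherent e20 hS.
have Kc j : K (Tm j.+1 kappa).
  split=> [|e' e'0]; first exact: cesaro_ba.
  have [V V0 kV] := ba_tvle_ex bk.
  have e'20 : 0 < e' / 2 by rewrite divr_gt0.
  have [N1 H1] := Kk _ e'20.
  have [N2 H2] := div_small (j.+1%:R * (2 * V)) e'20.
  exists (maxn N1 N2) => m; rewrite geq_max => /andP[m1 /H2 m2].
  have := tvle_tri (cesaro_cesaro_tvle p m j bk kV) (H1 _ m1); apply: tvleW.
  by rewrite mulrA; lra.
have Kmid k1 k2 : K k1 -> K k2 -> K (2^-1 *: k1 + 2^-1 *: k2).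
  move=> [b1 H1] [b2 H2]; split=> [|e' e'0].
    by apply: ba_lin => //; exact: baZ.
  have [N1 {}H1] := H1 _ e'0; have [N2 {}H2] := H2 _ e'0.
  exists (maxn N1 N2) => m; rewrite geq_max => /andP[/H1 {}H1 /H2 {}H2].
  have nm := ba_operator_cesaro p m.
  rewrite (ba_operatorD nm) ?(ba_operatorZ _ nm) //; try exact: baZ.
  have := tvleD (tvleZ 2^-1 H1) (tvleZ 2^-1 H2).
  rewrite !scalerBr addrACA -opprD -scalerDl.
  have -> : 2^-1 + 2^-1 = 1 :> R by lra.
  rewrite scale1r; apply: tvleW; rewrite ger0_norm; lra.
(* Both means have energy at most c < inf S + e^2, while their midpoint lies in K and therefore has
   no energy bound below inf S; the gap is less than 2 e^2. *)
have pair m n : tvle (Tm m.+1 kappa - Tm n.+1 kappa) (3 * e).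
  apply: (@energy_parallelogram mu c (inf S - e ^+ 2)) => //; try exact: cesaro_ba.
  - exact: energy_cesaro.
  - exact: energy_cesaro.
  - move=> H; have : S (inf S - e ^+ 2) by eexists; split; [apply: Kmid|exact: H]; exact: Kc.
    move/(ge_inf hS.2); lra.
  - lra.
have [N HN] := Kk _ e0.
exists (maxn N 1) => m n; rewrite !geq_max => /andP[Nm m0] /andP[Nn n0].
case: m n m0 n0 Nm Nn => // m [] // n _ _ Nm Nn.
have := tvle_tri (tvleC (HN _ Nm)) (tvle_tri (pair m n) (HN _ Nn)).
by apply: tvleW; rewrite /e; lra.
Qed.

End strong.

(** * Strong and uniform convergence *)

Section uniform.
Context {R : realType} {d : measure_display} {X : measurableType d}.
Variable p : R.-pker X ~> X.
Implicit Types (mu nu kappa lam : set X -> R) (f g h : X -> R).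
Implicit Types (A B : set X) (F : nat -> set X).

Local Notation T := (markov_op p).
Local Notation Tm := (cesaro_mean T).

Lemma ba_subU mu A B : ba mu -> pos_charge mu -> measurable A -> measurable B ->
  mu (A `|` B) <= mu A + mu B.
Proof.
move=> bmu mu0 mA mB.
have -> : A `|` B = A `|` (B `\` A).
  apply/seteqP; split=> x; have [Ax|nAx] := pselect (A x).
  - by left.
  - by case=> [//|Bx]; right.
  - by left.
  - by case=> [//|[Bx _]]; right.
have mBA : measurable (B `\` A) by exact: measurableD.
rewrite baU //; last by rewrite -subset0 => x [Ax [_]].
by rewrite lerD2l; apply: ba_le => //; exact: subDsetl.
Qed.

(** Finite unions are bounded by partial sums of the geometric series; countable additivity passes
    to the full tail. *)
Lemma ca_tail_union mu (P : nat -> set X) m : ca mu -> pos_charge mu ->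
  (forall k, measurable (P k)) ->
  (forall k, mu (P k) <= 2^-1 ^+ k) ->
  mu (\bigcup_k P (m + k)%N) <= 2 * 2^-1 ^+ m.
Proof.
move=> /caP[bmu cmu] mu0 mP muP.
pose U := \bigcup_k P (m + k)%N; pose Un n := \big[setU/set0]_(i < n) P (m + i)%N.
have mU : measurable U by exact: bigcup_measurable.
have mUn n : measurable (Un n) by exact: bigsetU_measurable.
have UnU n : Un n `<=` U by exact: (@bigsetU_bigcup _ (fun i => P (m + i)%N)).
have leUn n : mu (Un n) <= 2 * 2^-1 ^+ m - 2 * 2^-1 ^+ (m + n).
  elim: n => [|n IHn]; first by rewrite /Un big_ord0 addn0 subrr ba_set0.
  have -> : Un n.+1 = Un n `|` P (m + n)%N by rewrite /Un big_ord_recr.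
  apply: le_trans (ba_subU bmu mu0 (mUn n) (mP _)) _.
  by apply: le_trans (lerD IHn (muP _)) _; rewrite addnS exprS; lra.
have sF : shrinking (fun n => U `\` Un n).
  split=> [n|n|]; first exact: measurableD.
    by apply: setDS; rewrite /Un big_ord_recr /=; apply: subsetUl.
  rewrite -subset0 => x H; have [[n _ Pn] _] := H 0%N Logic.I.
  by have [_ /=] := H n.+1 Logic.I; apply; rewrite /Un big_ord_recr /=; right.
rewrite -/U; apply/ler_addgt0Pr => e e0.
have /cvgrPdist_le/(_ _ e0)/filter_ex[n /=] := cmu _ sF.
rewrite sub0r normrN => /(le_trans (ler_norm _)); rewrite baD //.
have := leUn n; have : 0 <= 2 * 2^-1 ^+ (m + n) :> R by rewrite mulr_ge0 // exprn_ge0.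
lra.
Qed.

Lemma tvle_cvg0 (mu : nat -> set X -> R) (W : nat -> R) B : measurable B ->
  (forall n, tvle (mu n) (W n)) -> W n @[n --> \oo] --> 0 -> mu n B @[n --> \oo] --> (0 : R).
Proof.
move=> mB muW W0; apply/cvgrPdist_le => e e0.
move/cvgrPdist_le : W0 => /(_ _ e0); apply: filterS => n.
rewrite !sub0r !normrN; apply: le_trans; apply: le_trans (tvle_norm (muW n) mB) _.
exact: ler_norm.
Qed.

Lemma cesaro_asymptotically_invariant (k : nat -> nat) (nu : nat -> set X -> R) B :
  (forall n, (n <= k n)%N) -> (forall n, ba_prob (nu n)) -> measurable B ->
  T (Tm (k n).+1 (nu n)) B - Tm (k n).+1 (nu n) B @[n --> \oo] --> (0 : R).
Proof.
move=> nk pnu mB.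
apply: (@tvle_cvg0 (fun n => T (Tm (k n).+1 (nu n)) - Tm (k n).+1 (nu n))
   (fun n => 2 * 1 / (k n).+1%:R)) => //.
  move=> n; have [bn _ _] := pnu n; apply: cesaro_diff_tvle => //; exact: prob_tvle.
apply/cvgrPdist_le => e e0; have [N HN] := div_small (2 * 1) e0.
exists N => // n /= Nn; rewrite sub0r normrN ger0_norm ?divr_ge0 // HN //.
by apply: (leq_trans Nn); apply: (leq_trans (nk n)); exact: leqnSn.
Qed.

Hypothesis inv_ca : forall mu, ba_prob mu -> T mu = mu -> ca mu.

(* If infinitely many averages kept mass e outside every multiple of the
   invariant limit mu, the sets carrying that mass would have unions of small
   mu-measure but of mu-measure at least e in the limit. *)
Lemma almost_dominated nu (e : R) : ba_prob nu -> ca nu -> 0 < e ->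
  exists mu k (P : set X), [/\ ba_prob mu, T mu = mu, measurable P,
    Tm k.+1 nu P <= e &
    forall B, measurable B -> B `&` P = set0 -> Tm k.+1 nu B <= 2 ^+ k * mu B].
Proof.
move=> pnu cnu e0.
have [U [UU oU]] := ultraFilterLemma eventually_filter.
have PU : ProperFilter U by exact: ultra_proper.
have plam n : ba_prob (Tm n.+1 nu) by exact: cesaro_prob.
have [mu [pmu lammu]] := ultralim_prob UU plam.
have muinv : T mu = mu.
  apply: (ultralim_invariant PU plam pmu lammu) => B mB.
  apply: cvg_trans (cesaro_asymptotically_invariant (k := id) (nu := fun=> nu) _ _ mB) => //.
  by move=> S HS; exact: oU.
have cmu := inv_ca pmu muinv; have [bmu mu0 mu1] := pmu.
(* P k is a Hahn set of T_(k+1) nu - 2^k mu. As T_(k+1) nu has mass 1, mu(P k) <= 2^-k, which is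
   summable. *)
have /choice[P HP] k : exists P, [/\ measurable P,
    forall B, measurable B -> B `<=` P -> 2 ^+ k * mu B <= Tm k.+1 nu B &
    forall B, measurable B -> B `&` P = set0 -> Tm k.+1 nu B <= 2 ^+ k * mu B].
  have cc : ca (- 2 ^+ k *: mu + Tm k.+1 nu).
    by apply: ca_lin => //; exact: cesaro_ca.
  have [P [mP posP negP]] := hahn cc; exists P; split => // B mB BP.
    by have := posP B mB BP; rewrite linE; lra.
  by have := negP B mB BP; rewrite linE; lra.
apply: contrapT => none.
have big k : e < Tm k.+1 nu (P k).
  rewrite ltNge; apply/negP => le; apply: none; exists mu, k, (P k).
  by have [mP _ nP] := HP k; split.
have mP k : measurable (P k) by case: (HP k).
have muP k : mu (P k) <= 2^-1 ^+ k.
  have [_ H _] := HP k; have := H _ (mP k) (@subset_refl _ _).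
  have [bl l0 l1] := plam k.
  move/le_trans => /(_ _ (prob_le1 (plam k) (mP k))).
  by rewrite exprVn -ler_pdivlMl ?exprn_gt0 // mulr1.
have [m Hm] : exists m, 2 * 2^-1 ^+ m <= e / 2 :> R.
  have e40 : 0 < e / 4 by rewrite divr_gt0.
  have := @cvg_expr R 2^-1; rewrite ger0_norm ?invr_ge0 // => /(_ _).
  have lt1 : 2^-1 < 1 :> R by lra.
  move=> /(_ lt1) /cvgrPdist_le/(_ _ e40)/filter_ex[m /=].
  by rewrite sub0r normrN => /(le_trans (ler_norm _)) H; exists m; lra.
pose F := \bigcup_k P (m + k)%N.
have mF : measurable F by exact: bigcup_measurable.
have muF : mu F <= e / 2 by apply: le_trans (ca_tail_union m cmu mu0 mP muP) Hm.
have Um : U [set n | (m <= n)%N] by apply: oU; exists m.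
have e40 : 0 < e / 4 by rewrite divr_gt0.
move/cvgrPdist_le : (lammu F) => /(_ _ e40) HF.
have [n [/= mn Hn]] := filter_ex (filterI Um HF).
have [bl l0 _] := plam n.
have PF : P n `<=` F by move=> x Px; exists (n - m)%N => //; rewrite subnKC.
have := ba_le bl l0 (mP n) mF PF; have := big n.
by move: Hn; rewrite ler_norml; lra.
Qed.

(** The mean kappa given by [almost_dominated] has the same asymptotics as nu. Off P it is dominated
    by a multiple of mu, and the part on P has mass at most e, which no mean increases. *)
Lemma strong_cauchy nu : ba_prob nu -> ca nu -> forall e : R, 0 < e ->
  exists N, forall m n, (N <= m)%N -> (N <= n)%N -> tvle (Tm m nu - Tm n nu) e.
Proof.
move=> pnu cnu e1 e10; pose e := e1 / 5.
have e0 : 0 < e by rewrite divr_gt0.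
have [mu [k [P [pmu muinv mP HP HN]]]] := almost_dominated pnu cnu e0.
set kappa := Tm k.+1 nu in HP HN.
have pk : ba_prob kappa by exact: cesaro_prob.
have [bk k0 _] := pk; have [bn _ _] := pnu; have [bmu mu0 _] := pmu.
have mPC : measurable (~` P) by exact: measurableC.
pose lam := restr_to kappa (~` P).
have bl : ba lam by exact: restr_to_ba.
have l0 : pos_charge lam by move=> B mB; rewrite /lam restr_toE // k0 //; exact: measurableI.
have lC B : measurable B -> lam B <= 2 ^+ k * mu B.
  move=> mB; rewrite /lam restr_toE //.
  apply: le_trans (HN _ (measurableI _ _ mB mPC) _) _.
    by rewrite -setIA setICl setI0.
  by rewrite ler_pM2l ?exprn_gt0 //; apply: ba_le => //; exact: measurableI.
have C0 : 0 < 2 ^+ k :> R by rewrite exprn_gt0.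
have kl : tvle (kappa - lam) e.
  have -> : kappa - lam = restr_to kappa P.
    apply/funext => B; rewrite submE; have [mB|nB] := pselect (measurable B); last first.
      by have [off _ _] := bk; rewrite off // /lam /restr_to !asboolF // subrr.
    by rewrite /lam !restr_toE // (baDI bk mB mP) setDE addrK.
  have br := restr_to_ba bk mP.
  apply: tvleW (tvle_pos br _); first by rewrite restr_toE // setTI.
  by move=> B mB; rewrite restr_toE // k0 //; exact: measurableI.
have [N1 H1] := dominated_cauchy pmu muinv bl l0 C0 lC e0.
have [N2 H2] := div_small (k.+1%:R * (2 * 1)) e0.
exists (maxn N1 N2) => m n; rewrite !geq_max => /andP[m1 /H2 m2] /andP[n1 /H2 n2].
have a1 := cesaro_cesaro_tvle p m k bn (prob_tvle pnu).
have a2 := cesaro_cesaro_tvle p n k bn (prob_tvle pnu).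
have b1 := cesaro_tvle p m (ba_sub bk bl) kl.
have b2 := cesaro_tvle p n (ba_sub bk bl) kl.
rewrite (ba_operatorB (ba_operator_cesaro p m)) // in b1.
rewrite (ba_operatorB (ba_operator_cesaro p n)) // in b2.
(* Five errors of size e: nu to kappa and kappa to lam, for m and for n, and the mean ergodic
   theorem for lam. *)
have := tvle_tri (tvleC a1) (tvle_tri b1 (tvle_tri (H1 _ _ m1 n1) (tvle_tri (tvleC b2) a2))).
by apply: tvleW; rewrite !mulrA in m2 n2 *; rewrite /e in m2 n2 *; lra.
Qed.

Definition dirac_fun (x : X) B : R := if `[< measurable B >] then \1_B x else 0.

Lemma dirac_prob x : ba_prob (dirac_fun x).
Proof.
have E B : measurable B -> dirac_fun x B = \1_B x.
  by rewrite /dirac_fun => mB; rewrite asboolT.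
split; [apply: baP| |].
- by move=> B nB; rewrite /dirac_fun asboolF.
- by rewrite E // indicE in_set0.
- move=> A B mA mB AB; rewrite !E //; last exact: measurableU.
  rewrite !indicE in_setU; case: (boolP (x \in A)) => xA; case: (boolP (x \in B)) => xB /=;
    rewrite ?addr0 ?add0r //.
  have : (A `&` B) x by split; apply/set_mem.
  by rewrite AB.
- by exists 1 => B mB; rewrite E // indicE; case: (_ \in _); rewrite ?normr1 ?normr0.
- by move=> B mB; rewrite E // indicE.
- by rewrite E // indicE in_setT.
Qed.

Lemma dirac_ca x : ca (dirac_fun x).
Proof.
apply/caP; split; first by case: (dirac_prob x).
move=> F sF; have [mF _ F0] := sF.
have [N nFN] : exists N, ~ F N x.
  apply: contrapT => /forallNP H.
  have : (\bigcap_n F n) x by move=> n _; exact: contrapT (H n).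
  by rewrite F0.
apply/cvgrPdist_le => e e0; exists N => // n /= Nn.
rewrite /dirac_fun asboolT // indicE memNset ?subr0 ?normr0 ?(ltW e0) //.
by move=> /(shrinking_le sF Nn).
Qed.

Lemma ba_integral_dirac x f : bmf f -> ba_integral (dirac_fun x) f = f x.
Proof.
move=> bf; have [bd d0 d1] := dirac_prob x.
apply: (@eq_eps _ _ _ 2) => e e0.
have [g fg] := bmf_sfun bf e0.
have H := ba_int_approx bd bf (prob_tvle (dirac_prob x)) (ltW e0) fg.
have sE : sint (dirac_fun x) g = g x.
  have [I [F [c [c2 [pF gc]]]]] := sfun_partition2 g g.
  have gc' i y : F i y -> g y = c i by move=> /gc[].
  rewrite (sint_partition bd pF gc'); have [mF dF cF] := pF.
  have [i Fx] := cF x; rewrite (bigD1 i) //= big1 ?addr0 => [|j ji].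
    by rewrite /dirac_fun asboolT // indicE mem_set // mulr1 -(gc' _ _ Fx).
  rewrite /dirac_fun asboolT // indicE memNset ?mulr0 // => Fj.
  by rewrite (dF _ _ _ Fx Fj) eqxx in ji.
rewrite sE in H; have := fg x; move: H.
rewrite !ler_norml; lra.
Qed.

Lemma cesaro_cdualE n mu B : ba mu -> measurable B ->
  Tm n mu B = ba_integral mu (cdual p n (\1_B)).
Proof.
move=> bmu mB; rewrite -ba_integral_cesaro //; last exact: bmf_indic.
by rewrite ba_integral_indic //; exact: cesaro_ba.
Qed.

(* Egorov's theorem for the differences x |-> (T_n - T_(k n)) delta_x (B_n),
   which tend to 0 pointwise by strong convergence, against the averages
   T_n nu_n, which charge shrinking sets uniformly little. *)
Lemma uniform_cesaro_set (e : R) : 0 < e -> exists N, forall n, (N <= n)%N ->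
  forall k nu B, (n <= k)%N -> ba_prob nu -> ca nu -> measurable B ->
  `|Tm n.+1 (Tm n.+1 nu) B - Tm k.+1 (Tm n.+1 nu) B| <= e.
Proof.
move=> e0.
pose bad n (t : nat * (set X -> R) * set X) := [/\ (n <= t.1.1)%N, ba_prob t.1.2,
  ca t.1.2, measurable t.2 &
  e < `|Tm n.+1 (Tm n.+1 t.1.2) t.2 - Tm t.1.1.+1 (Tm n.+1 t.1.2) t.2|].
(* A counterexample at index n whenever there is one, and otherwise a harmless default, so that the
   sequences below are defined for every n. *)
have /choice[t Ht] n : exists t, ((n <= t.1.1)%N /\ ba_prob t.1.2 /\ measurable t.2) /\
    ((exists t', bad n t') -> bad n t).
  have [[t' bt']|nb] := pselect (exists t', bad n t').
    by exists t'; split => //; have [? ? ? ?] := bt'.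
  exists (n, dirac_fun point, setT); split=> //=; split => //; split => //.
  exact: dirac_prob.
pose k n := (t n).1.1; pose nu n := (t n).1.2; pose B n := (t n).2.
have nk n : (n <= k n)%N by case: (Ht n) => [[? [? ?]] _].
have pnu n : ba_prob (nu n) by case: (Ht n) => [[? [? ?]] _].
have mB n : measurable (B n) by case: (Ht n) => [[? [? ?]] _].
pose f n x := cdual p n.+1 (\1_(B n)) x - cdual p (k n).+1 (\1_(B n)) x.
have bi n : bmf (\1_(B n) : X -> R) by exact: bmf_indic.
have bf n : bmf (f n) by apply: bmfB; exact: bmf_cdual.
have fE n x : f n x = (Tm n.+1 (dirac_fun x) - Tm (k n).+1 (dirac_fun x)) (B n).
  have [bd _ _] := dirac_prob x.
  by rewrite submE !cesaro_cdualE // !ba_integral_dirac //; exact: bmf_cdual.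
have f1 n x : `|f n x| <= 1 + 1.
  rewrite fE; apply: tvle_norm => //.
  by apply: tvleB; apply: prob_tvle; apply: cesaro_prob; exact: dirac_prob.
have f0 x : f n x @[n --> \oo] --> 0.
  apply/cvgrPdist_le => e' e'0.
  have [N HN] := strong_cauchy (dirac_prob x) (dirac_ca x) e'0.
  exists N => // n /= Nn; rewrite sub0r normrN fE; apply: tvle_norm => //.
  apply: HN; first exact: leqW.
  by apply: leqW; apply: leq_trans Nn (nk n).
have plam n : ba_prob (Tm n.+1 (nu n)) by exact: cesaro_prob.
have lamF F : shrinking F -> Tm n.+1 (nu n) (F n) @[n --> \oo] --> (0 : R).
  apply: (asymptotically_invariant_shrinking inv_ca plam) => C mC.
  exact: (cesaro_asymptotically_invariant (k := id)).
have : ba_integral (Tm n.+1 (nu n)) (f n) @[n --> \oo] --> (0 : R).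
  apply: (@ba_integral_cvg0 _ _ _ (fun n => Tm n.+1 (nu n)) f (1 + 1) 1) => //.
  - by move=> n; case: (plam n).
  - by move=> n; case: (plam n).
  - by move=> n; case: (plam n) => _ _ ->.
move/cvgrPdist_le => /(_ _ e0)[N _ HN]; exists N => n Nn k' nu' B' nk' pn' cn' mB'.
rewrite leNgt; apply/negP => lt.
have [_ H] := Ht n.
have [_ _ _ _] : bad n (t n) by apply: H; exists (k', nu', B').
rewrite ltNge => /negP; apply; have := HN n Nn.
rewrite /= sub0r normrN /f ba_integralB;
  [|by case: (plam n)|exact: bmf_cdual|exact: bmf_cdual].
rewrite -!cesaro_cdualE //; by case: (plam n).
Qed.

(** With N fixed, all later means T_m nu are close to the single measure T_N T_N nu, through T_m T_N
    nu. The bound on sets becomes a bound on the variation at the cost of a factor 2. *)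
Lemma uniform_cauchy (e : R) : 0 < e -> exists N, forall m n, (N <= m)%N -> (N <= n)%N ->
  forall nu, ba_prob nu -> ca nu -> tvle (Tm m nu - Tm n nu) e.
Proof.
move=> e10; have e0 : 0 < e / 8 by rewrite divr_gt0.
have [N HN] := uniform_cesaro_set e0.
have [N' HN'] := div_small (N.+1%:R * (2 * 1)) e0.
have key m : (maxn N.+1 N' <= m)%N -> forall nu, ba_prob nu -> ca nu ->
    tvle (Tm m nu - Tm N.+1 (Tm N.+1 nu)) (3 * (e / 8)).
  rewrite geq_max => /andP[mN /HN' mN'] nu pnu cnu; case: m mN mN' => // m mN mN'.
  have [bn _ _] := pnu.
  have a := cesaro_cesaro_tvle p m.+1 N bn (prob_tvle pnu).
  have b : tvle (Tm N.+1 (Tm N.+1 nu) - Tm m.+1 (Tm N.+1 nu)) (e / 8 *+ 2).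
    apply: ba_tvle => [|B mB]; first by apply: ba_sub; do 2!apply: cesaro_ba.
    by rewrite submE; apply: HN.
  have := tvle_tri (tvleC a) (tvleC b); apply: tvleW.
  by rewrite (mulr2n (e / 8)) (mulrA N.+1%:R); set z := N.+1%:R * _ / _ in mN' *; lra.
exists (maxn N.+1 N') => m n /key hm /key hn nu pnu cnu.
have := tvle_tri (hm _ pnu cnu) (tvleC (hn _ pnu cnu)); apply: tvleW; lra.
Qed.

End uniform.

(** * The limit projector *)

Lemma subrACA (V : zmodType) (a b c e : V) : a - b - (c - e) = a - c - (b - e).
Proof. by rewrite !opprB addrACA [RHS]addrACA; congr (_ + _); rewrite addrC. Qed.

Section tv_limits.
Context {R : realType} {d : measure_display} {X : measurableType d}.
Implicit Types (mu nu kappa lam : set X -> R) (A B : set X) (u : nat -> set X -> R).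

Lemma tv_norm_fin mu : ba mu -> exists V, [/\ tv_norm mu = V%:E, tvle mu V &
  forall W, tvle mu W -> V <= W].
Proof.
move=> bmu; have [W W0 muW] := ba_tvle_ex bmu.
have h1 : (0%:E <= tv_norm mu)%E.
  apply: (@le_trans _ _ (`|mu setT|)%:E); first by rewrite lee_fin.
  apply: ereal_sup_ubound; exists 1%N, (fun=> setT); split => //.
  - by move=> i j; rewrite !ord1.
  - by apply/seteqP; split=> // x _; exists ord0.
  - by rewrite big_ord1.
have h2 : (tv_norm mu <= W%:E)%E by apply/tvleP.
have h3 : tv_norm mu \is a fin_num.
  by rewrite ge0_fin_numE // (le_lt_trans h2) // ltry.
exists (fine (tv_norm mu)); rewrite fineK //; split => //.
  by apply/tvleP; rewrite fineK.
by move=> V /tvleP; rewrite -lee_fin fineK.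
Qed.

Lemma tv_eq mu nu : ba mu -> ba nu -> (forall e : R, 0 < e -> tvle (mu - nu) e) -> mu = nu.
Proof.
move=> bmu bnu H; apply/funext => B; have [mB|nB] := pselect (measurable B); last first.
  by case: bmu bnu => [zmu ? ?] [znu ? ?]; rewrite zmu // znu.
apply: (@eq_eps _ _ _ 1) => e e0; rewrite mulr1 -submE.
by apply: tvle_norm => //; exact: H.
Qed.

Lemma cvg_real_le (U : set_system nat) (u : nat -> R) (l c : R) : ProperFilter U ->
  u @ U --> l -> (\forall n \near U, u n <= c) -> l <= c.
Proof.
move=> PU ul uc; apply/ler_addgt0Pr => e e0.
move/cvgrPdist_le : ul => /(_ _ e0) ul.
have [n [/= H1 H2]] := filter_ex (filterI ul uc).
by move: H1; rewrite ler_norml; lra.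
Qed.

Definition tv_cauchy u := forall e : R, 0 < e ->
  exists N, forall m n, (N <= m)%N -> (N <= n)%N -> tvle (u m - u n) e.

(** Taken set by set; convergence in variation is recovered from the Cauchy property by
    [tv_lim_tvle]. *)
Definition tv_lim u B : R := lim (u n B @[n --> \oo]).

Lemma tv_lim_cvg u B : (forall n, ba (u n)) -> tv_cauchy u ->
  u n B @[n --> \oo] --> tv_lim u B.
Proof.
move=> bu cu; have [mB|nB] := pselect (measurable B); last first.
  have E : (fun n => u n B) = fun=> 0.
    by apply/funext => n; have [offu _ _] := bu n; rewrite offu.
  by rewrite /tv_lim E; apply: cvgP; exact: cvg_cst.
suff : cvg (u n B @[n --> \oo]) by [].
apply/cauchy_cvgP; apply: cauchy_exP => e e0.
have e20 : 0 < e / 2 by rewrite divr_gt0.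
have [N HN] := cu _ e20; exists (u N B); exists N => // n /= Nn.
rewrite /ball /=; apply: le_lt_trans (_ : e / 2 < e); last by lra.
by rewrite -submE; apply: tvle_norm => //; exact: HN.
Qed.

(** Lower semicontinuity of the variation: on each finite partition the bound on u n - u m passes to
    the limit in m. *)
Lemma tv_lim_tvle u N (e : R) : (forall n, ba (u n)) -> tv_cauchy u ->
  (forall m n, (N <= m)%N -> (N <= n)%N -> tvle (u m - u n) e) ->
  forall n, (N <= n)%N -> tvle (u n - tv_lim u) e.
Proof.
move=> bu cu HN n Nn k F pF.
apply: (cvg_real_le (U := \oo) (u := fun m => \sum_i `|(u n - u m) (F i)|)).
  apply: cvg_fsum => i; apply: cvg_norm; apply: cvgB; first exact: cvg_cst.
  exact: tv_lim_cvg.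
by exists N => // m /= Nm; apply: HN.
Qed.

Lemma tv_lim_ca u : (forall n, ca (u n)) -> tv_cauchy u -> ca (tv_lim u).
Proof.
move=> cau cu; have bu n : ba (u n) by case: (cau n).
have cv B := tv_lim_cvg (B := B) bu cu.
apply/caP; split.
  have [N HN] := cu _ ltr01; have [_ _ [M bM]] := bu N.
  apply: baP.
  - move=> B nB; apply: (cvg_real_unique _ (cv B)).
    rewrite (_ : (fun n => u n B) = fun=> 0); first exact: cvg_cst.
    by apply/funext => n; have [offu _ _] := bu n; rewrite offu.
  - apply: (cvg_real_unique _ (cv set0)).
    rewrite (_ : (fun n => u n set0) = fun=> 0); first exact: cvg_cst.
    by apply/funext => n; rewrite ba_set0.
  - move=> A B mA mB AB; apply: (cvg_real_unique _ (cv (A `|` B))).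
    rewrite (_ : (fun n => u n (A `|` B)) = (fun n => u n A + u n B)); first exact: cvgD.
    by apply/funext => n; rewrite baU.
  - exists (M + 1) => B mB.
    have := tvle_norm (tv_lim_tvle bu cu HN (leqnn N)) mB; rewrite submE.
    by have := bM _ mB; rewrite !ler_norml; lra.
move=> F sF; have [mF _ _] := sF; apply/cvgrPdist_le => e e0.
have e20 : 0 < e / 2 by rewrite divr_gt0.
(* The limit differs from one fixed u N by at most e/2 on every set, so the continuity of u N at the
   empty set suffices. *)
have [N HN] := cu _ e20; have := tv_lim_tvle bu cu HN (leqnn N) => H.
have /caP[_ /(_ _ sF)/cvgrPdist_le/(_ _ e20)] := cau N.
apply: filterS => n; rewrite !sub0r !normrN.
have := tvle_norm H (mF n); rewrite submE.
by rewrite !ler_norml; lra.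
Qed.

End tv_limits.

(** * The limit operator as a spectral projector *)

Section limit_operator.
Context {R : realType} {d : measure_display} {X : measurableType d}.
Variable p : R.-pker X ~> X.
Implicit Types (mu nu kappa lam : set X -> R) (A B : set X) (u : nat -> set X -> R).

Local Notation T := (markov_op p).
Local Notation Tm := (cesaro_mean T).

Hypothesis inv_ca : forall mu, ba_prob mu -> T mu = mu -> ca mu.

Lemma ca_ba mu : ca mu -> ba mu. Proof. by case. Qed.

(** From probabilities to signed measures by scaling and Jordan decomposition, whose two masses add
    up to at most V. *)
Lemma uniform_cauchy_ca (e : R) : 0 < e -> exists N, forall m n, (N <= m)%N -> (N <= n)%N ->
  forall nu V, ca nu -> tvle nu V -> tvle (Tm m nu - Tm n nu) (e * V).
Proof.
move=> e0; have [N HN] := uniform_cauchy inv_ca e0; exists N => m n Nm Nn.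
have nm := ba_operator_cesaro p m; have nn := ba_operator_cesaro p n.
have posc mu : ca mu -> pos_charge mu -> tvle (Tm m mu - Tm n mu) (e * mu setT).
  move=> cmu mu0; have [bmu _] := cmu.
  have [mT0|mT0] := eqVneq (mu setT) 0.
    have mu0' : tvle mu 0 by have := tvle_pos bmu mu0; rewrite mT0.
    rewrite mT0 mulr0 -[0]addr0.
    by apply: tvleB; exact: cesaro_tvle.
  have mTp : 0 < mu setT by rewrite lt0r mT0 mu0.
  have mTi : 0 < (mu setT)^-1 by rewrite invr_gt0.
  pose mu1 := (mu setT)^-1 *: mu.
  have pmu1 : ba_prob mu1.
    split; first exact: baZ.
      by move=> B mB; rewrite /mu1 scalemE mulr_ge0 ?mu0 // ltW.
    by rewrite /mu1 scalemE mulVf.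
  have cmu1 : ca mu1 by exact: caZ.
  have -> : mu = mu setT *: mu1 by rewrite /mu1 scalerA mulfV // scale1r.
  have b1 := ca_ba cmu1.
  have -> : (mu setT *: mu1) setT = mu setT.
    by have [_ _ m1] := pmu1; rewrite scalemE m1 mulr1.
  rewrite (ba_operatorZ _ nm b1) (ba_operatorZ _ nn b1) -scalerBr mulrC.
  by rewrite -[X in X * e](gtr0_norm mTp); apply: tvleZ; exact: HN.
move=> nu V cnu nuV; have [mp [mn [[cp pp] [cn pn] nuE leV]]] := jordan_ca cnu.
have bp := ca_ba cp; have bn := ca_ba cn.
rewrite nuE (ba_operatorB nm bp bn) (ba_operatorB nn bp bn) subrACA.
apply: tvleW (tvleB (posc _ cp pp) (posc _ cn pn)).
by rewrite -mulrDr ler_pM2l //; exact: leV.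
Qed.

Lemma cesaro_tv_cauchy nu : ca nu -> tv_cauchy (fun n => Tm n nu).
Proof.
move=> cnu e e0; have [V V0 nuV] := ba_tvle_ex (ca_ba cnu).
have [N HN] := uniform_cauchy_ca (divr_gt0 e0 V0); exists N => m n Nm Nn.
by have := HN m n Nm Nn _ _ cnu nuV; rewrite divfK // gt_eqF.
Qed.

Definition limit_op nu : set X -> R := tv_lim (fun n => Tm n nu).
Local Notation E := limit_op.

Lemma limit_op_cvg nu B : ca nu -> Tm n nu B @[n --> \oo] --> E nu B.
Proof.
move=> cnu; apply: tv_lim_cvg; last exact: cesaro_tv_cauchy.
by move=> n; apply: cesaro_ba; exact: ca_ba.
Qed.

Lemma limit_op_ca nu : ca nu -> ca (E nu).
Proof.
move=> cnu; apply: tv_lim_ca; last exact: cesaro_tv_cauchy.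
by move=> n; exact: cesaro_ca.
Qed.

Lemma limit_op_uniform (e : R) : 0 < e -> exists N, forall n, (N <= n)%N ->
  forall nu V, ca nu -> tvle nu V -> tvle (Tm n nu - E nu) (e * V).
Proof.
move=> e0; have [N HN] := uniform_cauchy_ca e0; exists N => n Nn nu V cnu nuV.
apply: (@tv_lim_tvle _ _ _ (fun n => Tm n nu) N) => //.
- by move=> k; apply: cesaro_ba; exact: ca_ba.
- exact: cesaro_tv_cauchy.
- by move=> k l Nk Nl; exact: HN.
Qed.

Lemma limit_op_near nu : ca nu -> forall e : R, 0 < e -> exists N, forall n, (N <= n)%N ->
  tvle (Tm n nu - E nu) e.
Proof.
move=> cnu e e0; have [V V0 nuV] := ba_tvle_ex (ca_ba cnu).
have [N HN] := limit_op_uniform (divr_gt0 e0 V0); exists N => n Nn.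
by have := HN n Nn _ _ cnu nuV; rewrite divfK // gt_eqF.
Qed.

Lemma limit_op_lin (a : R) mu nu : ca mu -> ca nu ->
  E (a *: mu + nu) = a *: E mu + E nu.
Proof.
move=> cmu cnu; apply/funext => B.
apply: (cvg_real_unique _ (limit_op_cvg (B := B) (ca_lin a cmu cnu))); rewrite linE.
rewrite (_ : (fun n => _) = (fun n => a * Tm n mu B + Tm n nu B)).
  by apply: cvgD; [apply: cvgM; [exact: cvg_cst|]|]; exact: limit_op_cvg.
apply/funext => n; have [_ H _ _] := ba_operator_cesaro p n.
by rewrite H ?linE //; exact: ca_ba.
Qed.

Lemma limit_op_tvle nu V : ca nu -> tvle nu V -> tvle (E nu) V.
Proof.
move=> cnu nuV k F pF.
apply: (cvg_real_le (U := \oo) (u := fun n => \sum_i `|Tm n nu (F i)|)).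
  by apply: cvg_fsum => i; apply: cvg_norm; exact: limit_op_cvg.
by apply: nearW => n; apply: cesaro_tvle => //; exact: ca_ba.
Qed.

Lemma limit_op_markov nu : ca nu -> E (T nu) = E nu.
Proof.
move=> cnu; have cT := markov_op_ca p cnu.
have [V V0 nuV] := ba_tvle_ex (ca_ba cnu); have bnu := ca_ba cnu.
apply: tv_eq; [exact: ca_ba (limit_op_ca cT)|exact: ca_ba (limit_op_ca cnu)|].
move=> e e0; have e30 : 0 < e / 3 by rewrite divr_gt0.
have [N1 H1] := limit_op_near cT e30; have [N2 H2] := limit_op_near cnu e30.
have [N3 H3] := div_small (2 * V) e30.
pose n := maxn N1 (maxn N2 N3).
have n1 : (N1 <= n)%N by exact: leq_maxl.
have n2 : (N2 <= n)%N by rewrite leq_max leq_maxl orbT.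
have n3 : (N3 <= n)%N by rewrite /n !leq_max leqnn !orbT.
have D : tvle (Tm n (T nu) - Tm n nu) (e / 3).
  have [_ _ _ ->] := ba_operator_cesaro p n => //.
  exact: tvleW (H3 _ n3) (cesaro_diff_tvle p n bnu nuV).
have := tvle_tri (tvleC (H1 _ n1)) (tvle_tri D (H2 _ n2)).
by apply: tvleW; lra.
Qed.

Lemma limit_op_invariant nu : ca nu -> T (E nu) = E nu.
Proof.
move=> cnu; have cE := limit_op_ca cnu.
have [V V0 nuV] := ba_tvle_ex (ca_ba cnu); have bnu := ca_ba cnu.
apply: tv_eq; [exact: ca_ba (markov_op_ca p cE)|exact: ca_ba cE|].
move=> e e0; have e30 : 0 < e / 3 by rewrite divr_gt0.
have [N2 H2] := limit_op_near cnu e30.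
have [N3 H3] := div_small (2 * V) e30.
pose n := maxn N2 N3.
have n2 : (N2 <= n)%N by exact: leq_maxl.
have n3 : (N3 <= n)%N by exact: leq_maxr.
have bT := cesaro_ba p n bnu.
have D := tvleW (H3 _ n3) (cesaro_diff_tvle p n bnu nuV).
have D2 := markov_op_tvle p (ba_sub bT (ca_ba cE)) (H2 _ n2).
rewrite markov_opB // in D2; last exact: ca_ba cE.
have := tvle_tri (tvleC D2) (tvle_tri D (H2 _ n2)).
by apply: tvleW; lra.
Qed.

Lemma cesaro_fix n nu : T nu = nu -> Tm n.+1 nu = nu.
Proof.
move=> Tnu; rewrite cesaroE.
have H i : iter i T nu = nu by elim: i => //= i ->.
rewrite (eq_bigr (fun=> nu)) // sumr_const card_ord -(scaler_nat n.+1 nu) scalerA.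
by rewrite mulVf ?scale1r // pnatr_eq0.
Qed.

Lemma limit_op_fix nu : ca nu -> T nu = nu -> E nu = nu.
Proof.
move=> cnu Tnu; apply: tv_eq; [exact: ca_ba (limit_op_ca cnu)|exact: ca_ba|].
move=> e e0; have [N HN] := limit_op_near cnu e0.
by have := tvleC (HN N.+1 (leqnSn N)); rewrite cesaro_fix.
Qed.

Lemma limit_op_prob nu : ba_prob nu -> ca nu -> ba_prob (E nu).
Proof.
move=> pnu cnu; have pl n : ba_prob (Tm n.+1 nu) by exact: cesaro_prob.
have cv B : Tm n.+1 nu B @[n --> \oo] --> E nu B.
  by have := limit_op_cvg (B := B) cnu; rewrite -(cvg_shiftS (fun n => Tm n nu B)).
split; first exact: ca_ba (limit_op_ca cnu).
- move=> B mB; rewrite -oppr_le0.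
  apply: (cvg_real_le (U := \oo) (u := fun n => - Tm n.+1 nu B)).
    by apply: cvgN; exact: cv.
  by apply: nearW => n; rewrite oppr_le0; case: (pl n) => _ + _; apply.
- apply: (cvg_real_unique _ (cv setT)).
  rewrite (_ : (fun n => _) = fun=> 1); first exact: cvg_cst.
  by apply/funext => n; case: (pl n).
Qed.

(** The average over i < n of the partial Neumann sums 1 + T + ... + T^i. Applying 1 - T turns these
    into 1 - T^(i+1), hence [potential_diff]. The scalar 1 gives the inner sum the shape required by
    [ba_operator_avg]. *)
Definition potential (n : nat) mu : set X -> R :=
  n%:R^-1 *: \sum_(i < n) (1 *: \sum_(j < i.+1) iter j T mu).
Local Notation Q := potential.

Lemma ba_operator_potential n : ba_operator p (Q n).
Proof.
exact: (ba_operator_avg n%:R^-1 n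
  (fun i => ba_operator_avg 1 i.+1 (fun j => ba_operator_iter p j))).
Qed.

Lemma potential_diff n mu : ba mu -> Q n.+1 mu - T (Q n.+1 mu) = mu - Tm n.+1 mu.
Proof.
move=> bmu; have bi i : ba (iter i T mu) by have [H _ _ _] := ba_operator_iter p i; exact: H.
have bs i : ba (1 *: \sum_(j < i) iter j T mu) by apply: baZ; exact: ba_sum.
rewrite /potential markov_opZ; last by apply: ba_sum => i; exact: bs.
rewrite markov_op_sum; last by move=> i; exact: bs.
rewrite -scalerBr -sumrB.
have H i : (1 *: \sum_(j < i.+1) iter j T mu) - T (1 *: \sum_(j < i.+1) iter j T mu) =
    mu - iter i.+1 T mu.
  rewrite !scale1r markov_op_sum // -sumrB.
  rewrite -(big_mkord predT (fun j => iter j T mu - T (iter j T mu))).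
  rewrite (@telescope_sumr_eq _ 0 i.+1 (fun j => - iter j T mu)) //.
    by rewrite opprK addrC.
  by move=> k _; rewrite /= opprK addrC.
rewrite (eq_bigr (fun i : 'I_n.+1 => mu - iter i.+1 T mu)); last by move=> i _; exact: H.
rewrite sumrB scalerBr -cesaroE; congr (_ - _).
by rewrite sumr_const card_ord -(scaler_nat n.+1 mu) scalerA mulVf ?scale1r // pnatr_eq0.
Qed.

Lemma potential_tvle n mu V : ba mu -> tvle mu V -> tvle (Q n mu) (n%:R * V).
Proof.
move=> bmu muV; have V0 := tvle_ge0 muV.
apply: (@tvle_avg _ _ _ n (fun i => 1 *: \sum_(j < i.+1) iter j T mu)).
  by rewrite mulr_ge0.
move=> i ilt; rewrite scale1r.
have := tvle_sum (index_enum 'I_i.+1) (fun j : 'I_i.+1 => iter_tvle p j bmu muV).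
apply: tvleW; rewrite -[index_enum _]enumT size_enum_ord -(mulr_natl V).
by rewrite ler_wpM2r // ler_nat.
Qed.

(** * The kernel of the projector, and the inverse of 1 - T on it *)

Definition complement_space : set (set X -> R) := [set mu | ca mu /\ E mu = 0].
Local Notation K := complement_space.

Lemma limit_op0 : E 0 = 0.
Proof. by have := limit_op_lin (-1) ca0 ca0; rewrite !scaleN1r !addNr. Qed.

Lemma complement_lin (a : R) mu nu : K mu -> K nu -> K (a *: mu + nu).
Proof.
move=> [cmu Emu] [cnu Enu]; split; first exact: ca_lin.
by rewrite limit_op_lin // Emu Enu scaler0 addr0.
Qed.

Lemma complement0 : K 0. Proof. by split; [exact: ca0|exact: limit_op0]. Qed.

Lemma complementZ (a : R) mu : K mu -> K (a *: mu).
Proof.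
move=> Kmu; rewrite -[a *: mu]addr0.
by apply: complement_lin => //; exact: complement0.
Qed.

Lemma complement_sub mu nu : K mu -> K nu -> K (mu - nu).
Proof. by move=> Kmu Knu; rewrite addrC -scaleN1r; exact: complement_lin. Qed.

Lemma complement_sum (I : Type) (s : seq I) (mu : I -> set X -> R) :
  (forall i, K (mu i)) -> K (\sum_(i <- s) mu i).
Proof.
move=> Kmu; elim: s => [|i s IHs]; first by rewrite big_nil; exact: complement0.
by rewrite big_cons -[mu i]scale1r; exact: complement_lin.
Qed.

Lemma complement_markov mu : K mu -> K (T mu).
Proof.
by move=> [cmu Emu]; split; [exact: markov_op_ca|rewrite limit_op_markov].
Qed.

Lemma complement_potential n mu : K mu -> K (Q n mu).
Proof.
move=> Kmu; apply: complementZ; apply: complement_sum => i.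
apply: complementZ; apply: complement_sum => j.
by elim: (nat_of_ord j) => //= k; exact: complement_markov.
Qed.

Lemma complement_ba mu : K mu -> ba mu. Proof. by move=> [/ca_ba]. Qed.

(** Write mu = T_N mu + Q_N (mu - T mu). On the kernel of E the first term has at most half the
    variation of mu and is absorbed; Q_N multiplies the variation by at most N. *)
Lemma complement_lower_bound : exists2 C : R, 0 < C & forall mu W, K mu ->
  tvle (mu - T mu) W -> tvle mu (C * W).
Proof.
have h0 : 0 < 2^-1 :> R by rewrite invr_gt0.
have [N HN] := limit_op_uniform h0.
exists (2 * N.+1%:R); first by rewrite mulr_gt0.
move=> mu W Kmu muW; have [cmu Emu] := Kmu; have bmu := ca_ba cmu.
(* Absorption needs the least bound V, since the conclusion comes from V <= V / 2 + N W. *)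
have [V [_ muV Vmin]] := tv_norm_fin bmu.
have h1 : tvle (Tm N.+1 mu) (2^-1 * V).
  by have := HN N.+1 (leqnSn N) _ _ cmu muV; rewrite Emu subr0.
have bT := markov_op_ba p bmu.
have h2 := potential_tvle N.+1 (ba_sub bmu bT) muW.
have nQ := ba_operator_potential N.+1.
rewrite (ba_operatorB nQ bmu bT) in h2; have [_ _ _ QT] := nQ.
rewrite QT // potential_diff // in h2.
have := Vmin _ _; move=> /(_ (2^-1 * V + N.+1%:R * W)).
have h3 := tvleD h1 h2; rewrite addrC subrK in h3.
move=> /(_ h3) h4; apply: tvleW muV; rewrite -mulrA.
set z := N.+1%:R * W in h4 *; lra.
Qed.

Definition resolvent nu : set X -> R := tv_lim (fun n => Q n.+1 nu).
Local Notation S := resolvent.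

(** Applied to nu, (1 - T)(Q_m - Q_n) equals T_n - T_m, which is small; the lower bound for 1 - T
    transfers this to Q_m - Q_n. *)
Lemma potential_cauchy nu : K nu -> tv_cauchy (fun n => Q n.+1 nu).
Proof.
move=> Knu; have [C C0 HC] := complement_lower_bound; have [cnu Enu] := Knu.
have bnu := ca_ba cnu.
move=> e e0; have [N HN] := cesaro_tv_cauchy cnu (divr_gt0 e0 C0).
exists N => m n Nm Nn; have -> : e = C * (e / C) by rewrite mulrC divfK // gt_eqF.
have Km := complement_potential m.+1 Knu; have Kn := complement_potential n.+1 Knu.
apply: HC; first exact: complement_sub.
rewrite markov_opB; [|exact: complement_ba|exact: complement_ba].
rewrite subrACA !potential_diff // subrACA subrr sub0r opprB.
by apply: HN; exact: leqW.
Qed.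

Lemma resolvent_cvg nu B : K nu -> Q n.+1 nu B @[n --> \oo] --> S nu B.
Proof.
move=> Knu; apply: (@tv_lim_cvg _ _ _ (fun n => Q n.+1 nu)); last exact: potential_cauchy.
by move=> n; apply: complement_ba; exact: complement_potential.
Qed.

Lemma resolvent_near nu : K nu -> forall e : R, 0 < e -> exists N, forall n, (N <= n)%N ->
  tvle (Q n.+1 nu - S nu) e.
Proof.
move=> Knu e e0; have cq := potential_cauchy Knu.
have [N HN] := cq _ e0; exists N.
apply: tv_lim_tvle => //.
by move=> n; apply: complement_ba; exact: complement_potential.
Qed.

Lemma resolvent_ca nu : K nu -> ca (S nu).
Proof.
move=> Knu; apply: tv_lim_ca; last exact: potential_cauchy.
by move=> n; case: (complement_potential n.+1 Knu).
Qed.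

Lemma resolvent_K nu : K nu -> K (S nu).
Proof.
move=> Knu; have cS := resolvent_ca Knu; split => //.
apply: tv_eq; [exact: ca_ba (limit_op_ca cS)|exact: ba0|].
move=> e e0; have [N HN] := resolvent_near Knu e0.
have [cQ EQ] := complement_potential N.+1 Knu.
have := limit_op_tvle (caB cQ cS) (HN N (leqnn N)).
rewrite addrC -scaleN1r limit_op_lin // EQ addr0 scaleN1r => /tvleN.
by rewrite opprK subr0.
Qed.

Lemma resolvent_lin (a : R) mu nu : K mu -> K nu ->
  S (a *: mu + nu) = a *: S mu + S nu.
Proof.
move=> Kmu Knu; apply/funext => B.
apply: (cvg_real_unique _ (resolvent_cvg (B := B) (complement_lin a Kmu Knu))); rewrite linE.
rewrite (_ : (fun n => _) = (fun n => a * Q n.+1 mu B + Q n.+1 nu B)).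
  by apply: cvgD; [apply: cvgM; [exact: cvg_cst|]|]; exact: resolvent_cvg.
apply/funext => n; have [_ H _ _] := ba_operator_potential n.+1.
by rewrite H ?linE //; exact: complement_ba.
Qed.

Lemma resolvent_right nu : K nu -> S nu - T (S nu) = nu.
Proof.
move=> Knu; have cS := resolvent_ca Knu; have bS := ca_ba cS; have [cnu Enu] := Knu.
have bT := markov_op_ba p bS.
apply: tv_eq; [exact: ba_sub|exact: ca_ba|].
move=> e e0; have e30 : 0 < e / 3 by rewrite divr_gt0.
have [N1 H1] := resolvent_near Knu e30; have [N2 H2] := limit_op_near cnu e30.
pose n := maxn N1 N2.
have {}H1 := H1 n (leq_maxl _ _).
have {}H2 := H2 n.+1 (leqW (leq_maxr _ _)); rewrite Enu subr0 in H2.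
have bQ := complement_ba (complement_potential n.+1 Knu).
have H3 := markov_op_tvle p (ba_sub bQ bS) H1.
rewrite markov_opB // in H3.
have H4 : tvle (nu - Tm n.+1 nu - nu) (e / 3).
  by rewrite addrAC subrr sub0r; exact: tvleN.
rewrite -potential_diff // in H4; last exact: ca_ba.
have H5 := tvleB H1 H3; rewrite subrACA in H5.
have := tvle_tri (tvleC H5) H4; apply: tvleW; lra.
Qed.

Lemma resolvent_left nu : K nu -> S (nu - T nu) = nu.
Proof.
move=> Knu; have KT := complement_markov Knu; have Kd := complement_sub Knu KT.
have [cnu Enu] := Knu; have bnu := ca_ba cnu.
have cS := resolvent_ca Kd; have bS := ca_ba cS.
apply: tv_eq => // e e0; have e20 : 0 < e / 2 by rewrite divr_gt0.
have [N1 H1] := resolvent_near Kd e20; have [N2 H2] := limit_op_near cnu e20.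
pose n := maxn N1 N2.
have {}H1 := H1 n (leq_maxl _ _).
have {}H2 := H2 n.+1 (leqW (leq_maxr _ _)); rewrite Enu subr0 in H2.
have nQ := ba_operator_potential n.+1; have [_ _ _ QT] := nQ.
rewrite (ba_operatorB nQ) // ?QT // ?potential_diff // in H1; last exact: markov_op_ba.
have H4 : tvle (nu - Tm n.+1 nu - nu) (e / 2).
  by rewrite addrAC subrr sub0r; exact: tvleN.
have := tvle_tri (tvleC H1) H4; apply: tvleW; lra.
Qed.

Lemma tvle_bounded_linear_on (V : set (set X -> R)) (L : (set X -> R) -> set X -> R) (C : R) :
  V `<=` ba -> 0 <= C ->
  (forall (a : R) mu nu, V mu -> V nu -> L (a *: mu + nu) = a *: L mu + L nu) ->
  (forall mu W, V mu -> tvle mu W -> tvle (L mu) (C * W)) -> bounded_linear_on V L.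
Proof.
move=> Vba C0 Llin LC; split => //; exists C => // mu Vmu.
have [W [-> muW _]] := tv_norm_fin (Vba _ Vmu).
by apply/tvleP; exact: LC.
Qed.

Lemma spectral_limit_op : spectral_projector ca T 1 E.
Proof.
have imE : E @` ca = eigenspace_on ca T 1.
  apply/seteqP; split=> [_ [nu cnu <-]|nu [cnu]].
    by split; [exact: limit_op_ca|rewrite scale1r limit_op_invariant].
  by rewrite scale1r => Tnu; exists nu => //; exact: limit_op_fix.
have cd : ca (dirac_fun point : set X -> R) by exact: dirac_ca.
have pd : ba_prob (dirac_fun point : set X -> R) by exact: dirac_prob.
split.
(* The image of a Dirac mass is a probability, so the eigenspace is not zero. *)
- exists (E (dirac_fun point)); first by rewrite -imE; exists (dirac_fun point).
  move=> E0; have [_ _] := limit_op_prob pd cd; rewrite E0 zeroE => /esym/eqP.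
  by rewrite oner_eq0.
- apply: (@tvle_bounded_linear_on _ _ 1) => //; first by move=> mu /ca_ba.
    by move=> a mu nu cmu cnu; exact: limit_op_lin.
  by move=> mu W cmu muW; rewrite mul1r; exact: limit_op_tvle.
- split => // mu cmu; apply: limit_op_fix; first exact: limit_op_ca.
  exact: limit_op_invariant.
- by move=> mu cmu; rewrite limit_op_markov // limit_op_invariant.
- have [C C0 HC] := complement_lower_bound; exists S; split.
  + by move=> mu Kmu; exact: resolvent_K.
  + apply: (@tvle_bounded_linear_on _ _ C); [by move=> mu /complement_ba|exact: ltW| |].
      by move=> a mu nu; exact: resolvent_lin.
    (* The lower bound for 1 - T, applied to S mu, is the boundedness of its inverse S. *)
    move=> mu W Kmu muW; apply: HC; first exact: resolvent_K.
    by rewrite resolvent_right.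
  + by move=> mu Kmu; rewrite !scale1r; split; [exact: resolvent_left|exact: resolvent_right].
Qed.

End limit_operator.

(** * Finite dimension *)

Section jordan_ba.
Context {R : realType} {d : measure_display} {X : measurableType d}.
Implicit Types (mu nu kappa lam : set X -> R) (A B : set X).

Lemma pos_mass0 mu : ba mu -> pos_charge mu -> mu setT = 0 -> mu = 0.
Proof.
move=> bmu mu0 m0; apply/funext => B; have [mB|nB] := pselect (measurable B); last first.
  by have [off _ _] := bmu; rewrite off.
apply/eqP; rewrite eq_le mu0 // andbT; apply: (@le_trans _ _ (mu setT)).
  exact: ba_le.
by rewrite m0.
Qed.

(** The value on B is the supremum of mu over measurable subsets of B. A merely finitely additive mu
    may have no Hahn set; the last clause, minimality among positive majorants, takes its place. *)
Lemma ba_pos_part mu : ba mu -> exists nu, [/\ ba nu, pos_charge nu,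
  pos_charge (nu - mu) &
  forall lam, ba lam -> pos_charge lam -> pos_charge (lam - mu) ->
    pos_charge (lam - nu)].
Proof.
move=> bmu; have [_ _ [M muM]] := bmu.
pose S B := [set mu C | C in [set C | measurable C /\ C `<=` B]].
pose s B := sup (S B).
have S0 B : S B 0 by exists set0; [split|rewrite ba_set0].
have SM B : ubound (S B) M by move=> _ [C [mC _] <-]; apply: le_trans (ler_norm _) (muM _ mC).
have hS B : has_sup (S B) by split; [exists 0|exists M].
have sub B t : S B t -> t <= s B by move=> St; apply: ub_le_sup => //; exact: (hS B).2.
have slub B t : ubound (S B) t -> s B <= t by move=> h; apply: ge_sup => //; exists 0.
have sU A B : measurable A -> measurable B -> A `&` B = set0 -> s (A `|` B) = s A + s B.
  move=> mA mB AB; apply/eqP; rewrite eq_le; apply/andP; split.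
    apply: slub => _ [C [mC CAB] <-]; rewrite (baDI bmu mC mA); apply: lerD.
      by apply: sub; exists (C `&` A) => //; split; [exact: measurableI|exact: subIsetr].
    apply: sub; exists (C `\` A) => //; split; first exact: measurableD.
    by move=> x [/CAB[]].
  rewrite -lerBrDr; apply: (slub) => _ [C [mC CA] <-]; rewrite lerBrDr addrC -lerBrDr.
  apply: slub => _ [D [mD DB] <-]; rewrite lerBrDr addrC -baU //.
    apply: sub; exists (C `|` D) => //; split; first exact: measurableU.
    by apply: setUSS.
  by rewrite -subset0 -AB; apply: setISS.
pose nu B := if `[< measurable B >] then s B else 0.
have nuE B : measurable B -> nu B = s B by rewrite /nu => mB; rewrite asboolT.
exists nu; split.
- apply: baP.
  + by move=> B nB; rewrite /nu asboolF.
  + rewrite nuE //; apply/eqP; rewrite eq_le (sub _ _ (S0 _)) andbT.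
    apply: (slub) => _ [C [_ + <-]].
    by rewrite subset0 => ->; rewrite ba_set0.
  + by move=> A B mA mB AB; rewrite !nuE ?sU //; exact: measurableU.
  + exists M => B mB; rewrite nuE // ger0_norm; [exact: slub|exact/sub/S0].
- by move=> B mB; rewrite nuE //; exact/sub/S0.
- by move=> B mB; rewrite submE nuE // subr_ge0; apply: (sub); exists B => //; split.
- move=> lam bl l0 lmu B mB; rewrite submE nuE // subr_ge0; apply: slub.
  move=> _ [C [mC CB] <-]; apply: (@le_trans _ _ (lam C)).
    by have := lmu _ mC; rewrite submE subr_ge0.
  exact: ba_le.
Qed.

End jordan_ba.

(** * The cone of positive invariant measures and its atoms *)

Section dimension.
Context {R : realType} {d : measure_display} {X : measurableType d}.
Variable p : R.-pker X ~> X.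
Implicit Types (mu nu kappa lam e : set X -> R) (A B P D : set X).

Local Notation T := (markov_op p).

Hypothesis inv_ca : forall mu, ba_prob mu -> T mu = mu -> ca mu.

(** T preserves total mass, so the positive charge T mu - mu has mass 0 and vanishes. *)
Lemma subinvariant mu : ba mu -> pos_charge (T mu - mu) -> T mu = mu.
Proof.
move=> bmu H; apply/eqP; rewrite -subr_eq0; apply/eqP; apply: pos_mass0 => //.
  by apply: ba_sub => //; exact: markov_op_ba.
by rewrite submE markov_opT // subrr.
Qed.

Definition pos_invariant mu := [/\ ba mu, pos_charge mu & T mu = mu].

Lemma pos_invariant_normalize mu : pos_invariant mu -> mu setT != 0 ->
  ba_prob ((mu setT)^-1 *: mu) /\ T ((mu setT)^-1 *: mu) = (mu setT)^-1 *: mu.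
Proof.
move=> [bmu mu0 Tmu] m0; split; last by rewrite markov_opZ // Tmu.
split; first exact: baZ.
  by move=> B mB; rewrite scalemE mulr_ge0 ?invr_ge0 ?mu0.
by rewrite scalemE mulVf.
Qed.

Lemma pos_invariant_ca mu : pos_invariant mu -> ca mu.
Proof.
move=> imu; have [bmu mu0 Tmu] := imu.
have [m0|m0] := eqVneq (mu setT) 0; first by rewrite (pos_mass0 bmu mu0 m0); exact: ca0.
have [p1 i1] := pos_invariant_normalize imu m0.
have := caZ (mu setT) (inv_ca p1 i1).
by rewrite scalerA mulfV // scale1r.
Qed.

(** T nu is positive and majorises T mu = mu, hence it majorises the positive part nu;
    [subinvariant] gives equality. *)
Lemma invariant_pos_part mu : ba mu -> T mu = mu ->
  exists nu1 nu2, [/\ pos_invariant nu1, pos_invariant nu2 & mu = nu1 - nu2].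
Proof.
move=> bmu Tmu; have [nu [bnu nu0 numu nul]] := ba_pos_part bmu.
have bT := markov_op_ba p bnu.
have bd := ba_sub bnu bmu.
have Tnu : T nu = nu.
  apply: subinvariant => //; apply: nul => //; first exact: markov_op_pos.
  by rewrite -[in X in pos_charge X]Tmu -markov_opB //; apply: markov_op_pos.
exists nu, (nu - mu); split => //; last by rewrite opprB addrC subrK.
by split => //; rewrite markov_opB // Tnu Tmu.
Qed.

Lemma M_ba_ca mu : ba mu -> T mu = mu -> ca mu.
Proof.
move=> bmu Tmu; have [nu1 [nu2 [i1 i2 ->]]] := invariant_pos_part bmu Tmu.
by apply: caB; exact: pos_invariant_ca.
Qed.

Lemma hahn_invariant rho : ca rho -> T rho = rho -> exists P, [/\ measurable P,
  pos_invariant (restr_to rho P), pos_invariant (- restr_to rho (~` P)) &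
  rho = restr_to rho P + restr_to rho (~` P)].
Proof.
move=> crho Trho; have brho := ca_ba crho.
have [P [mP posP negP]] := hahn crho.
have mPC : measurable (~` P) by exact: measurableC.
set a := restr_to rho P; set b := restr_to rho (~` P).
have rhoE : rho = a + b.
  apply/funext => B; rewrite addmE; have [mB|nB] := pselect (measurable B).
    by rewrite /a /b !restr_toE // (baDI brho mB mP) setDE.
  by have [off _ _] := brho; rewrite off // /a /b /restr_to !asboolF // addr0.
have ba_ : ba a by exact: restr_to_ba.
have bb : ba b by exact: restr_to_ba.
have a0 : pos_charge a by move=> B mB; rewrite /a restr_toE // posP //; exact: measurableI.
have b0 : pos_charge (- b).
  move=> B mB; rewrite oppmE /b restr_toE // oppr_ge0; apply: negP; first exact: measurableI.
  by rewrite -setIA setICl setI0.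
have bNb : ba (- b) by rewrite -scaleN1r; exact: baZ.
(* Since rho <= a, one has a(B) = T rho (B [&] P) <= T a (B [&] P) <= T a (B). *)
have Ta : T a = a.
  apply: subinvariant => // B mB; rewrite submE subr_ge0.
  have mBP : measurable (B `&` P) by exact: measurableI.
  apply: (@le_trans _ _ (T a (B `&` P))); last first.
    by apply: ba_le => //; [exact: markov_op_ba|exact: markov_op_pos].
  rewrite {1}/a restr_toE // -[in leLHS]Trho -subr_ge0 -submE -markov_opB //.
  apply: markov_op_pos => //; first exact: ba_sub.
  by rewrite rhoE opprD addrA subrr sub0r.
exists P; split => //; split => //.
have -> : - b = a - rho by rewrite rhoE opprD addrA subrr sub0r.
by rewrite markov_opB // Ta Trho.
Qed.

(** The tail unions F m of disjoint sets shrink to the empty set although mu n (F n) = 1, against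
    the compactness remark for a sequence of exactly invariant measures. *)
Lemma no_disjoint_sequence (mu : nat -> set X -> R) (D : nat -> set X) :
  (forall n, ba_prob (mu n)) -> (forall n, T (mu n) = mu n) ->
  (forall n, measurable (D n)) -> (forall n, mu n (D n) = 1) ->
  (forall m n x, (m < n)%N -> D m x -> ~ D n x) -> False.
Proof.
move=> pmu Tmu mD muD dD.
pose F m := \bigcup_(n in [set n | (m <= n)%N]) D n.
have mF m : measurable (F m) by exact: bigcup_measurable.
have sF : shrinking F.
  split=> // [m x [n /= mn H]|]; first by exists n => //=; exact: ltnW.
  rewrite -subset0 => x H; have [m _ Dm] := H 0%N Logic.I.
  by have [n /= mn Dn] := H m.+1 Logic.I; exact: (dD m n x).
have inv B : measurable B -> T (mu n) B - mu n B @[n --> \oo] --> (0 : R).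
  move=> _; rewrite (_ : (fun _ => _) = fun=> 0); first exact: cvg_cst.
  by apply/funext => n; rewrite Tmu subrr.
have := asymptotically_invariant_shrinking inv_ca pmu inv sF.
have h0 : 0 < 2^-1 :> R by rewrite invr_gt0.
move/cvgrPdist_le => /(_ _ h0)/filter_ex[n /=].
have [bn n0 _] := pmu n.
have : mu n (D n) <= mu n (F n) by apply: ba_le => // x Dx; exists n => /=.
by rewrite muD sub0r normrN ger0_norm ?n0 //; lra.
Qed.

(** A probability spanning an extreme ray of the cone of positive invariant measures, that is, an
    ergodic measure. *)
Definition atom e := [/\ ba_prob e, T e = e & forall lam, pos_invariant lam ->
  (forall B, measurable B -> lam B <= e B) -> lam = lam setT *: e].

Definition dominates mu nu := exists2 C : R, 0 < C &
  forall B, measurable B -> nu B <= C * mu B.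

Lemma dominates_trans mu nu lam : dominates mu nu -> dominates nu lam -> dominates mu lam.
Proof.
move=> [C C0 munu] [D D0 nulam]; exists (D * C); first exact: mulr_gt0.
move=> B mB; apply: le_trans (nulam _ mB) _; rewrite -mulrA ler_pM2l //.
exact: munu.
Qed.

Lemma dominates1 mu nu A : ba_prob mu -> ba_prob nu -> dominates mu nu ->
  measurable A -> mu A = 1 -> nu A = 1.
Proof.
move=> [bmu mu0 mu1] [bnu nu0 nu1] [C C0 munu] mA muA.
have mAC : measurable (~` A) by exact: measurableC.
have : nu (~` A) <= 0.
  apply: le_trans (munu _ mAC) _.
  by rewrite -setTD (baD bmu) // mu1 muA subrr mulr0.
by rewrite -setTD (baD bnu) // nu1; have := prob_le1 (And3 bnu nu0 nu1) mA; lra.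
Qed.

Lemma split_mass0 rho : ca rho -> T rho = rho -> rho setT = 0 -> rho <> 0 ->
  exists P, [/\ measurable P, pos_invariant (restr_to rho P),
    pos_invariant (- restr_to rho (~` P)), 0 < rho P & rho (~` P) = - rho P].
Proof.
move=> crho Trho rho0 rhoN0.
have [P [mP ia ib rhoE]] := hahn_invariant crho Trho.
have brho := ca_ba crho.
have mPC : measurable (~` P) by exact: measurableC.
have PC : rho (~` P) = - rho P by rewrite -setTD (baD brho) // rho0 sub0r.
exists P; split => //.
have [ba_ a0 _] := ia; have [bb b0 _] := ib.
have aT : restr_to rho P setT = rho P by rewrite restr_toE // setTI.
have bT : (- restr_to rho (~` P)) setT = rho P.
  by rewrite oppmE restr_toE // setTI PC opprK.
rewrite lt0r -aT a0 // andbT aT; apply/eqP => P0; apply: rhoN0.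
rewrite rhoE (pos_mass0 ba_ a0) ?aT // add0r.
by rewrite -[restr_to _ _]opprK (pos_mass0 bb b0) ?bT // oppr0.
Qed.

(** If lam <= mu is invariant but not a multiple of mu, then rho = lam - lam(X) mu is invariant,
    nonzero and of mass 0. Its Hahn parts are invariant and carried by complementary sets. *)
Lemma not_atom_split mu : ba_prob mu -> T mu = mu -> ~ atom mu ->
  exists mu1 mu2 P, [/\ measurable P, ba_prob mu1 /\ T mu1 = mu1,
    ba_prob mu2 /\ T mu2 = mu2, dominates mu mu1 /\ dominates mu mu2 &
    mu1 P = 1 /\ mu2 (~` P) = 1].
Proof.
move=> pmu Tmu nat_; have [bmu mu0 mu1] := pmu.
have [lam [il lmu lamN]] : exists lam, [/\ pos_invariant lam,
    forall B, measurable B -> lam B <= mu B & lam <> lam setT *: mu].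
  apply: contrapT => H; apply: nat_; split => // lam il lmu.
  by apply: contrapT => lamN; apply: H; exists lam.
have [bl l0 Tl] := il.
pose rho := lam - lam setT *: mu.
have l1 : lam setT <= 1 by rewrite -mu1; exact: lmu.
have lT0 : 0 <= lam setT by exact: l0.
have brho : ba rho by apply: ba_sub => //; exact: baZ.
have Trho : T rho = rho by rewrite markov_opB ?markov_opZ ?Tl ?Tmu //; exact: baZ.
have crho := M_ba_ca brho Trho.
have rho0 : rho setT = 0 by rewrite /rho submE scalemE mu1 mulr1 subrr.
have rhoN0 : rho <> 0 by move/eqP; rewrite subr_eq0 => /eqP.
have [P [mP ia ib rP rPC]] := split_mass0 crho Trho rho0 rhoN0.
have mPC : measurable (~` P) by exact: measurableC.
have rPi : 0 < (rho P)^-1 by rewrite invr_gt0.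
set a := restr_to rho P in ia; set b := - restr_to rho (~` P) in ib.
have aT : a setT = rho P by rewrite /a restr_toE // setTI.
have bT : b setT = rho P by rewrite /b oppmE restr_toE // setTI rPC opprK.
have := pos_invariant_normalize ia; rewrite aT gt_eqF // => /(_ isT)[pa Ta].
have := pos_invariant_normalize ib; rewrite bT gt_eqF // => /(_ isT)[pb Tb].
exists ((rho P)^-1 *: a), ((rho P)^-1 *: b), P; split => //.
(* On P, rho <= lam <= mu; off P, - rho <= lam(X) mu <= mu. *)
- split; exists (rho P)^-1 => // B mB; rewrite scalemE ler_pM2l //.
    have mBP : measurable (B `&` P) by exact: measurableI.
    rewrite /a restr_toE // /rho submE scalemE.
    apply: le_trans (_ : mu (B `&` P) <= _); last exact: ba_le.
    have := lmu _ mBP; have : 0 <= lam setT * mu (B `&` P) by rewrite mulr_ge0 // mu0.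
    lra.
  have mBP : measurable (B `&` ~` P) by exact: measurableI.
  rewrite /b oppmE restr_toE // /rho submE scalemE.
  apply: le_trans (_ : mu (B `&` ~` P) <= _); last exact: ba_le.
  have := l0 _ mBP; have : lam setT * mu (B `&` ~` P) <= 1 * mu (B `&` ~` P).
    by rewrite ler_wpM2r // mu0.
  lra.
- rewrite !scalemE /a /b oppmE !restr_toE // !setIid rPC opprK mulVf //.
  by rewrite gt_eqF.
Qed.

Lemma prob_setI nu A B : ba_prob nu -> measurable A -> measurable B ->
  nu A = 1 -> nu B = 1 -> nu (A `&` B) = 1.
Proof.
move=> pnu mA mB nuA nuB; have [bnu nu0 nuT] := pnu.
have h1 := baDI bnu mA mB.
have h2 : nu (A `\` B) <= nu (~` B).
  apply: (ba_le bnu nu0); [exact: measurableD|exact: measurableC|by move=> x []].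
have mAB : measurable (A `&` B) by exact: measurableI.
have := prob_le1 pnu mAB; move: h2.
rewrite -[~` B]setTD (baD bnu measurableT mB (@subsetT _ _)) nuT nuB.
by rewrite nuA in h1; lra.
Qed.

(** If no atom were dominated, every measure met would split again. Keeping one half of each split
    and splitting the other yields invariant probabilities carried by disjoint sets. *)
Lemma dominates_atom mu : ba_prob mu -> T mu = mu -> exists2 e, atom e & dominates mu e.
Proof.
move=> pmu Tmu; apply: contrapT => noatom.
(* A carrier is recorded with each measure. Dominating no atom is inherited by both halves, by
   [dominates_trans]. *)
pose good (t : (set X -> R) * set X) := [/\ ba_prob t.1, T t.1 = t.1, measurable t.2,
  t.1 t.2 = 1 & ~ exists2 e, atom e & dominates t.1 e].
have /choice[f Hf] (t : (set X -> R) * set X) :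
    exists t' : ((set X -> R) * set X) * ((set X -> R) * set X), good t ->
    [/\ good t'.1, good t'.2, t'.1.2 `<=` t.2, t'.2.2 `<=` t.2 & t'.1.2 `&` t'.2.2 = set0].
  have [gt|] := pselect (good t); last by exists (t, t).
  have [pt Tt mt t1 nt] := gt; have [bt t0 tT] := pt.
  have nat_ : ~ atom t.1.
    move=> at_; apply: nt; exists t.1 => //; exists 1 => // B mB; by rewrite mul1r.
  have [m1 [m2 [P [mP [p1 T1] [p2 T2] [d1 d2] [m1P m2P]]]]] := not_atom_split pt Tt nat_.
  have mPC : measurable (~` P) by exact: measurableC.
  exists ((m1, t.2 `&` P), (m2, t.2 `&` ~` P)) => _.
  have t11 := dominates1 pt p1 d1 mt t1; have t12 := dominates1 pt p2 d2 mt t1.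
  split => /=.
  - split => //=; [exact: measurableI|exact: prob_setI|].
    by move=> [e ae de]; apply: nt; exists e => //; exact: dominates_trans de.
  - split => //=; [exact: measurableI|exact: prob_setI|].
    by move=> [e ae de]; apply: nt; exists e => //; exact: dominates_trans de.
  - exact: subIsetl.
  - exact: subIsetl.
  - by rewrite setIACA setICr setI0.
pose t0 : (set X -> R) * set X := (mu, setT).
have g0 : good t0 by split => //=; case: pmu.
pose s k := iter k (fun t => (f t).2) t0.
have gs k : good (s k) by elim: k => //= k IHk; case: (Hf _ IHk).
have ss k l : (k <= l)%N -> (s l).2 `<=` (s k).2.
  elim: l => [|l IHl]; first by rewrite leqn0 => /eqP ->.
  rewrite leq_eqVlt => /predU1P[->//|]; rewrite ltnS => /IHl; apply: subset_trans.
  by have [_ _ _ + _] := Hf _ (gs l).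
have gf k : good (f (s k)).1 by case: (Hf _ (gs k)).
apply: (@no_disjoint_sequence (fun k => (f (s k)).1.1) (fun k => (f (s k)).1.2)).
- by move=> k; case: (gf k).
- by move=> k; case: (gf k).
- by move=> k; case: (gf k).
- by move=> k; case: (gf k).
- move=> m n x mn Dm Dn.
  (* The half kept at stage n lies inside the set of stage m + 1, the second half of the split at
     stage m. *)
  have [_ _ sub _ _] := Hf _ (gs n); have [_ _ _ _ dis] := Hf _ (gs m).
  have : ((f (s m)).1.2 `&` (f (s m)).2.2) x.
    by split => //; apply: (ss m.+1 n mn); exact: sub.
  by rewrite dis.
Qed.

Lemma prob_bigcap mu (G : nat -> set X) : ba_prob mu -> ca mu ->
  (forall n, measurable (G n)) -> (forall n, mu (G n) = 1) -> mu (\bigcap_n G n) = 1.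
Proof.
move=> pmu /caP[bmu cmu] mG muG; have [_ mu0 mu1] := pmu.
pose I := \bigcap_n G n; pose F n := \big[setI/setT]_(i < n) G i.
have mI : measurable I by exact: bigcap_measurable.
have FS n : F n.+1 = F n `&` G n by rewrite /F big_ord_recr.
have mF n : measurable (F n).
  elim: n => [|n IHn]; first by rewrite /F big_ord0.
  by rewrite FS; exact: measurableI.
have muF n : mu (F n) = 1.
  elim: n => [|n IHn]; first by rewrite /F big_ord0.
  by rewrite FS; exact: prob_setI.
have IF n : I `<=` F n.
  elim: n => [|n IHn]; first by rewrite /F big_ord0.
  by rewrite FS => x Ix; split; [exact: IHn|exact: Ix].
have sF : shrinking (fun n => F n `\` I).
  split=> [n|n|]; first exact: measurableD.
    by apply: setSD; rewrite FS; exact: subIsetl.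
  rewrite -subset0 => x H; have [_] := H 0%N Logic.I; apply => n _.
  by have := (H n.+1 Logic.I).1; rewrite FS => -[].
have := cmu _ sF.
rewrite (_ : (fun n => mu (F n `\` I)) = fun=> 1 - mu I); last first.
  by apply/funext => n; rewrite (baD bmu) // muF.
move=> /(cvg_real_unique _ (cvg_cst (1 - mu I) (F := \oo))) /eqP.
by rewrite subr_eq0 => /eqP.
Qed.

(** The positive part of e - e' lies below e and is thus a multiple of e, with positive factor rho
    P. It vanishes off P, hence so does e; symmetrically e' vanishes on P. *)
Lemma atoms_separated e e' : atom e -> atom e' -> e <> e' ->
  exists P, [/\ measurable P, e P = 1 & e' P = 0].
Proof.
move=> [pe Te ae] [pe' Te' ae'] ne.
have [be e0 e1] := pe; have [be' e'0 e'1] := pe'.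
pose rho := e - e'.
have brho : ba rho by exact: ba_sub.
have Trho : T rho = rho by rewrite markov_opB // Te Te'.
have crho := M_ba_ca brho Trho.
have rho0 : rho setT = 0 by rewrite /rho submE e1 e'1 subrr.
have rhoN0 : rho <> 0 by move/eqP; rewrite subr_eq0 => /eqP.
have [P [mP ia ib rP rPC]] := split_mass0 crho Trho rho0 rhoN0.
have mPC : measurable (~` P) by exact: measurableC.
have aE : restr_to rho P = rho P *: e.
  have -> : rho P = restr_to rho P setT by rewrite restr_toE // setTI.
  apply: ae => // B mB; have mBP : measurable (B `&` P) by exact: measurableI.
  rewrite restr_toE // /rho submE; apply: (@le_trans _ _ (e (B `&` P))).
    by have := e'0 _ mBP; lra.
  exact: ba_le.
have bE : - restr_to rho (~` P) = rho P *: e'.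
  have -> : rho P = (- restr_to rho (~` P)) setT.
    by rewrite oppmE restr_toE // setTI rPC opprK.
  apply: ae' => // B mB; have mBP : measurable (B `&` ~` P) by exact: measurableI.
  rewrite oppmE restr_toE // /rho submE; apply: (@le_trans _ _ (e' (B `&` ~` P))).
    by have := e0 _ mBP; lra.
  exact: ba_le.
exists P; split => //.
  have := congr1 (fun m => m (~` P)) aE; rewrite /= scalemE restr_toE // setICl ba_set0 //.
  move/esym/eqP; rewrite mulf_eq0 gt_eqF //= -setTD (baD be) // e1 subr_eq0.
  by move/eqP.
have := congr1 (fun m => m P) bE; rewrite /= scalemE oppmE restr_toE // setICr ba_set0 //.
by rewrite oppr0 => /esym/eqP; rewrite mulf_eq0 gt_eqF //= => /eqP.
Qed.

(** Countable intersections of pairwise separating sets give infinitely many atoms disjoint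
    carriers, which [no_disjoint_sequence] excludes. *)
Lemma finite_atoms : finite_set [set e | atom e].
Proof.
apply: contrapT => /infiniteP/pcard_leP[f].
have af n : atom (f n) by have := @funS _ _ _ _ f n Logic.I.
have nf i j : i != j -> f i <> f j.
  by move=> ij fij; move: ij; rewrite (@inj _ _ _ f i j) ?eqxx // inE.
have pf n : ba_prob (f n) by case: (af n).
have Tf n : T (f n) = f n by case: (af n).
have cf n : ca (f n) by exact: inv_ca.
have /choice[H HH] (ij : nat * nat) : exists P, measurable P /\
    (ij.1 != ij.2 -> f ij.1 P = 1 /\ f ij.2 P = 0).
  have [eq|ne] := eqVneq ij.1 ij.2; first by exists setT.
  have [P [mP P1 P2]] := atoms_separated (af _) (af _) (nf _ _ ne).
  by exists P; split.
(* Each unordered pair uses one separating set, so that G i j and G j i are complementary for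
   distinct i and j. *)
pose G i j := if i == j then setT else if (i < j)%N then H (i, j) else ~` H (j, i).
have mG i j : measurable (G i j).
  rewrite /G; case: ifP => // _; case: ifP => _; first by case: (HH (i, j)).
  by apply: measurableC; case: (HH (j, i)).
have fG i j : f i (G i j) = 1.
  rewrite /G; case: eqVneq => [_|ij]; first by case: (pf i).
  case: ifP => _; first by case: (HH (i, j)) => _ /(_ ij)[].
  have ji : j != i by rewrite eq_sym.
  have [mH /(_ ji)[_ H0]] := HH (j, i); have [bf _ f1] := pf i.
  by rewrite -setTD (baD bf) // f1 H0 subr0.
apply: (@no_disjoint_sequence f (fun i => \bigcap_j G i j)) => //.
- by move=> i; exact: bigcap_measurable.
- by move=> i; exact: prob_bigcap.
- move=> m n x mn Dm Dn; have := Dm n Logic.I; have := Dn m Logic.I.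
  rewrite /G eq_sym (ltn_eqF mn) mn ltnNge (ltnW mn) /=; exact.
Qed.

(** Greedy subtraction of the largest multiple of each atom; the last clause records that nothing
    more can be taken from the remainder. *)
Lemma subtract_atoms (s : seq (set X -> R)) nu : uniq s ->
  (forall e, e \in s -> ba_prob e /\ T e = e) -> pos_invariant nu ->
  exists nu' (c : (set X -> R) -> R), [/\ pos_invariant nu', pos_charge (nu - nu'),
    nu = nu' + \sum_(e <- s) c e *: e &
    forall e (t : R), e \in s -> 0 < t -> ~ (forall B, measurable B -> t * e B <= nu' B)].
Proof.
elim: s nu => [|e s IHs] nu /=.
  move=> _ _ inu; exists nu, (fun=> 0); split => //; last by rewrite big_nil addr0.
  by move=> B mB; rewrite submE subrr.
move=> /andP[es us] Hs inu; have [bnu nu0 Tnu] := inu.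
have [pe Te] := Hs e (mem_head _ _); have [be e0 e1] := pe.
pose S := [set t : R | 0 <= t /\ forall B, measurable B -> t * e B <= nu B].
have S0 : S 0 by split=> // B mB; rewrite mul0r nu0.
have SM : ubound S (nu setT) by move=> t [_ /(_ _ measurableT)]; rewrite e1 mulr1.
have hS : has_sup S by split; [exists 0|exists (nu setT)].
pose c0 := sup S.
have c00 : 0 <= c0 by apply: ub_le_sup => //; exact: hS.2.
(* The supremum is attained, because e(B) <= 1 makes the constraint on t continuous uniformly in
   B. *)
have c0le B : measurable B -> c0 * e B <= nu B.
  move=> mB; apply/ler_addgt0Pr => eps eps0.
  have [t St ct] := sup_adherent eps0 hS; have [t0 tS] := St.
  have eB1 := prob_le1 pe mB; have eB0 := e0 _ mB.
  have := tS _ mB.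
  have : (c0 - t) * e B <= eps * 1.
    have ct0 : 0 <= c0 - t by rewrite subr_ge0; exact: (ub_le_sup hS.2 St).
    by apply: ler_pM => //; rewrite /c0; lra.
  by lra.
pose nu1 := nu - c0 *: e.
have i1 : pos_invariant nu1.
  split; first by apply: ba_sub => //; exact: baZ.
    by move=> B mB; rewrite /nu1 submE scalemE subr_ge0 c0le.
  by rewrite /nu1 markov_opB ?markov_opZ ?Te ?Tnu //; exact: baZ.
have [|nu' [c [inu' nu'le nu1E nu'N]]] := IHs nu1 us _ i1.
  by move=> x xs; apply: Hs; rewrite in_cons xs orbT.
exists nu', (fun x => if x == e then c0 else c x); split => //.
- move=> B mB; have := nu'le _ mB; rewrite !submE /nu1 submE scalemE.
  have : 0 <= c0 * e B by rewrite mulr_ge0 // e0.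
  lra.
- rewrite big_cons eqxx.
  rewrite (eq_big_seq (fun x => c x *: x)); last first.
    by move=> x xs; case: eqVneq => // xe; rewrite -xe xs in es.
  by rewrite addrCA -nu1E /nu1 addrC subrK.
- move=> x t; rewrite in_cons => /predU1P[->|xs] t0 tx; last exact: (nu'N x t xs t0 tx).
  (* Later subtractions only lower the remainder, so a multiple t e still below nu' could have been
     added to c0 at this stage. *)
  have : S (c0 + t).
    split=> [|B mB]; first by rewrite addr_ge0 // ltW.
    have := tx _ mB; have := nu'le _ mB; rewrite submE /nu1 submE scalemE.
    lra.
  by move=> /(ub_le_sup hS.2); rewrite -/c0; lra.
Qed.

Lemma has_dim_M_ba : exists n, has_dim (M_ba p) n.
Proof.
have /finite_seqP[s0 s0E] := finite_atoms.
pose s := undup s0.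
have us : uniq s by exact: undup_uniq.
have sP e : e \in s <-> atom e.
  rewrite mem_undup; have -> : atom e = [set e | atom e] e by [].
  by rewrite s0E.
have sprob e : e \in s -> ba_prob e /\ T e = e by move=> /sP[].
have spanpos nu : pos_invariant nu ->
    exists c : (set X -> R) -> R, nu = \sum_(e <- s) c e *: e.
  move=> inu; have [nu' [c [inu' _ nuE nu'N]]] := subtract_atoms us sprob inu.
  exists c; rewrite {1}nuE; suff -> : nu' = 0 by rewrite add0r.
  have [b' n0' _] := inu'; apply: pos_mass0 => //; apply/eqP; apply: contrapT => /negP m0.
  have [pn Tn] := pos_invariant_normalize inu' m0.
  (* A nonzero remainder, once normalised, dominates some atom e with constant C, so it lies above
     (nu' setT / C) e, which maximality forbids. *)
  have [e ae [C C0 dC]] := dominates_atom pn Tn.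
  have mp : 0 < nu' setT by rewrite lt0r m0 n0'.
  apply: (nu'N e (nu' setT / C)); [exact/sP|exact: divr_gt0|].
  move=> B mB; have := dC _ mB; rewrite scalemE => H.
  rewrite mulrAC ler_pdivrMr // [leRHS]mulrC.
  by rewrite mulrCA in H; move: H; rewrite -ler_pdivlMl // mulrC.
pose x0 : set X -> R := 0.
exists (size s), (fun i : 'I_(size s) => nth x0 s i).
have sumE (c : (set X -> R) -> R) :
    \sum_(e <- s) c e *: e = \sum_(i < size s) c (nth x0 s i) *: nth x0 s i.
  by rewrite (big_nth x0) big_mkord.
split.
- move=> i; have /sP[[be _ _] Te _] := mem_nth x0 (ltn_ord i).
  by split.
- move=> c c0 i.
  (* Sets for testing independence: on the intersection D of the chosen ones, the i-th atom has mass
     1 and every other atom mass 0, so evaluation at D isolates c i. *)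
  pose G j := [set P | measurable P /\ nth x0 s i P = 1 /\ (i != j -> nth x0 s j P = 0)].
  have /choice[H HH] (j : 'I_(size s)) : exists P, G j P.
    have [eq|ne] := eqVneq i j.
      exists setT; split=> //; split; first by have /sP[[]] := mem_nth x0 (ltn_ord i).
      by rewrite eq eqxx.
    have nE : nth x0 s i <> nth x0 s j.
      by move/eqP; rewrite nth_uniq // => /eqP/val_inj ij; rewrite ij eqxx in ne.
    have [P [mP P1 P2]] := atoms_separated (iffLR (sP _) (mem_nth x0 (ltn_ord i)))
      (iffLR (sP _) (mem_nth x0 (ltn_ord j))) nE.
    by exists P.
  have [pi _ _] : atom (nth x0 s i) by apply/sP; exact: mem_nth.
  pose D := \big[setI/setT]_(j < size s) H j.
  have [mD D1] : measurable D /\ nth x0 s i D = 1.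
    rewrite /D; elim/big_ind: _ => [|A B [mA A1] [mB B1]|j _].
    - by split => //; case: pi.
    - by split; [exact: measurableI|exact: prob_setI].
    - by have [? []] := HH j.
  have D0 j : i != j -> nth x0 s j D = 0.
    move=> ij; have [mH [_ /(_ ij) H0]] := HH j.
    have [[bj j0 _] _ _] : atom (nth x0 s j) by apply/sP; exact: mem_nth.
    apply/eqP; rewrite eq_le j0 // andbT -H0; apply: ba_le => //.
    by rewrite /D (bigD1 j) //=; exact: subIsetl.
  have := congr1 (fun m : set X -> R => m D) c0; rewrite /= summE (bigD1 i) //= big1.
    by rewrite addr0 scalemE D1 mulr1.
  by move=> j ji; rewrite scalemE D0 ?mulr0 // eq_sym.
- move=> mu [bmu Tmu]; have [nu1 [nu2 [i1 i2 ->]]] := invariant_pos_part bmu Tmu.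
  have [c1 ->] := spanpos _ i1; have [c2 ->] := spanpos _ i2.
  exists (fun i => c1 (nth x0 s i) - c2 (nth x0 s i)).
  rewrite !sumE -sumrB; apply: eq_bigr => i _.
  by rewrite scalerBl.
Qed.

End dimension.

(** * Convergence of the suprema and conclusion *)

Lemma cvge0 (R : realType) (u : nat -> \bar R) : (forall n, (0 <= u n)%E) ->
  (forall e : R, 0 < e -> exists N, forall n, (N <= n)%N -> (u n <= e%:E)%E) ->
  u n @[n --> \oo] --> 0%E.
Proof.
move=> u0 ue; apply/fine_cvgP; split.
  have [N HN] := ue _ ltr01; exists N => // n /= Nn.
  by rewrite ge0_fin_numE // (le_lt_trans (HN _ Nn)) // ltry.
apply/cvgrPdist_le => e e0; have [N HN] := ue _ e0; exists N => // n /= Nn.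
have fn : u n \is a fin_num by rewrite ge0_fin_numE // (le_lt_trans (HN _ Nn)) // ltry.
rewrite sub0r normrN ger0_norm ?fine_ge0 // -lee_fin fineK //.
exact: HN.
Qed.

Lemma tv_norm_ge0 (R : realType) (d : measure_display) (X : measurableType d)
  (mu : set X -> R) : ba mu -> (0 <= tv_norm mu)%E.
Proof.
move=> /tv_norm_fin[V [-> /tvle_ge0]] => ?; by rewrite lee_fin.
Qed.

Theorem theorem4p5 (R : realType) (d : measure_display) (X : measurableType d)
    (p : R.-pker X ~> X)
    (X_infinite : infinite_set [set: X])
    (measurable_singleton : forall x : X, measurable [set x])
    (Delta_ba_sub_ca : Delta_ba p `<=` ca) :
  exists n : nat,
    [/\ has_dim (M_ba p) n, has_dim (M_ca p) n &
      exists E : (set X -> R) -> set X -> R,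
        [/\ spectral_projector ca (markov_op p) 1 E,
            E @` ca = M_ca p,
            op_norm ca (fun mu => cesaro_mean (markov_op p) k mu - E mu)
              @[k --> \oo] --> 0%E &
            ereal_sup [set tv_norm (cesaro_mean (markov_op p) k mu - E mu)
                      | mu in S_ca] @[k --> \oo] --> 0%E]].
Proof.
have inv_ca (mu : set X -> R) : ba_prob mu -> markov_op p mu = mu -> ca mu.
  by move=> /S_baP Smu Tmu; exact: Delta_ba_sub_ca.
have [n dim_ba] := has_dim_M_ba inv_ca.
have M_caE : M_ca p = M_ba p.
  apply/seteqP; split=> mu [cmu Tmu]; split => //; first exact: ca_ba.
  exact: M_ba_ca Tmu.
have spec := spectral_limit_op inv_ca.
have cb (k : nat) (mu : set X -> R) : ca mu ->
    ba (cesaro_mean (markov_op p) k mu - limit_op p mu).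
  by move=> cmu; apply: ca_ba; apply: caB; [exact: cesaro_ca|exact: limit_op_ca].
have unif (e : R) : 0 < e -> exists N, forall k, (N <= k)%N -> forall mu, ca mu ->
    (tv_norm mu <= 1)%E ->
    (tv_norm (cesaro_mean (markov_op p) k mu - limit_op p mu)%R <= e%:E)%E.
  move=> e0; have [N HN] := limit_op_uniform inv_ca e0; exists N => k Nk mu cmu mu1.
  by apply/tvleP; rewrite -[e]mulr1; apply: HN => //; exact/tvleP.
exists n; split => //; first by rewrite M_caE.
exists (limit_op p); split => //.
- have [_ _ [-> _] _ _] := spec.
  by apply/seteqP; split=> mu [cmu]; rewrite ?scale1r => Tmu; split => //; rewrite scale1r.
- apply: cvge0 => [k|e e0].
    (* The supremum is nonnegative because it is at least its term at the zero measure. *)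
    apply: (@le_trans _ _ (tv_norm (cesaro_mean (markov_op p) k 0 - limit_op p 0))).
      by apply: tv_norm_ge0; apply: cb; exact: ca0.
    apply: ereal_sup_ubound; exists 0 => //; split; first exact: ca0.
    by apply/tvleP; exact: tvle0.
  have [N HN] := unif _ e0; exists N => k Nk.
  by apply: ge_ereal_sup => _ [mu [cmu mu1] <-]; exact: HN.
- apply: cvge0 => [k|e e0].
    (* The zero measure is not in [S_ca]; a Dirac mass shows that the supremum is not over the empty
       set. *)
    have cd : ca (dirac_fun point : set X -> R) by exact: dirac_ca.
    apply: (@le_trans _ _ (tv_norm (cesaro_mean (markov_op p) k (dirac_fun point)
                                    - limit_op p (dirac_fun point)))).
      by apply: tv_norm_ge0; exact: cb.
    apply: ereal_sup_ubound; exists (dirac_fun point) => //; split => //.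
    by apply/S_baP; exact: dirac_prob.
  have [N HN] := unif _ e0; exists N => k Nk.
  apply: ge_ereal_sup => _ [mu [[_ _ mu1] cmu] <-]; apply: HN => //.
  by rewrite mu1.
Qed.
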